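(* For any $\Lambda^+$-valued divisor $D$ on $\mathbb P^1$ satisfying Assumption (A), the type $C_r$ matrix $\mathsf T_D(z):=T_D(z)/Z_0(z)$ is regular in $z$: $\mathsf T_D(z)\in\mathcal A[z]\otimes_{\mathbb C}\mathrm{End}\,\mathbb C^{2r}$.
   Context: Let $r$ be a positive integer, $N=2r$, $i'=N+1-i$. **Divisors.** $\Lambda=\bigoplus_{j=1}^{r+1}\mathbb Z\epsilon_j$ with dual basis $\epsilon_j^\vee$; $\Lambda^+=\{\mu:(\epsilon_i^\vee-\epsilon_{i+1}^\vee)(\mu)\ge0,\ 1\le i\le r\}$; $\varpi_i=-\epsilon_{i+1}-\dots-\epsilon_{r+1}$ ($0\le i\le r$). A $\Lambda^+$-valued divisor on $\mathbb P^1$ is a formal sum $D=\sum_{s=1}^M\gamma_s\varpi_{i_s}[x_s]+\mu[\infty]$ with $0\le i_s\le r$, $x_s\in\mathbb C$, $\gamma_s=1$ if $i_s\ne0$, $\gamma_s\in\{\pm1\}$ if $i_s=0$, and $\mu\in\Lambda^+$. Put $\lambda=\sum_s\gamma_s\varpi_{i_s}$. Assumption (A): $\lambda+\mu=\sum_{i=1}^ra_i\hat\alpha_i$ with $a_i\in\mathbb Z_{\ge0}$, where $\hat\alpha_i=\epsilon_i-\epsilon_{i+1}$ ($i\le r-2$), $\hat\alpha_{r-1}=\epsilon_{r-1}-\epsilon_r+\epsilon_{r+1}$, $\hat\alpha_r=\epsilon_r-\epsilon_{r+1}$. **Oscillators.** $\mathcal A$ is the $\mathbb C$-algebra generated by $p_{i,k},e^{\pm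 q_{i,k}}$ ($1\le i\le r$, $1\le k\le a_i$) and $(p_{i,k}-p_{i,\ell}+m)^{-1}$ ($k\ne\ell$, $m\in\mathbb Z$) with $[e^{\pm q_{i,k}},p_{j,\ell}]=\mp c_i\delta_{i,j}\delta_{k,\ell}e^{\pm q_{i,k}}$, where $c_i=1$ for $i<r$ and $c_r=2$, all $p$'s commuting, all $e^q$'s commuting, $e^{\pm q_{i,k}}e^{\mp q_{i,k}}=1$. $P_j(z)=\prod_{k=1}^{a_j}(z-p_{j,k})$, $P_{j,\ell}(z)=\prod_{k\ne\ell}(z-p_{j,k})$, $P_0=1$, $Z_i(z)=\prod_{s:i_s=i}(z-x_s)^{\gamma_s}$ ($0\le i\le r$). **The matrix $T_D(z)$.** Rational functions of $z$ are expanded in $z^{-1}$. $T_D(z)=F^D(z)H^D(z)E^D(z)$, where $F^D$ is lower unitriangular with entries $f_{j,i}(z)$, $H^D=\mathrm{diag}(h_1,\dots,h_{2r})$, $E^D$ is upper unitriangular with entries $e_{i,j}(z)$, determined as follows. Write $e_i=e_{i,i+1}$, $f_i=f_{i+1,i}$ ($1\le i\le r$), and $g^{(1)}$ for the coefficient of $z^{-1}$ in $g(z)$. Basic entries: $e_i(z)=\sum_{k=1}^{a_i}\frac{P_{i-1}(p_{i,k}-1)}{(z-p_{i,k})P_{i,k}(p_{i,k})}e^{q_{i,k}}$ ($i<r$), $e_r(z)=\sum_{k=1}^{a_r}\frac{P_{r-1}(p_{r,k}-1)P_{r-1}(p_{r,k}-2)}{(z-p_{r,k})P_{r,k}(p_{r,k})}e^{q_{r,k}}$;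 $f_i(z)=-\sum_{k=1}^{a_i}\frac{Z_i(p_{i,k}+1)P_{i+1}(p_{i,k}+1)}{(z-p_{i,k}-1)P_{i,k}(p_{i,k})}e^{-q_{i,k}}$ ($i<r$), $f_r(z)=-\sum_{k=1}^{a_r}\frac{Z_r(p_{r,k}+2)}{(z-p_{r,k}-2)P_{r,k}(p_{r,k})}e^{-q_{r,k}}$; $h_i=\frac{P_i(z)}{P_{i-1}(z-1)}\prod_{k=0}^{i-1}Z_k(z)$ ($i\le r$), $h_{r+1}=\frac{P_{r-1}(z-2)}{P_r(z-2)}\prod_{k=0}^rZ_k(z)$. Remaining entries: $h_{i'}(z)=\frac1{h_i(z+i-r-1)}\prod_{j=i+1}^{r-1}\frac{h_j(z+j-r-2)}{h_j(z+j-r-1)}\,h_r(z-2)h_{r+1}(z)$ ($i\le r-1$); $e_{(i+1)',i'}(z)=-e_i(z+i-r-1)$ ($i\le r-1$); $e_{i,j+1}=-[e_{i,j},e_j^{(1)}]$ and $e_{i,j'}=[e_{i,(j+1)'},e_j^{(1)}]$ ($i<j\le r-1$); $e_{i,r'}=-\frac12[e_{i,r},e_r^{(1)}]$ ($i\le r-1$); $e_{i',j'}=[e_{i',(j+1)'},e_j^{(1)}]$ and $e_{i,j'}=[e_{i,(j+1)'},e_j^{(1)}]$ ($1\le j\le i-2\le r-2$); $e_{i,i'}=[e_{i,(i+1)'},e_i^{(1)}]-e_ie_{i,(i+1)'}$ and $e_{i+1,i'}=[e_{i+1,(i+1)'},e_i^{(1)}]+e_ie_{i+1,(i+1)'}-e_{i,(i+1)'}$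 ($i\le r-1$); $f_{i',(i+1)'}(z)=-f_i(z+i-r-1)$ ($i\le r-1$); $f_{j+1,i}=-[f_j^{(1)},f_{j,i}]$ and $f_{j',i}=[f_j^{(1)},f_{(j+1)',i}]$ ($i<j\le r-1$); $f_{r',i}=-\frac12[f_r^{(1)},f_{r,i}]$ ($i\le r-1$); $f_{j',i'}=[f_j^{(1)},f_{(j+1)',i'}]$ and $f_{j',i}=[f_j^{(1)},f_{(j+1)',i}]$ ($1\le j\le i-2\le r-2$); $f_{i',i}=[f_i^{(1)},f_{(i+1)',i}]-f_{(i+1)',i}f_i$ and $f_{i',i+1}=[f_i^{(1)},f_{(i+1)',i+1}]+f_{(i+1)',i+1}f_i-f_{(i+1)',i}$ ($i\le r-1$). (All series in the same variable $z$ unless indicated.) *)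

(* Defs.v *)
From HB Require Import structures.
From mathcomp Require Import all_boot all_order all_algebra.
From mathcomp Require Import boolp classical_sets fsbigop.
From mathcomp Require Import zify ring.

Set Implicit Arguments.
Unset Strict Implicit.
Unset Printing Implicit Defensive.

Import Order.TTheory GRing.Theory Num.Theory.
Local Open Scope ring_scope.

Section LaurentDef.
Variable A : nzRingType.

(* Laurent series in [z^-1] with coefficients in [A]: the coefficients of
   [z ^ n] vanish for all large [n]. *)
Definition lbounded (u : int -> A) : Prop :=
  exists N : int, forall n, N < n -> u n = 0.

(* [lcoef f n] is the coefficient of [z ^ n]. *)
Record laurent := Laurent {
  lcoef :> int -> A;
  lcoefP : lbounded lcoef
}.

Lemma laurentP (f g : laurent) : f =1 g -> f = g.
Proof.
case: f g => [u pu] [v pv] /= /funext uv.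
by case: _ / uv pv => pv; congr Laurent; apply: Prop_irrelevance.
Qed.

HB.instance Definition _ := gen_eqMixin laurent.
HB.instance Definition _ := gen_choiceMixin laurent.

Definition nbounded (u : int -> A) (B : nat) :=
  forall n : int, B%:Z < n -> u n = 0.

Lemma nboundedP u : lbounded u -> exists B, nbounded u B.
Proof.
case=> N hN; exists `|N|%N => n Nn; apply: hN.
by apply: le_lt_trans Nn; lia.
Qed.

Lemma nboundedW u B B' : (B <= B')%N -> nbounded u B -> nbounded u B'.
Proof. by move=> BB hu n hn; apply: hu; lia. Qed.

Lemma nbounded_l u B : nbounded u B -> lbounded u.
Proof. by exists B%:Z. Qed.

Fact lzero_subproof : lbounded (fun _ => 0).
Proof. by exists 0. Qed.
Definition lzero := Laurent lzero_subproof.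

Fact lopp_subproof (f : laurent) : lbounded (fun n => - f n).
Proof. by case: (lcoefP f) => N h; exists N => n /h ->; rewrite oppr0. Qed.
Definition lopp f := Laurent (lopp_subproof f).

Fact ladd_subproof (f g : laurent) : lbounded (fun n => f n + g n).
Proof.
have [B hB] := nboundedP (lcoefP f); have [C hC] := nboundedP (lcoefP g).
exists (B + C)%N%:Z => n hn.
by rewrite hB ?hC ?addr0 //; lia.
Qed.
Definition ladd f g := Laurent (ladd_subproof f g).

Fact laddA : associative ladd.
Proof. by move=> f g h; apply: laurentP => n /=; rewrite addrA. Qed.
Fact laddC : commutative ladd.
Proof. by move=> f g; apply: laurentP => n /=; rewrite addrC. Qed.
Fact ladd0 : left_id lzero ladd.
Proof. by move=> f; apply: laurentP => n /=; rewrite add0r. Qed.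
Fact laddN : left_inverse lzero lopp ladd.
Proof. by move=> f; apply: laurentP => n /=; rewrite addNr. Qed.

HB.instance Definition _ :=
  GRing.isZmodule.Build laurent laddA laddC ladd0 laddN.

Fact lmon_subproof (a : A) (m : int) : lbounded (fun n => a *+ (n == m)).
Proof. by exists m => n mn; rewrite gt_eqF. Qed.
(* The monomial [a * z ^ m]. *)
Definition lmon a m := Laurent (lmon_subproof a m).

(* Finitely many terms of the sum are non-zero when u and v are bounded. *)
Definition lconv (u v : int -> A) (n : int) : A :=
  \sum_(i \in [set: int]) u i * v (n - i).

Definition zint (N : nat) : seq int := [seq k%:Z - N%:Z | k <- iota 0 (N + N).+1].

Lemma mem_zint N (i : int) : (i \in zint N) = (`|i| <= N)%N.
Proof.
apply/mapP/idP => [[k]|iN]; first by rewrite mem_iota => hk ->; lia.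
by exists (absz (i + N%:Z)); rewrite ?mem_iota; lia.
Qed.

Lemma zint_uniq N : uniq (zint N).
Proof. by rewrite map_inj_uniq ?iota_uniq // => x y; lia. Qed.

Lemma fsumE (F : int -> A) N : (forall i, (N < `|i|)%N -> F i = 0) ->
  \sum_(i \in [set: int]) F i = \sum_(i <- zint N) F i.
Proof.
move=> F0; rewrite (fsbigE (zint N)) ?zint_uniq //=.
  by apply: eq_bigl => i; rewrite in_setT.
by move=> i _; rewrite mem_zint -ltnNge; exact: F0.
Qed.

Lemma lconvE u v B n N : nbounded u B -> nbounded v B -> (`|n| + B <= N)%N ->
  lconv u v n = \sum_(i <- zint N) u i * v (n - i).
Proof.
move=> hu hv nN; apply: fsumE => i iN.
have [iB|] := ltP B%:Z i; first by rewrite hu ?mul0r.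
by move=> iB; rewrite hv ?mulr0 //; lia.
Qed.

Lemma lconv_nbounded u v B : nbounded u B -> nbounded v B ->
  nbounded (lconv u v) (B + B).
Proof.
move=> hu hv n hn; apply: fsbig1 => i _.
have [iB|] := ltP B%:Z i; first by rewrite hu ?mul0r.
by move=> iB; rewrite hv ?mulr0 //; lia.
Qed.

Lemma common_bound (f g h : laurent) :
  exists B, [/\ nbounded f B, nbounded g B & nbounded h B].
Proof.
have [B hB] := nboundedP (lcoefP f); have [C hC] := nboundedP (lcoefP g).
have [D hD] := nboundedP (lcoefP h); exists (B + C + D)%N.
by split; [move: hB|move: hC|move: hD]; apply: nboundedW; lia.
Qed.

Fact lmul_subproof (f g : laurent) : lbounded (lconv f g).
Proof.
have [B [hf hg _]] := common_bound f g f.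
exact: nbounded_l (lconv_nbounded hf hg).
Qed.
Definition lmul f g := Laurent (lmul_subproof f g).

Fact lmulA : associative lmul.
Proof.
move=> f g h; apply: laurentP => n /=.
have [B [hf hg hh]] := common_bound f g h.
pose N := (`|n| + 2 * B)%N.
pose S := \sum_(i <- zint N) \sum_(j <- zint N) f j * (g (i - j) * h (n - i)).
transitivity S; last first.
  rewrite /S /lconv (@fsumE _ N); last first.
    move=> i iN; have [nB|] := ltP B%:Z (n - i); first by rewrite hh ?mulr0.
    move=> nB; rewrite [X in X * _]fsbig1 ?mul0r// => j _.
    have [jB|jB] := ltP B%:Z j; first by rewrite hf ?mul0r.
    by rewrite hg ?mulr0 //; rewrite /N in iN; lia.
  apply: eq_bigr => i _.
  have [nB|nB] := ltP B%:Z (n - i).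
    by rewrite hh // mulr0 big1 // => j _; rewrite !mulr0.
  rewrite (@fsumE _ N) ?mulr_suml; first by apply: eq_bigr => j _; rewrite mulrA.
  move=> j jN; have [jB|jB] := ltP B%:Z j; first by rewrite hf ?mul0r.
  by rewrite hg ?mulr0 //; rewrite /N in jN; lia.
rewrite /S exchange_big /lconv (@fsumE _ N) /=; last first.
  move=> j jN; have [jB|jB] := ltP B%:Z j; first by rewrite hf ?mul0r.
  rewrite [X in _ * X]fsbig1 ?mulr0// => k _.
  have [kB|kB] := ltP B%:Z k; first by rewrite hg ?mul0r.
  by rewrite hh ?mulr0 //; rewrite /N in jN; lia.
apply: eq_bigr => j _.
have [jB|jB] := ltP B%:Z j.
  by rewrite hf // mul0r big1 // => i _; rewrite mul0r.
rewrite -mulr_sumr; congr (_ * _).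
rewrite (reindex_fsbigT (fun i => i - j)) /=; last first.
  by exists (fun i => i + j) => i; rewrite ?subrK ?addrK.
rewrite (@fsumE _ N).
  by apply: eq_bigr => i _; congr (_ * h _); lia.
move=> i iN; have [iB|iB] := ltP B%:Z (i - j); first by rewrite hg ?mul0r.
by rewrite hh ?mulr0 //; rewrite /N in iN; lia.
Qed.

Lemma fsum1 (F : int -> A) m : (forall i, i != m -> F i = 0) ->
  \sum_(i \in [set: int]) F i = F m.
Proof.
move=> F0; rewrite (fsbigE [:: m]) //= ?big_seq1_id.
  by rewrite big_cons big_nil in_setT addr0.
by move=> i _; rewrite inE; exact: F0.
Qed.

Lemma lmonM a m (f : laurent) n : lmul (lmon a m) f n = a * f (n - m).
Proof.
rewrite /= /lconv (@fsum1 _ m); first by rewrite eqxx.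
by move=> i /negPf->; rewrite mul0r.
Qed.

Lemma mullmon a m (f : laurent) n : lmul f (lmon a m) n = f (n - m) * a.
Proof.
rewrite /= /lconv (@fsum1 _ (n - m)).
  by rewrite (_ : n - (n - m) == m) //; apply/eqP; lia.
move=> i im; rewrite (_ : n - i == m = false) ?mulr0 //.
by apply: contra_neqF im => /eqP; lia.
Qed.

Fact lmul1l : left_id (lmon 1 0) lmul.
Proof. by move=> f; apply: laurentP => n; rewrite lmonM mul1r subr0. Qed.
Fact lmul1r : right_id (lmon 1 0) lmul.
Proof. by move=> f; apply: laurentP => n; rewrite mullmon mulr1 subr0. Qed.

Fact lmulDl : left_distributive lmul +%R.
Proof.
move=> f g h; apply: laurentP => n /=.
have [B [hf hg hh]] := common_bound f g h.
rewrite !(@lconvE _ _ B _ (`|n| + B)) //.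
  by rewrite -big_split /=; apply: eq_bigr => i _; rewrite mulrDl.
by move=> i iB; rewrite /= hf ?hg ?addr0.
Qed.

Fact lmulDr : right_distributive lmul +%R.
Proof.
move=> f g h; apply: laurentP => n /=.
have [B [hf hg hh]] := common_bound f g h.
rewrite !(@lconvE _ _ B _ (`|n| + B)) //.
  by rewrite -big_split /=; apply: eq_bigr => i _; rewrite mulrDr.
by move=> i iB; rewrite /= hg ?hh ?addr0.
Qed.

Fact lone_neq0 : lmon 1 0 != 0.
Proof.
apply/eqP => /(congr1 (fun f : laurent => f 0)) /=.
by move/eqP; rewrite oner_eq0.
Qed.

HB.instance Definition _ := GRing.Zmodule_isNzRing.Build laurent
  lmulA lmul1l lmul1r lmulDl lmulDr lone_neq0.

(* The inverse is chosen classically: [f^-1] is the two-sided inverse of [f]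
   when there is one, and [f] otherwise. *)
Definition lunit : pred laurent :=
  fun f => `[< exists g : laurent, g * f = 1 /\ f * g = 1 >].
Definition linv (f : laurent) : laurent :=
  if pselect (exists g : laurent, g * f = 1 /\ f * g = 1) is left e
  then projT1 (cid e) else f.

Fact lmulV : {in lunit, left_inverse 1 linv *%R}.
Proof.
move=> f /asboolP e; rewrite /linv; case: pselect => // e'.
by case: cid => g /= [].
Qed.
Fact lmulrV : {in lunit, right_inverse 1 linv *%R}.
Proof.
move=> f /asboolP e; rewrite /linv; case: pselect => // e'.
by case: cid => g /= [].
Qed.
Fact lunitP (f g : laurent) : g * f = 1 /\ f * g = 1 -> lunit f.
Proof. by move=> h; apply/asboolP; exists g. Qed.
Fact linv_out : {in [predC lunit], linv =1 id}.
Proof.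
by move=> f /asboolPn e; rewrite /linv; case: pselect => // e'; case: e.
Qed.

HB.instance Definition _ := GRing.NzRing_hasMulInverse.Build laurent
  lmulV lmulrV lunitP linv_out.

Definition lcst (x : A) : laurent := lmon x 0.
Definition lz : laurent := lmon 1 1.

Fact lcst_zmod : zmod_morphism lcst.
Proof. by move=> x y; apply: laurentP => n /=; rewrite mulrnBl. Qed.
Fact lcst_monoid : monoid_morphism lcst.
Proof.
split=> // x y; apply: laurentP => n.
by rewrite [RHS](lmonM x 0) /= subr0 mulrnAr.
Qed.
HB.instance Definition _ :=
  GRing.isZmodMorphism.Build A laurent lcst lcst_zmod.
HB.instance Definition _ :=
  GRing.isMonoidMorphism.Build A laurent lcst lcst_monoid.

(* The embedding of [A[z]] into Laurent series in [z^-1]. *)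
Definition lpoly (q : {poly A}) : laurent := (map_poly lcst q).[lz].

End LaurentDef.

Arguments lz {A}.

Local Open Scope quotient_scope.

Section Oscillators.
Variables (K : numClosedFieldType) (r : nat) (a : nat -> nat).

(* [Op k], [Oq true k], [Oq false k] and [Oinv _ m] (for k != l in 'I_(a i))
   stand for p_{i,k}, e^{q_{i,k}}, e^{-q_{i,k}} and (p_{i,k} - p_{i,l} + m)^-1.
   Colours i are numbered as usual from 1 to r; a i = 0 for the other ones, so
   that these contribute no generator.  The index k is numbered from 0. *)
Inductive oterm : Type :=
| Ocst of K
| Oadd of oterm & oterm
| Omul of oterm & oterm
| Op (i : nat) of 'I_(a i)
| Oq (s : bool) (i : nat) of 'I_(a i)
| Oinv (i : nat) (k l : 'I_(a i)) of k != l & int.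

Definition ocoef (i : nat) : int := if i == r then 2 else 1.

Definition osgn (s : bool) : int := if s then 1 else -1.

Definition osub (t u : oterm) := Oadd t (Omul (Ocst (-1)) u).
Definition ocomm (t u : oterm) := osub (Omul t u) (Omul u t).

(* The congruence of K-algebras generated by the defining relations (from [Opp]
   on). *)
Inductive orel : oterm -> oterm -> Prop :=
| Orefl t : orel t t
| Osym t u : orel t u -> orel u t
| Otrans t u v : orel t u -> orel u v -> orel t v
| OaddC' t t' u u' : orel t t' -> orel u u' -> orel (Oadd t u) (Oadd t' u')
| OmulC' t t' u u' : orel t t' -> orel u u' -> orel (Omul t u) (Omul t' u')
| OaddA t u v : orel (Oadd t (Oadd u v)) (Oadd (Oadd t u) v)
| OaddC t u : orel (Oadd t u) (Oadd u t)
| Oadd0 t : orel (Oadd (Ocst 0) t) t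
| OaddN t : orel (osub t t) (Ocst 0)
| OmulA t u v : orel (Omul t (Omul u v)) (Omul (Omul t u) v)
| Omul1 t : orel (Omul (Ocst 1) t) t
| OmulDl t u v : orel (Omul (Oadd t u) v) (Oadd (Omul t v) (Omul u v))
| OmulDr t u v : orel (Omul t (Oadd u v)) (Oadd (Omul t u) (Omul t v))
| OcstD c d : orel (Oadd (Ocst c) (Ocst d)) (Ocst (c + d))
| OcstM c d : orel (Omul (Ocst c) (Ocst d)) (Ocst (c * d))
| OcstC c t : orel (Omul (Ocst c) t) (Omul t (Ocst c))
| Opp i (k : 'I_(a i)) j (l : 'I_(a j)) : orel (ocomm (Op k) (Op l)) (Ocst 0)
| Oqq s i (k : 'I_(a i)) s' j (l : 'I_(a j)) :
    orel (ocomm (Oq s k) (Oq s' l)) (Ocst 0)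
| OqK s i (k : 'I_(a i)) : orel (Omul (Oq s k) (Oq (~~ s) k)) (Ocst 1)
| Oqp s i (k : 'I_(a i)) j (l : 'I_(a j)) :
    orel (ocomm (Oq s k) (Op l))
      (Omul (Ocst (- osgn s * ocoef i *+ ((i == j) && (k == l :> nat)))%:~R)
            (Oq s k))
| OinvL i (k l : 'I_(a i)) (kl : k != l) m :
    orel (Omul (Oinv kl m) (Oadd (osub (Op k) (Op l)) (Ocst m%:~R))) (Ocst 1)
| OinvR i (k l : 'I_(a i)) (kl : k != l) m :
    orel (Omul (Oadd (osub (Op k) (Op l)) (Ocst m%:~R)) (Oinv kl m)) (Ocst 1).

HB.instance Definition _ := gen_eqMixin oterm.
HB.instance Definition _ := gen_choiceMixin oterm.

Definition orelb : rel oterm := fun t u => `[< orel t u >].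

Fact orelb_refl : reflexive orelb.
Proof. by move=> t; apply/asboolP/Orefl. Qed.
Fact orelb_sym : symmetric orelb.
Proof. by move=> t u; apply/asbool_equiv_eq; split; apply: Osym. Qed.
Fact orelb_trans : transitive orelb.
Proof.
by move=> u t v /asboolP tu /asboolP uv; apply/asboolP; apply: Otrans tu uv.
Qed.
Canonical orel_equiv := EquivRel orelb orelb_refl orelb_sym orelb_trans.

Definition osc : Type := {eq_quot orelb}.
HB.instance Definition _ := Choice.on osc.

Definition opi (t : oterm) : osc := \pi_({eq_quot orelb}) t.
Definition orepr (x : osc) : oterm := repr (x : {eq_quot orelb}).

Lemma opiP t u : orel t u -> opi t = opi u.
Proof. by move=> tu; apply/eqmodP/asboolP. Qed.
Lemma opi_inj t u : opi t = opi u -> orel t u.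
Proof. by move=> /eqmodP/asboolP. Qed.
Lemma oreprK x : opi (orepr x) = x.
Proof. exact: reprK. Qed.
Lemma opiK t : orel (orepr (opi t)) t.
Proof. by apply: opi_inj; rewrite oreprK. Qed.

Lemma oscW (P : osc -> Prop) : (forall t, P (opi t)) -> forall x, P x.
Proof. by move=> h x; rewrite -[x]oreprK. Qed.

Definition oscadd (x y : osc) := opi (Oadd (orepr x) (orepr y)).
Definition oscmul (x y : osc) := opi (Omul (orepr x) (orepr y)).
Definition oscopp (x : osc) := opi (Omul (Ocst (-1)) (orepr x)).
Definition oscscale (c : K) (x : osc) := opi (Omul (Ocst c) (orepr x)).

Lemma oscaddE t u : oscadd (opi t) (opi u) = opi (Oadd t u).
Proof. by apply/opiP/OaddC'; apply: opiK. Qed.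
Lemma oscmulE t u : oscmul (opi t) (opi u) = opi (Omul t u).
Proof. by apply/opiP/OmulC'; apply: opiK. Qed.
Lemma oscoppE t : oscopp (opi t) = opi (Omul (Ocst (-1)) t).
Proof. by apply/opiP/OmulC'; [exact: Orefl|apply: opiK]. Qed.
Lemma oscscaleE c t : oscscale c (opi t) = opi (Omul (Ocst c) t).
Proof. by apply/opiP/OmulC'; [exact: Orefl|apply: opiK]. Qed.

Fact oscaddA : associative oscadd.
Proof.
elim/oscW=> t; elim/oscW=> u; elim/oscW=> v; rewrite !oscaddE.
exact/opiP/OaddA.
Qed.
Fact oscaddC : commutative oscadd.
Proof. by elim/oscW=> t; elim/oscW=> u; rewrite !oscaddE; apply/opiP/OaddC. Qed.
Fact oscadd0 : left_id (opi (Ocst 0)) oscadd.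
Proof. by elim/oscW=> t; rewrite oscaddE; apply/opiP/Oadd0. Qed.
Fact oscaddN : left_inverse (opi (Ocst 0)) oscopp oscadd.
Proof.
elim/oscW=> t; rewrite oscoppE oscaddC oscaddE; apply/opiP/OaddN.
Qed.
HB.instance Definition _ :=
  GRing.isZmodule.Build osc oscaddA oscaddC oscadd0 oscaddN.

Fact oscmulA : associative oscmul.
Proof.
elim/oscW=> t; elim/oscW=> u; elim/oscW=> v; rewrite !oscmulE.
exact/opiP/OmulA.
Qed.
Fact oscmul1l : left_id (opi (Ocst 1)) oscmul.
Proof. by elim/oscW=> t; rewrite oscmulE; apply/opiP/Omul1. Qed.
Fact oscmul1r : right_id (opi (Ocst 1)) oscmul.
Proof.
elim/oscW=> t; rewrite oscmulE; apply/opiP.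
by apply: Otrans (Omul1 t); apply/Osym/OcstC.
Qed.
Fact oscmulDl : left_distributive oscmul oscadd.
Proof.
elim/oscW=> t; elim/oscW=> u; elim/oscW=> v; rewrite !(oscaddE, oscmulE).
exact/opiP/OmulDl.
Qed.
Fact oscmulDr : right_distributive oscmul oscadd.
Proof.
elim/oscW=> t; elim/oscW=> u; elim/oscW=> v; rewrite !(oscaddE, oscmulE).
exact/opiP/OmulDr.
Qed.

(* [osc] is non-trivial, as {poly _} and [laurent] require: the generators act by difference operators on
   functions on a generic translate of the lattice of values of the [p]'s. *)
Let G := {i : nat & 'I_(a i)}.
Let V := (G -> int) -> K.
Let oweight i (k : 'I_(a i)) (n : G -> int) : K :=
  (ocoef i * n (Tagged _ k))%:~R + 'i * k%:R.
Let oshift s i (k : 'I_(a i)) (n : G -> int) : G -> int :=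
  fun g => n g - osgn s *+ (g == Tagged _ k).

Let Fixpoint oeval (t : oterm) : V -> V :=
  match t with
  | Ocst c => fun v n => c * v n
  | Oadd t u => fun v n => oeval t v n + oeval u v n
  | Omul t u => fun v => oeval t (oeval u v)
  | Op i k => fun v n => oweight k n * v n
  | Oq s i k => fun v n => v (oshift s k n)
  | Oinv i k l _ m => fun v n => (oweight k n - oweight l n + m%:~R)^-1 * v n
  end.

Let oeval_lin t c (v w : V) :
  oeval t (fun n => c * v n + w n) = fun n => c * oeval t v n + oeval t w n.
Proof.
elim: t v w => [d|t iht u ihu|t iht u ihu|i k|s i k|i k l kl m] v w /=;
  apply/funext => n //=; rewrite ?iht ?ihu ?iht //; ring.
Qed.

Let oevalD t (v w : V) :
  oeval t (fun n => v n + w n) = fun n => oeval t v n + oeval t w n.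
Proof.
have := oeval_lin t 1 v w; under eq_fun do rewrite mul1r.
by move=> ->; apply/funext => n; rewrite mul1r.
Qed.

Let oevalZ t c (v : V) : oeval t (fun n => c * v n) = fun n => c * oeval t v n.
Proof.
have t0 : oeval t (fun n => 0) = fun n => 0.
  apply/funext=> n; have := oeval_lin t (-1) v v.
  under eq_fun do rewrite mulN1r addNr.
  by move=> ->; rewrite mulN1r addNr.
have := oeval_lin t c v (fun=> 0); rewrite t0.
under eq_fun do rewrite addr0.
by move=> ->; apply/funext => n; rewrite addr0.
Qed.

Let oweight_neq i (k l : 'I_(a i)) m n :
  k != l -> oweight k n - oweight l n + m%:~R != 0.
Proof.
move=> kl; apply/eqP => /(congr1 (fun x => 'Im x)).
set x : int := ocoef i * n (Tagged _ k) - ocoef i * n (Tagged _ l) + m.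
rewrite (_ : _ + _ = x%:~R + 'i * (k%:Z - l%:Z)%:~R); last first.
  rewrite /oweight /x !rmorphD !rmorphN /= -!pmulrn; ring.
rewrite Im_rect ?realz // raddf0 => /eqP; rewrite intr_eq0 subr_eq0 => /eqP.
by case=> /val_inj/eqP; rewrite (negPf kl).
Qed.

Let oshiftC s i (k : 'I_(a i)) s' j (l : 'I_(a j)) n :
  oshift s k (oshift s' l n) = oshift s' l (oshift s k n).
Proof. by apply/funext => g; rewrite /oshift addrAC. Qed.

Let oshiftK s i (k : 'I_(a i)) n : oshift (~~ s) k (oshift s k n) = n.
Proof.
by apply/funext => g; rewrite /oshift; case: s; case: eqP => _ /=; lia.
Qed.

Let oweight_shift s i (k : 'I_(a i)) j (l : 'I_(a j)) n :
  oweight l (oshift s k n) = oweight l n +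
   (- osgn s * ocoef i *+ ((i == j) && (k == l :> nat)))%:~R.
Proof.
rewrite /oweight /oshift addrAC -rmorphD /=; congr (_%:~R + _).
have -> : (Tagged (fun i => 'I_(a i)) l == Tagged _ k) =
          ((i == j) && (k == l :> nat)).
  apply/eqP/andP => [e|[/eqP ij]].
    have := congr1 (fun g : G => tag g) e.
    have /= := congr1 (fun g : G => nat_of_ord (tagged g)) e.
    by move=> -> ->; rewrite !eqxx.
  by move: l; rewrite -ij => l /eqP/val_inj ->.
case: andP => [[/eqP ij _]|_]; rewrite /= ?mulr1n ?mulr0n; last by ring.
have -> : ocoef i = ocoef j by rewrite ij.
ring.
Qed.

Let oevalP t u : orel t u -> oeval t = oeval u.
Proof.
elim=> {t u} //=.
- by move=> t u v _ -> _ ->.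
- by move=> t t' u u' _ -> _ ->.
- by move=> t t' u u' _ -> _ ->.
- by move=> t u v; apply/funext=> w; apply/funext=> n; rewrite addrA.
- by move=> t u; apply/funext=> w; apply/funext=> n; rewrite addrC.
- by move=> t; apply/funext=> w; apply/funext=> n; rewrite mul0r add0r.
- by move=> t; apply/funext=> w; apply/funext=> n; rewrite mul0r mulN1r subrr.
- by move=> t; apply/funext=> w; apply/funext=> n; rewrite mul1r.
- by move=> t u v; apply/funext=> w; rewrite oevalD.
- by move=> c d; apply/funext=> w; apply/funext=> n; rewrite mulrDl.
- by move=> c d; apply/funext=> w; apply/funext=> n; rewrite mulrA.
- by move=> c t; apply/funext=> w; rewrite oevalZ.
- move=> i k j l; apply/funext=> w; apply/funext=> n; ring.
- move=> s i k s' j l; apply/funext=> w; apply/funext=> n.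
  by rewrite oshiftC mulN1r subrr mul0r.
- by move=> s i k; apply/funext=> w; apply/funext=> n; rewrite oshiftK mul1r.
- move=> s i k j l; apply/funext=> w; apply/funext=> n.
  rewrite oweight_shift; ring.
- move=> i k l kl m; apply/funext=> w; apply/funext=> n.
  rewrite mulN1r -mulNr -!mulrDl mulrA mulVf ?mul1r //; exact: oweight_neq.
- move=> i k l kl m; apply/funext=> w; apply/funext=> n.
  rewrite mulN1r -mulNr -!mulrDl mulrA mulfV ?mul1r //; exact: oweight_neq.
Qed.

Fact oscone_neq0 : opi (Ocst 1) != 0.
Proof.
apply/eqP => /opi_inj/oevalP/(congr1 (fun f => f (fun=> 1) (fun=> 0))) /= /eqP.
by rewrite mul1r mul0r oner_eq0.
Qed.

HB.instance Definition _ := GRing.Zmodule_isNzRing.Build osc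
  oscmulA oscmul1l oscmul1r oscmulDl oscmulDr oscone_neq0.

Fact oscscaleA c d x : oscscale c (oscscale d x) = oscscale (c * d) x.
Proof.
elim/oscW: x => t; rewrite !oscscaleE; apply/opiP.
by apply: Otrans (OmulA _ _ _) _; apply: OmulC' (OcstM _ _) (Orefl _).
Qed.
Fact oscscale1 : left_id 1 oscscale.
Proof. by elim/oscW => t; rewrite oscscaleE; apply/opiP/Omul1. Qed.
Fact oscscaleDr : right_distributive oscscale +%R.
Proof.
move=> c; elim/oscW=> t; elim/oscW=> u; rewrite [LHS]/oscscale.
rewrite !oscscaleE -[RHS]/(oscadd _ _) oscaddE; apply/opiP.
apply: Otrans (OmulDr _ _ _); apply: OmulC' (Orefl _) _.
by apply: Otrans (opiK _) _; apply: OaddC'; apply: opiK.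
Qed.
Fact oscscaleDl x : {morph oscscale^~ x : c d / c + d}.
Proof.
elim/oscW: x => t c d; rewrite !oscscaleE -[RHS]/(oscadd _ _) oscaddE.
apply/opiP; apply: Otrans (OmulDl _ _ _).
by apply: OmulC' (Osym (OcstD _ _)) (Orefl _).
Qed.
HB.instance Definition _ := GRing.Zmodule_isLmodule.Build K osc
  oscscaleA oscscale1 oscscaleDr oscscaleDl.

Fact oscscaleAl (c : K) (x y : osc) : c *: (x * y) = (c *: x) * y.
Proof.
elim/oscW: x => t; elim/oscW: y => u.
rewrite -[_ * opi u]/(oscmul _ _) -[LHS]/(oscscale _ _) -[RHS]/(oscmul _ _).
rewrite -[c *: _]/(oscscale _ _) !(oscmulE, oscscaleE).
exact/opiP/OmulA.
Qed.
HB.instance Definition _ := GRing.Lmodule_isLalgebra.Build K osc oscscaleAl.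

Fact oscscaleAr (c : K) (x y : osc) : c *: (x * y) = x * (c *: y).
Proof.
elim/oscW: x => t; elim/oscW: y => u.
rewrite -[_ * opi u]/(oscmul _ _) -[LHS]/(oscscale _ _) -[RHS]/(oscmul _ _).
rewrite -[c *: _]/(oscscale _ _) !(oscmulE, oscscaleE).
apply/opiP; apply: Otrans (OmulA _ _ _) _.
apply: Otrans _ (Osym (OmulA _ _ _)).
by apply: OmulC' (OcstC _ _) (Orefl _).
Qed.
HB.instance Definition _ := GRing.Lalgebra_isAlgebra.Build K osc oscscaleAr.

Definition op i (k : 'I_(a i)) : osc := opi (Op k).
Definition oq (s : bool) i (k : 'I_(a i)) : osc := opi (Oq s k).

End Oscillators.

Local Close Scope quotient_scope.

Section Divisors.
Variable r : nat.

(* The lattice with basis [weps 1], ..., [weps r.+1]. *)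
Definition wlattice := 'rV[int]_r.+1.

Definition weps (j : nat) : wlattice := \row_(k < r.+1) (k.+1 == j)%:R.

(* The dual basis, for 1 <= j <= r.+1. *)
Definition wepsv (j : nat) (mu : wlattice) : int := mu ord0 (inord j.-1).

Definition dominant (mu : wlattice) : Prop :=
  forall i, (1 <= i <= r)%N -> 0 <= wepsv i mu - wepsv i.+1 mu.

Definition wvarpi (i : nat) : wlattice := - \sum_(i.+1 <= j < r.+2) weps j.

Definition walpha (i : nat) : wlattice :=
  if i.+1 == r then weps i - weps i.+1 + weps i.+2 else weps i - weps i.+1.

(* The divisor \sum_s dsgn s * wvarpi (dind s) [dpt s] + dinf [infinity]. *)
Record divisor (K : Type) := Divisor {
  dsize : nat;
  dind : 'I_dsize -> 'I_r.+1;
  dsgn : 'I_dsize -> int;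
  dpt : 'I_dsize -> K;
  dinf : wlattice;
  dsgnP : forall s, dsgn s = 1 \/ (dind s = 0%N :> nat /\ dsgn s = -1);
  dinfP : dominant dinf
}.

Definition dlambda K (D : divisor K) : wlattice :=
  \sum_(s < dsize D) wvarpi (dind s) *~ dsgn s.

Definition assumptionA K (D : divisor K) (a : nat -> nat) : Prop :=
  (forall i, ~~ (1 <= i <= r)%N -> a i = 0%N) /\
  dlambda D + dinf D = \sum_(1 <= i < r.+1) walpha i *+ a i.

End Divisors.

Section LaxMatrix.
Variables (K : numClosedFieldType) (r : nat) (D : divisor r K) (a : nat -> nat).

Local Notation L := (laurent (osc K r a)).
Local Notation z := (lz : L).

Definition lp i (k : 'I_(a i)) : L := lcst (op K r k).
Definition lq (s : bool) i (k : 'I_(a i)) : L := lcst (oq K r s k).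

(* Below, [y] is the point at which a rational function is evaluated: [z], a
   shift of [z], or a shift of some p_{i,k}. *)
Definition Pfun (j : nat) (y : L) : L := \prod_(k < a j) (y - lp k).

(* the product defining P_{j,k}, with the factor of index k omitted *)
Definition Pfun' (j : nat) (k : 'I_(a j)) (y : L) : L :=
  \prod_(l < a j | l != k) (y - lp l).

(* For i > 0 all the exponents are 1. *)
Definition Zfun (i : nat) (y : L) : L :=
  \prod_(s < dsize D | dind s == i :> nat) (y - lcst (dpt s)%:A) ^ dsgn s.

Definition ebasic (i : nat) (y : L) : L :=
  if i == r then
    \sum_(k < a r) Pfun r.-1 (lp k - 1) * Pfun r.-1 (lp k - 2)
      / ((y - lp k) * Pfun' k (lp k)) * lq true k
  else
    \sum_(k < a i) Pfun i.-1 (lp k - 1)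
      / ((y - lp k) * Pfun' k (lp k)) * lq true k.

Definition fbasic (i : nat) (y : L) : L :=
  if i == r then
    - \sum_(k < a r) Zfun r (lp k + 2)
      / ((y - lp k - 2) * Pfun' k (lp k)) * lq false k
  else
    - \sum_(k < a i) Zfun i (lp k + 1) * Pfun i.+1 (lp k + 1)
      / ((y - lp k - 1) * Pfun' k (lp k)) * lq false k.

(* [hbasic i] is h_i for 1 <= i <= r + 1; the other h_i are in [hentry]. *)
Definition hbasic (i : nat) (y : L) : L :=
  (if (i <= r)%N then Pfun i y / Pfun i.-1 (y - 1)
   else Pfun r.-1 (y - 2) / Pfun r (y - 2)) * \prod_(0 <= k < i) Zfun k y.

(* the involution i |-> i' on {1, .., 2r} *)
Definition iprime (i : nat) : nat := ((2 * r).+1 - i)%N.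

Definition hentry (n : nat) : L :=
  if (n <= r.+1)%N then hbasic n z else
  let i := iprime n in
  (hbasic i (z + i%:R - r%:R - 1))^-1
  * \prod_(i.+1 <= j < r) (hbasic j (z + j%:R - r%:R - 2)
                          / hbasic j (z + j%:R - r%:R - 1))
  * hbasic r (z - 2) * hbasic r.+1 z.

Definition lcomm (x y : L) : L := x * y - y * x.

(* the coefficient of z^-1 *)
Definition lres (g : L) : L := lcst (g (-1)).

(* [ecol n i] is e_{i,n} for 1 <= i < n <= 2r; each column of E is obtained
   from the previous one. *)
Fixpoint ecol (n : nat) : nat -> L :=
  if n isn't m.+1 then fun _ => 0 else
  let prev := ecol m in
  fun i =>
  if (n <= r)%N then
    (* e_{m,m+1}; e_{i,m+1} *)
    if i == m then ebasic m z else - lcomm (prev i) (lres (ebasic m z))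
  else if n == r.+1 then
    (* e_{r,r'}; e_{i,r'} *)
    if i == r then ebasic r z
    else - 2^-1 * lcomm (prev i) (lres (ebasic r z))
  else
    (* n = j' and m = (j+1)' *)
    let j := iprime n in
    if (i <= r)%N then
      if i == j then
        lcomm (prev i) (lres (ebasic j z)) - ebasic j z * prev i
      else if i == j.+1 then
        lcomm (prev i) (lres (ebasic j z)) + ebasic j z * prev i - prev j
      else lcomm (prev i) (lres (ebasic j z))
    else
      (* e_{(j+1)',j'}; e_{i,j'} with i = k' and j <= k - 2 *)
      if i == m then - ebasic j (z + j%:R - r%:R - 1)
      else lcomm (prev i) (lres (ebasic j z)).

(* [frow n i] is f_{n,i} for 1 <= i < n <= 2r. *)
Fixpoint frow (n : nat) : nat -> L :=
  if n isn't m.+1 then fun _ => 0 else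
  let prev := frow m in
  fun i =>
  if (n <= r)%N then
    if i == m then fbasic m z else - lcomm (lres (fbasic m z)) (prev i)
  else if n == r.+1 then
    if i == r then fbasic r z
    else - 2^-1 * lcomm (lres (fbasic r z)) (prev i)
  else
    let j := iprime n in
    if (i <= r)%N then
      if i == j then
        lcomm (lres (fbasic j z)) (prev i) - prev i * fbasic j z
      else if i == j.+1 then
        lcomm (lres (fbasic j z)) (prev i) + prev i * fbasic j z - prev j
      else lcomm (lres (fbasic j z)) (prev i)
    else
      if i == m then - fbasic j (z + j%:R - r%:R - 1)
      else lcomm (lres (fbasic j z)) (prev i).

(* Rows and columns of matrices are numbered from 0. *)
Definition Fmx : 'M[L]_(2 * r) := \matrix_(i, j)
  if i == j then 1 else if (j < i)%N then frow i.+1 j.+1 else 0.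

Definition Hmx : 'M[L]_(2 * r) := diag_mx (\row_i hentry i.+1).

Definition Emx : 'M[L]_(2 * r) := \matrix_(i, j)
  if i == j then 1 else if (i < j)%N then ecol j.+1 i.+1 else 0.

Definition Tmx : 'M[L]_(2 * r) := Fmx *m Hmx *m Emx.

Definition Tmx_normalized : 'M[L]_(2 * r) := (Zfun 0 z)^-1 *: Tmx.

End LaxMatrix.

(* Main.v *)
(** Number the links 1, ..., 2r - 1 between consecutive rows of [T = F H E] and
    colour link [i] by the simple root [b i = i] (i <= r) or [2r - i] (i > r).
    Column [n + 1] of [E] is a multiple of [D (v n)], where [v n] is column [n]
    and [D = D_(b n)] is the commutator with [e_(b n)^(1)] corrected by a lower
    bidiagonal matrix.  Dually, put [Phi_j v = [f_j^(1), v] - G_j v] with [G_j]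
    superdiagonal, with entries [h_(j+1) / h_j].  The relations between two
    generators give [[Phi_j, D_b] = 0] for [b <> j], while [[Phi_j, D_j]] is a
    Cartan operator having every column of [E] as an eigenvector; dominance at
    infinity enters here: it makes the degree of [h_(j+1) / h_j] in [z] at most 0,
    so that [[e_j(z), f_j^(1)]] is this ratio minus a constant.  Hence
    [Phi_j (v n)] is a scalar multiple of [v (n - 1)] as long as [n <= 2r + 1 - j]
    (beyond that point Serre relations would be needed), and
    [T_(m+1, n)] is a combination of the commutator of [T_(m, n)] with
    [f_(b m)^(1)] and of [T_(m, n-1)].  The same argument in the opposite ring
    moves along rows.  One of the two steps always applies (the first one when
    [n <= m], the second one when [m <= n]), so all the entries lie in the ring
    generated over [A] by [T_(1, 1) / Z_0 = P_1], up to the factor [Z_0]. *)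

From Stdlib Require Import Ncring Ncring_tac.
Require Import Defs.
From HB Require Import structures.
From mathcomp Require Import all_boot all_order all_algebra.
From mathcomp Require Import boolp reals.
From mathcomp.real_closed Require Import complex.
From mathcomp Require Import zify ring.

Set Implicit Arguments.
Unset Strict Implicit.
Unset Printing Implicit Defensive.

Import Order.TTheory GRing.Theory Num.Theory.
Local Open Scope ring_scope.

(** * Recursion for the entries of a Lax matrix *)

(** The relations between two generators reduce to identities between functions of [z] and the
    momenta. Each [e_b(y)], each [f_b] and each correction [mu] is a sum of terms [phi e^(q_(b,k))]
    or [e^(-q_(b,k)) phi], and moving [e^(q_(b,k))] past a function shifts [p_(b,k)] by [c_b]. Terms
    of [e_b] and [f_j] with different oscillators commute. A pair with the same oscillator leaves a
    function minus its shift, and these differences are the partial fraction terms of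
    [h_(b+1) / h_b], whose poles are the [p_(b,k)] and [p_(b,k) + c_b]. For neighbouring colours the
    points [z + i - r - 1] matter: they put the zero of the factor [P_b] in [h_(j+1) / h_j] on the
    pole at the neighbouring link, before or after one shift. These computations need a commutative
    ring with inverses and shift automorphisms inside the noncommutative Laurent series; the double
    centralizer of the momenta is one. No pole is ever cancelled by hand: [T_(1,1) / Z_0] has none,
    and each step only takes combinations and brackets with elements free of [z]. *)

Section LaxRecursion.
Variables (L : nzRingType) (r : nat).

#[local] Instance nc_ring_ops :
  @Ring_ops L 0 1 +%R *%R (fun x y => x - y) -%R eq := {}.
#[local] Instance nc_ring : @Ring _ _ _ _ _ _ _ _ nc_ring_ops.
Proof.
split => //.
- exact: RelationClasses.eq_equivalence.
- by move=> ? ? -> ? ? ->.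
- by move=> ? ? -> ? ? ->.
- by move=> ? ? -> ? ? ->.
- by move=> ? ? ->.
- exact: add0r.
- exact: addrC.
- exact: addrA.
- exact: mul1r.
- exact: mulr1.
- exact: mulrA.
- exact: mulrDl.
- by move=> x y z; exact: mulrDr.
- exact: subrr.
Qed.

(* Link [i] joins rows [i] and [i + 1]; its colour is 0 unless 0 < i < 2r. *)
Definition link_color (i : nat) : nat :=
  if (i <= r)%N then i else (2 * r - i)%N.

Definition lterm (m : nat -> L) (b i : nat) : L := m i *+ (link_color i == b).

(* The operators [D_b], [Phi_j] and [[Phi_j, D_j]] on columns [u].  At a
   link [i] of colour [b], located at the point [y] (a shift of [z]), [mu i]
   stands for [c_b e_b(y)], [x i] for 1, 2 or -1 according to [i < r], [i = r]
   or [i > r], and [kx i] for [x i * (h_(b+1) / h_b)(y)]. *)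
Definition raise (e mu x : nat -> L) (b : nat) (u : nat -> L) (i : nat) : L :=
  u i * e b - e b * u i - (lterm mu b i - lterm mu b i.-1) * u i
  - lterm x b i.-1 * u i.-1.

Definition lower (f kx : nat -> L) (j : nat) (u : nat -> L) (i : nat) : L :=
  f j * u i - u i * f j + lterm kx j i * u i.+1.

Definition weight (kap t : nat -> L) (j : nat) (u : nat -> L) (i : nat) : L :=
  kap j * u i - u i * kap j
    - (t j *+ (link_color i == j) - t j *+ (link_color i.-1 == j)) * u i.

(** * Brackets of the operators on columns *)

Section Comm.
Variables (e f kap mu kx x t : nat -> L) (b j : nat).
Hypothesis cx : forall i u, x i * u = u * x i.
Hypothesis b0 : (0 < b)%N.
Hypothesis j0 : (0 < j)%N.

Lemma lterm0 m c : (0 < c)%N -> lterm m c 0 = 0.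
Proof. by rewrite /lterm /link_color leq0n eq_sym; case: eqP => // ->. Qed.

Lemma ltermxC i u : lterm x b i * u = u * lterm x b i.
Proof. by rewrite /lterm mulrnAl mulrnAr cx. Qed.

Hypothesis fe : f j * e b - e b * f j = - kap j *+ (j == b).
Hypothesis kxe : forall i, lterm kx j i * e b - e b * lterm kx j i =
   lterm kx j i * (lterm mu b i - lterm mu b i.+1)
   + (lterm mu b i - lterm mu b i.-1) * lterm kx j i.
Hypothesis muf : forall i, lterm mu b i * f j - f j * lterm mu b i =
   lterm kx j i * lterm x b i - (t j *+ (link_color i == j)) *+ (j == b).

(** The terms in [u i.+1] cancel by [kxe] and those in [u i.-1] because [x] is central. In the terms
    in [u i], [muf] at the links [i] and [i.-1] leaves the constants [t], and [fe] leaves the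
    bracket with [kap j]; together they form [weight]. *)
Lemma lower_raise u i :
  lower f kx j (raise e mu x b u) i - raise e mu x b (lower f kx j u) i
  = weight kap t j u i *+ (j == b).
Proof.
have main : forall M0 M M' X0 X K0 K : L,
  f j * e b - e b * f j = - kap j *+ (j == b) ->
  K * e b - e b * K = K * (M - M') + (M - M0) * K ->
  M * f j - f j * M = K * X - (t j *+ (link_color i == j)) *+ (j == b) ->
  M0 * f j - f j * M0 = K0 * X0 - (t j *+ (link_color i.-1 == j)) *+ (j == b) ->
  (forall u, X0 * u = u * X0) ->
  f j * (u i * e b - e b * u i - (M - M0) * u i - X0 * u i.-1)
  - (u i * e b - e b * u i - (M - M0) * u i - X0 * u i.-1) * f j
  + K * (u i.+1 * e b - e b * u i.+1 - (M' - M) * u i.+1 - X * u i)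
  - ((f j * u i - u i * f j + K * u i.+1) * e b - e b *
    (f j * u i - u i * f j + K * u i.+1) - (M - M0) *
    (f j * u i - u i * f j + K * u i.+1)
  - X0 * (f j * u i.-1 - u i.-1 * f j + K0 * u i)) =
      weight kap t j u i *+ (j == b).
  move=> M0 M M' X0 X K0 K h1 h2 h3 h4 h5.
  set T1 : L := _ *+ (j == b) in h3; set T0 : L := _ *+ (j == b) in h4.
  set Q : L := _ *+ _ in h1.
  have -> : weight kap t j u i *+ (j == b) = - Q * u i + u i * Q - (T1 - T0) *
    u i.
    rewrite /weight /T1 /T0 /Q; case: (j == b); rewrite ?mulr0n ?mulr1n //.
      by rewrite opprK mulrN.
    by rewrite !(oppr0, mul0r, mulr0, subr0, addr0).
  have e1 : T1 = K * X - (M * f j - f j * M) by rewrite h3 opprB addrC subrK.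
  have e0 : T0 = K0 * X0
    - (M0 * f j - f j * M0) by rewrite h4 opprB addrC subrK.
  have e2 : (K * e b - e b * K - (K * (M - M') + (M - M0) * K)) * u i.+1 =
    0 by rewrite h2 subrr mul0r.
  rewrite -h1 e1 e0.
  have e3 : f j * X0 - X0 * f j = 0 by rewrite h5 subrr.
  have e4 : X0 * K0 - K0 * X0 = 0 by rewrite h5 subrr.
  apply/eqP; rewrite -subr_eq0; apply/eqP.
  transitivity (- ((K * e b - e b * K - (K * (M - M') + (M - M0) * K)) * u i.+1)
    - (f j * X0 - X0 * f j) * u i.-1 + (X0 * K0 - K0 * X0) * u i).
    non_commutative_ring.
  by rewrite e2 e3 e4 !(mul0r, oppr0, addr0).
have := main (lterm mu b i.-1) (lterm mu b i) (lterm mu b i.+1) (lterm x b i.-1)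
  (lterm x b i) (lterm kx j i.-1) (lterm kx j i) fe (kxe i) (muf i) (muf i.-1)
  (ltermxC i.-1).
(* At [i = 0] the entry [u i.-1.+1] is not [u i], but its coefficient contains [lterm x b 0], which
   is 0. *)
rewrite /raise /lower; case: i {main} => [|i] /=; last exact.
by rewrite (lterm0 x b0) !mul0r.
Qed.


Hypothesis ct : forall u, t j * u = u * t j.
Variable w : L.
Hypothesis cw : forall u, w * u = u * w.
Hypothesis kape : kap j * e b - e b * kap j = w * e b.
Hypothesis kapmu : forall i, kap j * lterm mu b i - lterm mu b i * kap j = w *
  lterm mu b i.
Hypothesis tx : forall i, lterm x b i *
  ((t j *+ (link_color i.+1 == j) - t j *+ (link_color i == j))
   - (t j *+ (link_color i == j) - t j *+ (link_color i.-1 == j))) = - w *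
     lterm x b i.

(** The terms of [D_b] in [e b] and [mu] have weight [w] under the bracket with [kap j]. The term in
    [x] is central, but it moves the entry by one link, and by [tx] the change of the [t] terms
    there is worth [w] too. So [D_b] maps eigenvectors of [weight] to eigenvectors. *)
Lemma weight_raise u i :
  weight kap t j (raise e mu x b u) i
  = raise e mu x b (weight kap t j u) i + w * raise e mu x b u i.
Proof.
have main : forall M0 M X0 T0 T : L,
  kap j * M - M * kap j = w * M -> kap j * M0 - M0 * kap j = w * M0 ->
  X0 * (T - T0) = - w * X0 -> (forall u, X0 * u = u * X0) ->
  (forall u, T * u = u * T) ->
  kap j * (u i * e b - e b * u i - (M - M0) * u i - X0 * u i.-1)
  - (u i * e b - e b * u i - (M - M0) * u i - X0 * u i.-1) * kap j
  - T * (u i * e b - e b * u i - (M - M0) * u i - X0 * u i.-1) =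
  (kap j * u i - u i * kap j - T * u i) * e b
  - e b * (kap j * u i - u i * kap j - T * u i)
  - (M - M0) * (kap j * u i - u i * kap j - T * u i)
  - X0 * (kap j * u i.-1 - u i.-1 * kap j - T0 * u i.-1)
  + w * (u i * e b - e b * u i - (M - M0) * u i - X0 * u i.-1).
  move=> M0 M X0 T0 T h1 h2 h3 h4 h5.
  apply/eqP; rewrite -subr_eq0; apply/eqP.
  transitivity (- (kap j * e b - e b * kap j - w * e b) * u i
   + u i * (kap j * e b - e b * kap j - w * e b)
   - (kap j * M - M * kap j - w * M) * u i +
       (kap j * M0 - M0 * kap j - w * M0) * u i
   + (X0 * (T - T0) - - w * X0) * u i.-1 - (w * u i - u i * w) * e b
   - (kap j * X0 - X0 * kap j) * u i.-1 + (T * e b - e b * T) * u i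
   + (T * (M - M0) - (M - M0) * T) * u i + (T * X0 - X0 * T) * u i.-1).
    non_commutative_ring.
  rewrite h1 h2 h3 kape !cw !h4 !h5 !subrr.
  by rewrite !(mul0r, mulr0, oppr0, addr0).
have := main (lterm mu b i.-1) (lterm mu b i) (lterm x b i.-1)
  (t j *+ (link_color i.-1 == j) - t j *+ (link_color i.-1.-1 == j))
  (t j *+ (link_color i == j) - t j *+ (link_color i.-1 == j)) (kapmu i)
    (kapmu i.-1).
rewrite /weight /raise; case: i {main} => [|i] /=.
  rewrite (lterm0 x b0); apply; rewrite ?mul0r ?mulr0 // => v;
    rewrite ?mul0r ?mulr0 //.
  by rewrite mulrBl mulrBr !mulrnAl !mulrnAr ct.
apply; rewrite ?tx // => v; first exact: ltermxC.
by rewrite mulrBl mulrBr !mulrnAl !mulrnAr ct.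
Qed.

End Comm.

(** One half of the factorization: the columns of [E] over [L], or the rows of [F] over the opposite
    ring. In the instances [skap j] is the bracket of [e_j^(1)] with [f_j^(1)], [st j] is [c_j ^ 2]
    times the value of [h_(j+1) / h_j] at infinity, and [sw j b] is [st j] times a Cartan
    integer. *)
Record side := Side {
  se : nat -> L; sf : nat -> L; skap : nat -> L; smu : nat -> L;
  skx : nat -> L; sx : nat -> L; st : nat -> L; ss : nat -> L;
  sw : nat -> nat -> L;
  scal : L -> Prop;
  sv : nat -> nat -> L;
  scalC : forall u v, scal u -> u * v = v * u;
  scal0 : scal 0;
  scalN : forall u, scal u -> scal (- u);
  scalD : forall u v, scal u -> scal v -> scal (u + v);
  scalM : forall u v, scal u -> scal v -> scal (u * v);
  scalx : forall i, scal (sx i);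
  scalt : forall i, scal (st i);
  scals : forall i, scal (ss i);
  scalw : forall i j, scal (sw i j);
  side_fe : forall j b, (0 < j <= r)%N -> (0 < b <= r)%N ->
    sf j * se b - se b * sf j = - skap j *+ (j == b);
  side_kxe : forall j b i, (0 < j <= r)%N -> (0 < b <= r)%N ->
    lterm skx j i * se b - se b * lterm skx j i =
    lterm skx j i * (lterm smu b i - lterm smu b i.+1)
    + (lterm smu b i - lterm smu b i.-1) * lterm skx j i;
  side_muf : forall j b i, (0 < j <= r)%N -> (0 < b <= r)%N ->
    lterm smu b i * sf j - sf j * lterm smu b i =
    lterm skx j i * lterm sx b i - (st j *+ (link_color i == j)) *+ (j == b);
  side_kape : forall j b, (0 < j <= r)%N -> (0 < b <= r)%N ->
    skap j * se b - se b * skap j = sw j b * se b;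
  side_kapmu : forall j b i, (0 < j <= r)%N -> (0 < b <= r)%N ->
    skap j * lterm smu b i - lterm smu b i * skap j = sw j b * lterm smu b i;
  side_tx : forall j b i, (0 < j <= r)%N -> (0 < b <= r)%N -> lterm sx b i *
    ((st j *+ (link_color i.+1 == j) - st j *+ (link_color i == j))
     - (st j *+ (link_color i == j) - st j *+ (link_color i.-1 == j))) =
    - sw j b * lterm sx b i;
  side_far : forall b b', (0 < b)%N -> (b.+1 < b' <= r)%N ->
    se b * se b' = se b' * se b;
  side_farmu : forall b b' i, (0 < b)%N -> (b.+1 < b' <= r)%N ->
    lterm smu b i * se b' = se b' * lterm smu b i;
  side_v1 : forall i, sv 1 i = (i == 1%N)%:R;
  side_vS : forall m i, (0 < m < 2 * r)%N ->
    sv m.+1 i = ss m * raise se smu sx (link_color m) (sv m) i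
}.

Section Side.
Variable S : side.
Local Notation v := (sv S).

Lemma linkE m : (0 < m < 2 * r)%N -> (0 < link_color m <= r)%N.
Proof. rewrite /link_color; case: ifP; lia. Qed.

Lemma sv0 m i : (0 < m <= r)%N -> (m < i)%N -> v m i = 0.
Proof.
elim: m i => // -[|m] IH i mr mi.
  by rewrite side_v1; case: eqP => // i1; rewrite i1 in mi.
rewrite side_vS ?/raise; last by lia.
rewrite !IH ?mulr0 ?mul0r ?subrr ?subr0 ?mulr0 //; lia.
Qed.

(** Column [m] is built from colours at most [m - 1 <= b - 2] only. *)
Lemma sv_far m b i : (0 < m < b)%N -> (b <= r)%N -> v m i * se S b = se S b *
  v m i.
Proof.
elim: m i => // -[|m] IH i mb br.
  by rewrite side_v1; case: (_ == _); rewrite ?mul0r ?mulr0 ?mul1r ?mulr1.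
rewrite side_vS; last by lia.
have lk : link_color m.+1 = m.+1 by rewrite /link_color; case: ifP; lia.
have cc x y : x * se S b = se S b * x -> y * se S b = se S b * y ->
  x * y * se S b = se S b * (x * y) by move=> hx hy;
    rewrite -mulrA hy !mulrA hx.
have cd x y : x * se S b = se S b * x -> y * se S b = se S b * y ->
  (x - y) * se S b = se S b * (x - y) by move=> hx hy;
    rewrite mulrBl mulrBr hx hy.
have cs x : scal S x -> x * se S b = se S b * x by move=> h;
  rewrite (scalC _ h).
have cl n k : scal S (n k) ->  lterm n (link_color m.+1) k * se S b = se S b *
  lterm n (link_color m.+1) k.
  by move=> h; rewrite /lterm mulrnAl mulrnAr (cs _ h).
have cm k : lterm (smu S) (link_color m.+1) k * se S b = se S b *
  lterm (smu S) (link_color m.+1) k.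
  by apply: side_farmu; rewrite lk; lia.
apply: (cc); first by apply: cs; apply: scals.
have cv k : v m.+1 k * se S b = se S b * v m.+1 k by apply: IH; lia.
have ce : se S (link_color m.+1) * se S b = se S b * se S (link_color m.+1).
  by apply: side_far; rewrite lk; lia.
rewrite /raise; apply: (cd); last by apply: (cc) => //; apply: cl; apply: scalx.
by apply: (cd); [apply: (cd); apply: (cc)|apply: (cc); [apply: (cd)|]].
Qed.

(** Besides commuting with [e_b], column [m] is supported on rows up to [m], and the corrections in
    [D_b] meet it only through links of colour at most [m < b]. *)
Lemma raise_far m b i : (0 < m < b)%N -> (b <= r)%N ->
  raise (se S) (smu S) (sx S) b (v m) i = 0.
Proof.
move=> mb br; rewrite /raise sv_far // subrr sub0r.
have lnk k : (k <= m)%N -> link_color k == b = false.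
  by move=> km; apply/negbTE/eqP; rewrite /link_color; case: ifP; lia.
have [im|mi] := leqP i m.
  by rewrite /lterm !lnk ?mulr0n ?subrr ?mul0r ?subr0 ?oppr0 //; lia.
rewrite sv0 ?mulr0 ?oppr0 ?sub0r; [|lia..].
have [im|mi'] := leqP i.-1 m; first by rewrite /lterm lnk // mul0r oppr0.
by rewrite sv0 ?mulr0 ?oppr0 //; lia.
Qed.

Lemma raise_scale y b u i : scal S y ->
  raise (se S) (smu S) (sx S) b (fun k => y * u k) i
  = y * raise (se S) (smu S) (sx S) b u i.
Proof.
move=> sy; have h z := scalC z sy; rewrite /raise !mulrBr.
by rewrite !mulrA (h (se S b)) (h (_ - _)) (h (lterm _ _ _)) .
Qed.

Lemma lower_scale y j u i : scal S y ->
  lower (sf S) (skx S) j (fun k => y * u k) i = y * lower (sf S) (skx S) j u i.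
Proof.
move=> sy; have h z := scalC z sy; rewrite /lower mulrDr mulrBr.
by rewrite !mulrA (h (sf S j)) (h (lterm _ _ _)).
Qed.

Lemma weight_scale y j u i : scal S y ->
  weight (skap S) (st S) j (fun k => y * u k) i
  = y * weight (skap S) (st S) j u i.
Proof.
move=> sy; have h z := scalC z sy; rewrite /weight !mulrBr.
by rewrite !mulrA (h (skap S j)) (h (_ - _)).
Qed.

Lemma weight_sv j m : (0 < j <= r)%N -> (0 < m <= 2 * r)%N ->
  exists2 y, scal S y & forall i, weight (skap S) (st S) j (v m) i = y * v m i.
Proof.
move=> hj; elim: m => // -[_ _|m IH mr].
  pose T i := st S j *+ (link_color i == j) - st S j *+ (link_color i.-1 == j).
  have sT i : scal S (T i).
    have h (b : bool) : scal S (st S j *+ b).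
      by case: b; [apply: scalt|apply: scal0].
    by apply: scalD => //; apply: scalN.
  exists (- T 1%N) => [|i]; first exact: scalN.
  rewrite /weight -/(T i) !side_v1.
  case: eqP => [->|_]; last by rewrite !mulr0 mul0r !subrr.
  by rewrite !mulr1 mul1r subrr sub0r.
have [|y sy hy] := IH _; first lia.
have hl := @linkE m.+1 ltac:(lia).
exists (y + sw S j (link_color m.+1)) => [|i]; first exact: scalD (scalw _ _ _).
rewrite side_vS; last by lia.
pose R := raise (se S) (smu S) (sx S) (link_color m.+1) (v m.+1).
transitivity (ss S m.+1 * weight (skap S) (st S) j R i).
  rewrite -weight_scale; last exact: scals.
  by rewrite /weight !side_vS //; lia.
rewrite (@weight_raise _ _ _ _ _ _ _ _ _ _ (sw S j (link_color m.+1)));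
  first last.
- by move=> k; apply: side_tx.
- by move=> k; apply: side_kapmu.
- exact: side_kape.
- by move=> k; rewrite (scalC _ (scalw S _ _)).
- by move=> k; rewrite (scalC _ (scalt S _)).
- by lia.
- by move=> k z; rewrite (scalC _ (scalx S _)).
have -> : raise (se S) (smu S) (sx S) (link_color m.+1)
  (weight (skap S) (st S) j (v m.+1)) i = y * R i.
  by rewrite /R -raise_scale // /raise !hy.
by rewrite -mulrDl mulrA (scalC _ (scals S _)) mulrA.
Qed.

(** In the induction [Phi_j] of the next column is a weight term plus [D_b] applied to [y * v m.-1],
    so that [D_b] has to kill the latter. If [y] is non-zero, link [m.-1] has colour [j]. The bound
    on [m] makes this link equal to [j < r], where [raise_far] applies; the other link of this
    colour, [2r - j], is reached only at the last column allowed. *)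
Lemma lower_sv j m : (0 < j <= r)%N -> (0 < m <= 2 * r - j.-1)%N ->
  exists y, [/\ scal S y, (link_color m.-1 != j -> y = 0) &
   forall i, lower (sf S) (skx S) j (v m) i = y * v m.-1 i].
Proof.
move=> hj; elim: m => // -[_ _|m IH mr].
  exists 0; split=> // [|i]; first exact: scal0.
  rewrite /lower !side_v1 mul0r; case: i => [|i] /=.
    by rewrite lterm0 ?mul0r ?mulr0 ?subrr ?addr0 //; lia.
  rewrite eqSS; case: eqP => _; last by rewrite ?(mulr0, mul0r, subr0, addr0).
  by rewrite mulr0 mulr1 mul1r subrr addr0.
have [|y [sy y0 hy]] := IH _; first lia.
have hl := @linkE m.+1 ltac:(lia).
pose R := raise (se S) (smu S) (sx S) (link_color m.+1) (v m.+1).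
have Ry i : raise (se S) (smu S) (sx S) (link_color m.+1)
  (lower (sf S) (skx S) j (v m.+1)) i = 0.
  have -> : raise (se S) (smu S) (sx S) (link_color m.+1)
    (lower (sf S) (skx S) j (v m.+1)) i
    = y * raise (se S) (smu S) (sx S) (link_color m.+1) (v m) i.
    by rewrite -raise_scale // /raise !hy.
  (* The bound on the column leaves only [m = j < r], so the next colour is [m + 1 > m]. *)
  have [lmj|lmj] := eqVneq (link_color m) j; last by rewrite y0 // mul0r.
  by rewrite raise_far ?mulr0 //; move: lmj; rewrite /link_color; do !case: ifP;
    lia.
have eqR i : lower (sf S) (skx S) j (v m.+2) i = ss S m.+1 *
  (weight (skap S) (st S) j (v m.+1) i *+ (j == link_color m.+1)).
  transitivity (ss S m.+1 * lower (sf S) (skx S) j R i).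
    rewrite -lower_scale; last exact: scals.
    by rewrite /lower !side_vS //; lia.
  congr (_ * _); rewrite -[LHS]subr0 -(Ry i)
    (@lower_raise _ _ (skap S) _ _ _ (st S)) //; first last.
  - by move=> k; apply: side_muf.
  - by move=> k; apply: side_kxe.
  - exact: side_fe.
  - by lia.
  - by move=> k z; rewrite (scalC _ (scalx S _)).
have [z sz hz] := @weight_sv j m.+1 hj ltac:(lia).
exists (ss S m.+1 * z *+ (j == link_color m.+1)); split=> [||i].
- by case: (_ == _); [apply: scalM => //; apply: scals|apply: scal0].
- by rewrite eq_sym => /negPf->.
by rewrite eqR hz mulrnAl mulrnAr mulrA.
Qed.

End Side.

Lemma link_top : link_color (2 * r) = 0%N.
Proof. by rewrite /link_color; case: ifP; lia. Qed.

Section Product.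
Variable S : side.
Variables (mu' s' h : nat -> L) (row : nat -> nat -> L).
Variable A : L -> Prop.

Definition lax m n := \sum_(i < (2 * r).+1) row m i * (h i * sv S n i).

Hypothesis rowS : forall m i, (0 < m < 2 * r)%N -> row m.+1 i = s' m *
  (sf S (link_color m) * row m i - row m i * sf S (link_color m)
   - row m i * (lterm mu' (link_color m) i - lterm mu' (link_color m) i.-1)
   - row m i.-1 * lterm (sx S) (link_color m) i.-1).
Hypothesis hS : forall i, h i * skx S i = sx S i * h i.+1.
Hypothesis fh : forall j i, (0 < j <= r)%N ->
  sf S j * h i - h i * sf S j = - (lterm mu' j i - lterm mu' j i.-1) * h i.
Hypothesis A0 : A 0.
Hypothesis AB : forall u u', A u -> A u' -> A (u - u').
Hypothesis AM : forall u u', A u -> A u' -> A (u * u').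
Hypothesis Ascal : forall u, scal S u -> A u.
Hypothesis As' : forall i, A (s' i).
Hypothesis Af : forall j, A (sf S j).

(** Expand row [m.+1] and move [f_j] through the product of row, [h] and column. The bracket with
    [h] cancels the terms in [mu'], and the bracket with the column is given by [lower_sv]. *)
Lemma lax_step m n : (0 < m < 2 * r)%N ->
  (0 < n <= 2 * r - (link_color m).-1)%N ->
  A (lax m n) -> ((1 < n)%N -> A (lax m n.-1)) -> A (lax m.+1 n).
Proof.
move=> hm hn Amn Amn'; set j := link_color m in hn;
  have hj : (0 < j <= r)%N by apply: linkE.
have [y [sy y0 hy]] := lower_sv S hj hn.
suff -> : lax m.+1 n = s' m *
  (sf S j * lax m n - lax m n * sf S j - y * lax m n.-1).
  apply: AM => //; apply: AB.
    by apply: AB; apply: AM.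
  have [n1|n1] := ltnP 1 n; first by apply: AM; [apply: Ascal|apply: Amn'].
  (* There is no column 0 to fall back on, but for [n = 1] the scalar [y] is 0 because link 0 has no
     colour. *)
  have n1' : n = 1%N by case/andP: hn n1; lia.
  by rewrite y0 ?mul0r // n1' /link_color leq0n eq_sym -lt0n; case/andP: hj.
pose F i := row m i * (h i * sv S n i).
(* By [hS] this is the superdiagonal term of [Phi_j] at [i]; it is also the subdiagonal term of the
   row recursion at [i.+1], so the two sums cancel. *)
pose Q i := lterm (sx S) j i * (row m i * (h i.+1 * sv S n i.+1)).
have xC i u : lterm (sx S) j i * u = u * lterm (sx S) j i.
  by rewrite /lterm mulrnAl mulrnAr (scalC u (scalx S i)).
have eF i : row m.+1 i * (h i * sv S n i) =
   s' m * (sf S j * F i - F i * sf S j - y * (row m i * (h i * sv S n.-1 i))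
     + Q i - lterm (sx S) j i.-1 * (row m i.-1 * (h i * sv S n i))).
  rewrite rowS // -mulrA; congr (_ * _); rewrite -/j.
  have hk : h i * lterm (skx S) j i = lterm (sx S) j i * h i.+1.
    by rewrite /lterm mulrnAl mulrnAr hS.
  have e1 := hy i; rewrite /lower in e1.
  have e2 := fh i hj.
  have yC : y * (row m i * h i) = row m i * h i * y by rewrite (scalC _ sy).
  apply/eqP; rewrite -subr_eq0 /F /Q; apply/eqP.
  transitivity (- (row m i *
    (sf S j * h i - h i * sf S j - - (lterm mu' j i - lterm mu' j i.-1) * h i) *
    sv S n i)
    - (row m i * h i) * (sf S j * sv S n i - sv S n i * sf S j +
        lterm (skx S) j i * sv S n i.+1 - y * sv S n.-1 i)
    + row m i * (h i * lterm (skx S) j i - lterm (sx S) j i * h i.+1) *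
      sv S n i.+1
    + (row m i * lterm (sx S) j i - lterm (sx S) j i * row m i) * h i.+1 *
      sv S n i.+1
    + (y * (row m i * h i) - row m i * h i * y) * sv S n.-1 i
    + (lterm (sx S) j i.-1 * row m i.-1 - row m i.-1 * lterm (sx S) j i.-1) *
      h i * sv S n i).
    non_commutative_ring.
  rewrite e1 e2 hk yC !(xC _ (row _ _)) !subrr.
  by rewrite !(mul0r, mulr0, oppr0, addr0).
rewrite /lax; under eq_bigr do rewrite eF.
rewrite -mulr_sumr; congr (_ * _).
rewrite sumrB big_split /= !sumrB -!mulr_sumr -mulr_suml -addrA.
rewrite [X in _ + X](_ : _ = 0) ?addr0 //.
(* After the shift of index only the end terms remain; they vanish because links 0 and [2 * r] have
   colour 0. *)
rewrite big_ord_recr [X in _ - X]big_ord_recl /= /Q.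
rewrite (@lterm0 (sx S) j) ?mul0r ?add0r; last by lia.
rewrite [lterm _ _ (2 * r)]/lterm link_top; case: eqP => [e|_]; first by lia.
by rewrite mulr0n mul0r addr0 subrr.
Qed.

End Product.
End LaxRecursion.

(** * Induction over the entries, alternating between [L] and its opposite ring *)

Section Induction.
Variables (L : nzRingType) (r : nat) (S : side L r) (S' : side (L^c)%type r).
Variables (h : nat -> L).
Variable A : L -> Prop.
Hypothesis eS' : forall j, se S' j = sf S j.
Hypothesis fS' : forall j, sf S' j = se S j.
Hypothesis xS' : forall i, sx S' i = sx S i.
Hypothesis kxS' : forall i, skx S' i = skx S i.
Hypothesis hS : forall i, h i * skx S i = sx S i * h i.+1.
Hypothesis hkC : forall i, h i * skx S i = skx S i * h i.
Hypothesis fh : forall j i, (0 < j <= r)%N ->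
  sf S j * h i - h i * sf S j =
    - (@lterm L r (smu S') j i - @lterm L r (smu S') j i.-1) * h i.
Hypothesis eh : forall j i, (0 < j <= r)%N ->
  h i * se S j - se S j * h i = - h i *
    (lterm r (smu S) j i - lterm r (smu S) j i.-1).
Hypothesis A0 : A 0.
Hypothesis AB : forall u u', A u -> A u' -> A (u - u').
Hypothesis AM : forall u u', A u -> A u' -> A (u * u').
Hypothesis Ascal : forall u, scal S u -> A u.
Hypothesis Ascal' : forall u, scal S' u -> A u.
Hypothesis Ae : forall j, A (se S j).
Hypothesis Af : forall j, A (sf S j).
Hypothesis A1 : A (h 1%N).

Lemma lax_mem m n : (0 < m <= 2 * r)%N -> (0 < n <= 2 * r)%N ->
  A (\sum_(i < (2 * r).+1) (sv S' m i : L) * (h i * sv S n i)).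
Proof.
pose T m n : L := \sum_(i < (2 * r).+1) (sv S' m i : L) * (h i * sv S n i).
rewrite -/(T m n); have [N] := ubnP (m + n);
  elim: N m n => // N IH m n mnN hm hn.
have [/andP[/eqP m1 /eqP n1]|mn1] := boolP ((m == 1%N) && (n == 1%N)).
  rewrite /T m1 n1 (bigD1 (Ordinal (_ : 1 < (2 * r).+1)%N)) //=; first by lia.
  move=> r2; rewrite big1 ?addr0; first by rewrite !side_v1 /= mul1r mulr1.
  by move=> i /eqP i1; rewrite !side_v1; case: eqP => [e|_]; rewrite ?mul0r //;
    case: i1; apply: val_inj.
have [nm|mn] := leqP n m.
  case: m => // m in mnN hm mn1 nm *; have {}hm : (0 < m < 2 * r)%N by lia.
  have := @lax_step L r S (smu S') (ss S') h (sv S') A.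
  rewrite /lax; apply => //.
  - move=> k i hk; rewrite (@side_vS _ _ S' k i hk) [LHS](scalC _ (scals S' k)).
    by rewrite /raise eS' /lterm xS'.
  - by move=> i; apply/Ascal'/scals.
  (* The bound of [lax_step] is [2r + 1 - m >= m + 1] for [m <= r] and exactly [m + 1] for [m > r],
     so [n <= m + 1] is enough. *)
  - by move: nm hn; rewrite /link_color; case: ifP; lia.
  - by apply: IH; lia.
  - by move=> n1; apply: IH; lia.
case: n => // n in mnN hn mn1 mn *; have {}hn : (0 < n < 2 * r)%N by lia.
have eT k l : T k l =
  \sum_(i < (2 * r).+1) ((sv S l i : L^c) * ((h i : L^c) * (sv S' k i : L^c))).
  by apply: eq_bigr => i _; rewrite /= mulrA.
have := @lax_step L^c r S' (smu S) (ss S) h (sv S) A.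
rewrite /lax eT; apply => //.
- move=> k i hk; rewrite (@side_vS _ _ S k i hk) [LHS](scalC _ (scals S k)).
  by rewrite /raise fS' /lterm xS'.
(* The opposite ring exchanges the factors; [hkC] and the centrality of [sx] restore them. *)
- move=> i; rewrite kxS' xS' -[LHS]/(skx S i * h i) -[RHS]/(h i.+1 * sx S i).
  by rewrite -hkC hS (scalC _ (scalx S i)).
- move=> j i hj; rewrite fS' -[RHS]/(h i * - _).
  by rewrite -[LHS]/(h i * se S j - se S j * h i) eh // mulNr mulrN.
- by move=> u u' Au Au'; apply: AM.
- by move=> i; apply/Ascal/scals.
- by move=> j; rewrite fS'.
- by move: mn hm; rewrite /link_color; case: ifP; lia.
- by rewrite -eT; apply: IH; lia.
- by move=> n1; rewrite -eT; apply: IH; lia.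
Qed.
End Induction.

(** * Partial fractions *)

Section PartialFractions.
Variables (C : comUnitRingType) (I : finType) (x : I -> C).
Hypothesis xU : forall i j, i != j -> x i - x j \is a GRing.unit.

(** The ring need not be a domain; unit differences of the nodes replace distinctness. *)
Lemma poly_roots0 (R : {poly C}) :
  (size R <= #|I|)%N -> (forall i, R.[x i] = 0) -> R = 0.
Proof.
move=> sR R0; apply/eqP; apply: contraTT sR => nz;
  rewrite -ltnNge cardE -(size_map x).
apply: max_ring_poly_roots => //.
  by apply/allP => _ /mapP[i _ ->]; apply/rootP.
elim: (enum I) (enum_uniq I) => //= i e IH /andP[ie /IH ->]; rewrite andbT.
apply/allP => _ /mapP[j je ->]; rewrite /diff_roots mulrC eqxx /= xU //.
by apply: contraNneq ie => <-.
Qed.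

Variable s : seq C.
Hypothesis ss : (size s <= #|I|)%N.

Let N : {poly C} := \prod_(v <- s) ('X - v%:P).
Let M : {poly C} := \prod_i ('X - (x i)%:P).
Let M' i : {poly C} := \prod_(j | j != i) ('X - (x j)%:P).
Definition pf_residue i : C :=
  (\prod_(v <- s) (x i - v)) / \prod_(j | j != i) (x i - x j).
Let c : C := (size s == #|I|)%:R.

Let M'E i j : (M' i).[x j] = (\prod_(j | j != i) (x i - x j)) *+ (i == j).
Proof.
rewrite /M' horner_prod; case: eqVneq => [->|ij].
  by apply: eq_bigr => k _; rewrite hornerXsubC.
by rewrite (bigD1 j) 1?eq_sym //= hornerXsubC subrr mul0r.
Qed.

Let prodU i : \prod_(j | j != i) (x i - x j) \is a GRing.unit.
Proof. by apply: rpred_prod => j ji; rewrite xU // eq_sym. Qed.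

Let coefN j : (size s <= j)%N -> N`_j = (j == size s)%:R.
Proof.
rewrite leq_eqVlt => /predU1P[<-|sj].
  rewrite eqxx; have := monic_prod_XsubC s xpredT id => /monicP.
  by rewrite /lead_coef size_prod_XsubC.
by rewrite gtn_eqF // nth_default // size_prod_XsubC.
Qed.

Let coefM j : (#|I| <= j)%N -> M`_j = (j == #|I|)%:R.
Proof.
have sM : size M = #|I|.+1 by rewrite /M size_prod_XsubC cardT enumT.
rewrite leq_eqVlt => /predU1P[<-|sj].
  rewrite eqxx; have := monic_prod_XsubC (index_enum I) xpredT x => /monicP.
  by rewrite /lead_coef sM.
by rewrite gtn_eqF // nth_default // sM.
Qed.

Let M'f i : M' i = \prod_(v <- [seq x j | j <- enum I & j != i]) ('X - v%:P).
Proof. by rewrite big_map big_filter big_enum_cond. Qed.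

Let sM' i : size [seq x j | j <- enum I & j != i] = #|I|.-1.
Proof.
by rewrite size_map size_filter -(cardC1 i) cardE {2}/enum_mem size_filter
  enumT.
Qed.

Let coefM' i j : (#|I|.-1 <= j)%N -> (M' i)`_j = (j == #|I|.-1)%:R.
Proof.
rewrite leq_eqVlt => /predU1P[<-|sj]; rewrite M'f.
  rewrite eqxx; have :=
    monic_prod_XsubC [seq x j | j <- enum I & j != i] xpredT id => /monicP.
  by rewrite /lead_coef size_prod_XsubC sM'.
by rewrite gtn_eqF // nth_default // size_prod_XsubC sM'.
Qed.

(** Lagrange interpolation: both sides agree at the nodes, and [c] cancels the leading term of [N]
    when the degrees of [N] and [M] agree, so the difference has too many roots. *)
Let pf_poly : N = c%:P * M + \sum_i (pf_residue i)%:P * M' i.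
Proof.
apply/eqP; rewrite -subr_eq0; apply/eqP; apply: poly_roots0.
  apply/leq_sizeP => j jn; rewrite coefB coefD coefCM coef_sum.
  rewrite coefN ?(leq_trans ss) // coefM // big1 ?addr0; last first.
    move=> i _; rewrite coefCM coefM' ?(leq_trans (leq_pred _)) //.
    have n0 : (0 < #|I|)%N by apply/card_gt0P; exists i.
    by rewrite gtn_eqF ?mulr0 //; apply: leq_trans jn; rewrite prednK.
  rewrite /c; have [->|jn'] := eqVneq j #|I|.
    by rewrite mulr1 eq_sym subrr.
  rewrite mulr0 subr0 gtn_eqF //; apply: leq_ltn_trans ss _.
  by rewrite ltn_neqAle eq_sym jn'.
move=> i; rewrite hornerD hornerN hornerD hornerCM horner_sum
  [X in _ - (_ + X)](bigD1 i) //= hornerCM M'E eqxx mulr1n.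
rewrite [X in _ - (_ + (_ + X))]big1 => [|j ji];
  last by rewrite hornerCM M'E (negPf ji) mulr0.
rewrite divrK // addr0 /N /M horner_prod.
rewrite [X in c * X](_ : _ = 0) ?mulr0 ?add0r; last first.
  by rewrite horner_prod (bigD1 i) //= hornerXsubC subrr mul0r.
by apply/eqP; rewrite subr_eq0; apply/eqP; apply: eq_bigr => k _;
  rewrite hornerXsubC.
Qed.

Lemma partial_fractions y : (forall i, y - x i \is a GRing.unit) ->
  (\prod_(v <- s) (y - v)) / (\prod_i (y - x i))
  = (size s == #|I|)%:R + \sum_i pf_residue i / (y - x i).
Proof.
move=> yU; have PU : \prod_i (y - x i) \is a GRing.unit by apply: rpred_prod.
apply: (mulIr PU); rewrite divrK // mulrDl mulr_suml.
have := congr1 (fun q => q.[y]) pf_poly;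
  rewrite hornerD hornerCM /N horner_prod.
under eq_bigr do rewrite hornerXsubC.
move=> ->; congr (c * _ + _); first by rewrite horner_prod;
  apply: eq_bigr => i _; rewrite hornerXsubC.
rewrite horner_sum; apply: eq_bigr => i _;
  rewrite hornerCM (bigD1 i) //= mulrA divrK //.
by rewrite horner_prod; congr (_ * _); apply: eq_bigr => j _;
  rewrite hornerXsubC.
Qed.

(** This is the coefficient of [y^-1] in [N / M], read off by comparing the coefficients of degree
    [#|I|.-1] in [pf_poly]. *)
Lemma sum_pf_residue : \sum_i pf_residue i =
  if size s == #|I| then \sum_i x i - \sum_(v <- s) v
  else ((size s).+1 == #|I|)%:R.
Proof.
have [I0|I0] := posnP #|I|.
  have e (F : I -> C) : \sum_i F i = 0 by apply: big1 => i;
    have := card0_eq I0 i.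
  rewrite !e; move: ss; rewrite I0 leqn0 => /eqP s0; rewrite s0 /=.
  by rewrite (size0nil s0) big_nil subr0.
have := congr1 (fun q : {poly C} => q`_(#|I|.-1)) pf_poly.
rewrite coefD coefCM coef_sum => h.
have {h} : \sum_i pf_residue i = N`_(#|I|.-1) - c * M`_(#|I|.-1).
  rewrite h addrAC subrr add0r; apply: eq_bigr => i _.
  by rewrite coefCM coefM' // eqxx mulr1.
move=> ->; rewrite /c; case: eqP => sI; last first.
  rewrite mul0r subr0 coefN; last by move: ss sI; lia.
  by congr (_%:R); rewrite -(eqn_add2r 1) !addn1 prednK // eq_sym.
have e1 : M`_(#|I|.-1) = - \sum_i x i.
  have <- : size (map x (enum I)) = #|I| by rewrite size_map -cardT.
  rewrite /M -big_enum -(big_map x xpredT (fun v => 'X - v%:P)).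
  rewrite coefPn_prod_XsubC ?size_map -?enumT -?cardT -?lt0n //.
  by rewrite big_map big_enum.
rewrite ?mulr1n mul1r e1 -sI /N coefPn_prod_XsubC ?sI -?lt0n //.
by rewrite opprK addrC.
Qed.

End PartialFractions.

(** * Oscillators over a commutative ring of functions of the momenta *)

Section Oscillator.
Variables (K : numFieldType) (C : comUnitRingType) (eta : {rmorphism K -> C}).
Variables (r : nat) (a : nat -> nat).
Variable p : forall i, 'I_(a i) -> C.
Variable sg : bool -> forall i, 'I_(a i) -> {rmorphism C -> C}.
Variable zs : nat -> seq K.
Variable z : C.

Local Notation unit := (@GRing.unit C).
Local Notation link := (link_color r).

Definition pstep (b : nat) : nat := if b == r then 2%N else 1%N.

Hypothesis r0 : (0 < r)%N.
Hypothesis a0 : a 0 = 0%N.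
Hypothesis sgp : forall s b (k : 'I_(a b)) j (l : 'I_(a j)),
  sg s k (p l) = p l - (if s then 1 else - 1) *
    (pstep b)%:R *+ ((b == j) && (k == l :> nat)).
Hypothesis sg_eta : forall s b (k : 'I_(a b)) x, sg s k (eta x) = eta x.
Hypothesis sg_z : forall s b (k : 'I_(a b)), sg s k z = z.
Hypothesis pU : forall b (k l : 'I_(a b)) (n : int), k != l -> p k - p l +
  n%:~R \is a unit.
Hypothesis zU : forall b (k : 'I_(a b)) (n : int), z + n%:~R - p k \is a unit.

Definition pprod (b : nat) (y : C) : C := \prod_(k < a b) (y - p k).
Definition pprod' (b : nat) (k : 'I_(a b)) (y : C) : C :=
  \prod_(l < a b | l != k) (y - p l).

Lemma PE b (k : 'I_(a b)) y : pprod b y = (y - p k) * pprod' k y.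
Proof. by rewrite /pprod (bigD1 k). Qed.

Lemma sgP_ne s b (k : 'I_(a b)) j y : b != j -> sg s k (pprod j y) =
  pprod j (sg s k y).
Proof.
move=> bj; rewrite rmorph_prod; apply: eq_bigr => l _.
by rewrite rmorphB sgp (negPf bj) subr0.
Qed.

Lemma sgpp s b (k : 'I_(a b)) : sg s k (p k) = p k - (if s then 1 else - 1) *
  (pstep b)%:R.
Proof. by rewrite sgp !eqxx. Qed.

Lemma sgp_ne s b (k l : 'I_(a b)) : k != l -> sg s k (p l) = p l.
Proof. by move=> link_ratio;
  rewrite sgp eqxx /= (inj_eq val_inj) (negPf link_ratio) subr0. Qed.

Lemma sgP' s b (k : 'I_(a b)) y : sg s k (pprod' k y) = pprod' k (sg s k y).
Proof.
rewrite rmorph_prod; apply: eq_bigr => l lk.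
by rewrite rmorphB sgp_ne // eq_sym.
Qed.

Lemma ddU b : ((pstep b)%:R : C) \is a unit.
Proof.
rewrite -(rmorph_nat eta) rmorph_unit // unitfE pnatr_eq0 /pstep.
by case: ifP.
Qed.

(** Listed as roots so that [partial_fractions] applies to [h_(b+1) / h_b], which is [hratio b]. *)
Definition nroots (b : nat) : seq C :=
  [seq eta x | x <- zs b] ++ [seq p k + 1 | k <- enum 'I_(a b.-1)] ++
  (if b == r then [seq p k + 2 | k <- enum 'I_(a b.-1)] else
    [seq p k | k <- enum 'I_(a b.+1)]).

Definition Zprod (b : nat) (y : C) : C := \prod_(x <- zs b) (y - eta x).

Definition numer (b : nat) (y : C) : C :=
  Zprod b y * pprod b.-1 (y - 1) *
    (if b == r then pprod b.-1 (y - 2) else pprod b.+1 y).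

Lemma numerE b y : \prod_(v <- nroots b) (y - v) = numer b y.
Proof.
rewrite /nroots !big_cat !big_map /numer -mulrA; congr (_ * (_ * _)).
  by rewrite /= ?enumT; apply: eq_bigr => k _; ring.
by case: ifP => _; rewrite big_map ?enumT; apply: eq_bigr => k _ //; ring.
Qed.

Definition hratio (b : nat) (y : C) : C :=
  numer b y / (pprod b y * pprod b (y - (pstep b)%:R)).

Hypothesis szr : forall b, (0 < b <= r)%N -> (size (nroots b) <= a b + a b)%N.

(** The value of [hratio b] at infinity; [kappa b] is [c_b] times its coefficient of [y^-1]. *)
Definition hratio_lead (b : nat) : K := (size (nroots b) == a b + a b)%:R.
Definition kappa (b : nat) : C := (pstep b)%:R *
  (if size (nroots b) == (a b + a b)%N
   then \sum_(k < a b) (p k + (p k + (pstep b)%:R)) - \sum_(v <- nroots b) v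
   else ((size (nroots b)).+1 == a b + a b)%:R).

Definition e_numer (b : nat) (y : C) : C := pprod b.-1 (y - 1) *
  (if b == r then pprod b.-1 (y - 2) else 1).
Definition f_numer (b : nat) (y : C) : C := Zprod b y *
  (if b == r then 1 else pprod b.+1 y).
(** [e_b(y)] is the sum of the [(y - p)^-1 e_coef e^q], and [f_b(y)] that of the
    [e^(-q) (y - p)^-1 f_coef]. With [e^(-q)] on the left, the shifts by [c_b] leave the numerator
    and the pole of [f_b] and enter the argument of [pprod']. *)
Definition e_coef b (k : 'I_(a b)) : C := e_numer b (p k) / pprod' k (p k).
Definition f_coef b (k : 'I_(a b)) : C :=
  - f_numer b (p k) / pprod' k (p k - (pstep b)%:R).

Lemma sgZp s b (k : 'I_(a b)) j y : sg s k (Zprod j y) = Zprod j (sg s k y).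
Proof. by rewrite rmorph_prod; apply: eq_bigr => x _; rewrite rmorphB sg_eta.
  Qed.

Lemma sg_numer s b (k : 'I_(a b)) y : (0 < b)%N -> sg s k (numer b y) =
  numer b (sg s k y).
Proof.
move=> b0; have hb : b != b.-1 by lia.
have hb' : b != b.+1 by lia.
rewrite /numer !rmorphM sgZp sgP_ne // rmorphB rmorph1; congr (_ * _).
by case: ifP => _; rewrite sgP_ne // rmorphB rmorph_nat.
Qed.

Lemma P'U b (k : 'I_(a b)) (n : int) : pprod' k (p k + n%:~R) \is a unit.
Proof. by apply: rpred_prod => l lk; rewrite addrAC pU // eq_sym. Qed.

Lemma GU b (k : 'I_(a b)) : e_coef k * f_coef k =
  - numer b (p k) / (pprod' k (p k) * pprod' k (p k - (pstep b)%:R)).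
Proof.
rewrite /e_coef /f_coef mulrACA -invrM; first last.
- by have := P'U k 0; rewrite addr0.
- by have := P'U k (- (pstep b)%:Z); rewrite rmorphN.
congr (_ / _); last by rewrite mulrC.
rewrite /e_numer /f_numer /numer; case: ifP => _; ring.
Qed.

(** * The ratio [h_(b+1) / h_b] in partial fractions *)

Section PF.
Variable b : nat.
Hypothesis hb : (0 < b <= r)%N.
Let d := pstep b.

Let pole (i : 'I_(a b) + 'I_(a b)) : C := match i with inl k => p k | inr k =>
  p k + d%:R end.

Let poleU i j : i != j -> pole i - pole j \is a unit.
Proof.
have h := @pU b; have hd := ddU b.
case: i j => [k|k] [l|l] /= link_ratio.
- by have := h k l 0 link_ratio; rewrite addr0.
- have [<-|{}link_ratio] := eqVneq k l;
    first by rewrite opprD addrA subrr sub0r unitrN.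
  by have := h k l (- d%:Z) link_ratio; rewrite rmorphN opprD addrA.
- have [<-|{}link_ratio] := eqVneq k l; first by rewrite addrAC subrr add0r.
  by have := h k l d link_ratio; rewrite addrAC.
- by have := h k l 0 link_ratio; rewrite addr0 opprD addrACA subrr addr0.
Qed.

Let prod_pole y : \prod_i (y - pole i) = pprod b y * pprod b (y - d%:R).
Proof.
rewrite big_sumType /=; congr (_ * _); apply: eq_bigr => k _; ring.
Qed.

Lemma sgGU (k : 'I_(a b)) : sg false k (e_coef k * f_coef k) =
  - numer b (p k + d%:R) / (pprod' k (p k + d%:R) * pprod' k (p k)).
Proof.
have e : sg false k (p k) = p k + d%:R by rewrite sgpp mulN1r opprK.
have b0 : (0 < b)%N by case/andP: hb.
rewrite GU rmorph_div; last first.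
  rewrite unitrM -{1}[p k]addr0 -[0]/(0%:~R) P'U.
  by have := P'U k (- (pstep b)%:Z); rewrite rmorphN.
rewrite rmorphN sg_numer // e rmorphM !sgP' rmorphB e rmorph_nat addrK.
by [].
Qed.

(** At [p_k] the second factor of the denominator, [P_b(y - d)], contributes [- d], whence the
    factor [d]. At the pole [p_k + d] the first factor contributes [+ d], whence the sign in
    [resr]. *)
Let resl (k : 'I_(a b)) : d%:R * pf_residue pole (nroots b) (inl k) = e_coef k *
  f_coef k.
Proof.
rewrite GU /pf_residue numerE big_sumType /=.
rewrite [X in _ / (X * _)](_ : _ = pprod' k (p k)); last first.
  by apply: eq_bigl => l; rewrite /= (inj_eq inl_inj).
rewrite [X in _ / (_ * X)](_ : _ = - d%:R * pprod' k (p k - d%:R)); last first.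
  transitivity (pprod b (p k - d%:R));
    last by rewrite (PE k) addrAC subrr add0r.
  by apply: eq_bigr => l _; ring.
have AU : pprod' k (p k) \is a unit by have := P'U k 0; rewrite addr0.
have BU : pprod' k (p k - d%:R) \is a unit by have := P'U k (- d%:Z);
  rewrite rmorphN.
apply: (mulIr (_ : pprod' k (p k) * pprod' k (p k - d%:R) \is a unit));
  first by rewrite unitrM AU.
set X := _ * (- d%:R * _); rewrite [RHS]divrK ?unitrM ?AU //.
have XU : X \is a unit by rewrite !unitrM unitrN AU BU ddU.
rewrite -[RHS](divrK XU) /X; ring.
Qed.

Let resr (k : 'I_(a b)) : d%:R * pf_residue pole (nroots b) (inr k) =
  - sg false k (e_coef k * f_coef k).
Proof.
rewrite sgGU /pf_residue numerE big_sumType /=.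
rewrite [X in _ / (_ * X)](_ : _ = pprod' k (p k)); last first.
  by apply: eq_big => l; rewrite /= ?(inj_eq inr_inj) // => _; ring.
rewrite [X in _ / (X * _)](_ : _ = d%:R * pprod' k (p k + d%:R)); last first.
  transitivity (pprod b (p k + d%:R));
    last by rewrite (PE k) addrAC subrr add0r.
  by apply: eq_bigr.
have AU : pprod' k (p k) \is a unit by have := P'U k 0; rewrite addr0.
have BU : pprod' k (p k + d%:R) \is a unit by have := P'U k d%:Z.
apply: (mulIr (_ : pprod' k (p k + d%:R) * pprod' k (p k) \is a unit));
  first by rewrite unitrM BU.
set X := d%:R * pprod' k _ * _;
  rewrite [RHS]mulNr [in RHS]divrK ?unitrM ?BU // opprK.
have XU : X \is a unit by rewrite !unitrM AU BU ddU.
rewrite -[RHS](divrK XU) /X; ring.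
Qed.

Let szb : (size (nroots b) <= #|{: 'I_(a b) + 'I_(a b)}|)%N.
Proof. by rewrite card_sum card_ord szr. Qed.

(** The left side is what remains of the bracket of [e_b(y)] with [f_b^(1)] once terms with
    different oscillators have cancelled. *)
Lemma kf_partial_fractions y : (forall k : 'I_(a b), y - p k \is a unit) ->
  (forall k : 'I_(a b), y - (p k + d%:R) \is a unit) ->
  \sum_(k < a b) (e_coef k * f_coef k / (y - p k)
    - sg false k (e_coef k * f_coef k) / (y - (p k + d%:R)))
  = d%:R * (hratio b y - eta (hratio_lead b)).
Proof.
move=> yU yU'; have ypoleU i : y - pole i \is a unit by case: i.
have := partial_fractions poleU szb ypoleU.
rewrite prod_pole numerE -/(hratio b y) card_sum card_ord big_sumType /= => ->.
rewrite rmorph_nat addrAC subrr add0r mulrDr !mulr_sumr -big_split /=.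
by apply: eq_bigr => k _;
  rewrite [X in _ = X + _]mulrA [X in _ = _ + X]mulrA resl resr mulNr.
Qed.

Lemma kappa_sum : \sum_(k < a b)
  (e_coef k * f_coef k - sg false k (e_coef k * f_coef k)) = kappa b.
Proof.
have := sum_pf_residue poleU szb.
rewrite /kappa card_sum card_ord !big_sumType /= -!big_split /= => <-.
rewrite mulr_sumr; apply: eq_bigr => k _.
by rewrite mulrDr resl resr.
Qed.

End PF.

Lemma sum_sub_sg b (k : 'I_(a b)) j (t : C) : sg true k t = t ->
  \sum_(l < a j) (p l + t) - sg true k (\sum_(l < a j) (p l + t)) =
    (pstep b * (b == j))%N%:R.
Proof.
move=> wt_scale; rewrite rmorph_sum -sumrB.
under eq_bigr do rewrite rmorphD wt_scale sgp mul1r opprD addrACA subrr addr0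
  opprB addrCA subrr addr0.
have [bj|bj] := eqVneq b j; last by rewrite big1 ?muln0 // => l _;
  rewrite andFb mulr0n.
move: k wt_scale; rewrite bj => k wt_scale.
rewrite (bigD1 k) //= eqxx mulr1n muln1 big1 ?addr0 // => l lk.
by rewrite (inj_eq val_inj) eq_sym (negPf lk).
Qed.

Lemma sg_nroots_sum b (k : 'I_(a b)) j :
  \sum_(v <- nroots j) v - sg true k (\sum_(v <- nroots j) v)
  = (pstep b * ((b == j.-1) * (if j == r then 2 else 1) + (b == j.+1) *
    (j != r)))%N%:R.
Proof.
rewrite /nroots !big_cat !big_map /= !rmorphD.
rewrite [X in _ - (X + _)](_ : _ = \sum_(x <- zs j) eta x); last first.
  by rewrite rmorph_sum; apply: eq_bigr => x _; rewrite sg_eta.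
rewrite opprD addrACA subrr add0r opprD addrACA sum_sub_sg ?rmorph1 //.
case: ifP => jr /=.
  by rewrite big_map ?big_enum sum_sub_sg ?rmorph_nat // -natrD; congr (_%:R);
    lia.
rewrite big_map ?big_enum; under eq_bigr do rewrite -[p _]addr0.
by rewrite sum_sub_sg ?rmorph0 // -natrD; congr (_%:R); lia.
Qed.

Definition wt_scale (j : nat) : K := (pstep j)%:R ^+ 2 * hratio_lead j.
(** The second factor is a Cartan integer of type [C_r]: the neighbours of link [b] are counted by
    colour, and for [b = r] both have colour [r - 1]. *)
Definition wt_coef (j b : nat) : K := wt_scale j *
  ((b == j)%:R *+ 2 - (link b.+1 == j)%:R - (link b.-1 == j)%:R).

(** [kappa j] is constant or affine in the momenta, so shifting one momentum changes it by a
    constant. *)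
Lemma kappa_sg j b (k : 'I_(a b)) : (0 < b <= r)%N -> (0 < j <= r)%N ->
  kappa j - sg true k (kappa j) = eta (wt_coef j b).
Proof.
move=> hb hj; rewrite /kappa /wt_coef /wt_scale /hratio_lead rmorphM rmorph_nat
  -mulrBr.
case: eqP => _; last by rewrite mulr0 mul0r rmorph0 rmorph_nat subrr mulr0.
(* Symmetrizability of the Cartan matrix: it trades [c_j c_b] for [c_j ^ 2]. *)
have key : (pstep j * pstep b *
  ((b == j.-1) * (if j == r then 2 else 1) + (b == j.+1) * (j != r))
   = pstep j * pstep j * ((link b.+1 == j) + (link b.-1 == j)))%N.
  rewrite /pstep /link; do !case: ifP; do !case: eqP; lia.
have key2 : (pstep b * (b == j) = pstep j * (b == j))%N by have [->|] :=
  eqVneq b j; rewrite ?muln0.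
have kA : \sum_(l < a j) (p l + (p l + (pstep j)%:R))
  - sg true k (\sum_(l < a j) (p l + (p l + (pstep j)%:R)))
   = (pstep j * (b == j) * 2)%N%:R.
  rewrite big_split rmorphD opprD addrACA sum_sub_sg ?rmorph_nat //.
  under eq_bigr do rewrite -[p _]addr0.
  by rewrite sum_sub_sg ?rmorph0 // -natrD -key2 muln2 addnn.
transitivity ((pstep j)%:R *
  ((\sum_(l < a j) (p l + (p l + (pstep j)%:R))
    - sg true k (\sum_(l < a j) (p l + (p l + (pstep j)%:R))))
   - (\sum_(v <- nroots j) v - sg true k (\sum_(v <- nroots j) v)))).
  by rewrite rmorphB; ring.
rewrite kA sg_nroots_sum mulrBr -[X in _ - X]natrM mulnA key !natrM natrD.
by rewrite rmorphM mulr1n mulr1 rmorphXn !rmorphB rmorphMn !rmorph_nat /=; ring.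
Qed.

(** The point at which the entries of [E] and [F] next to the diagonal at link [i] evaluate the
    basic series of colour [link i]. *)
Definition link_pt (i : nat) : C := if (i <= r)%N then z else z + (link i)%:R
  - r%:R - 1.

Definition link_ratio (j i : nat) : C :=
  hratio (link i) (link_pt i) *+ (link i == j).
Definition link_pole b (k : 'I_(a b)) (i : nat) : C :=
  (pstep b)%:R / (link_pt i - p k) *+ (link i == b).

Lemma ylE i : exists n : int, link_pt i = z + n%:~R.
Proof.
rewrite /link_pt; case: ifP => _; first by exists 0; rewrite addr0.
exists ((link i)%:Z - r%:Z - 1); rewrite !rmorphB /= rmorph1 !addrA.
by [].
Qed.

Lemma sg_yl s b (k : 'I_(a b)) i : sg s k (link_pt i) = link_pt i.
Proof. by have [n ->] := ylE i; rewrite rmorphD rmorph_int sg_z. Qed.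

Lemma ylU b (k : 'I_(a b)) i (n : int) : link_pt i + n%:~R - p k \is a unit.
Proof. by have [m ->] := ylE i; rewrite -[z + _ + _]addrA -intrD zU. Qed.

Lemma ylUn b (k : 'I_(a b)) i (n : nat) : link_pt i - n%:R - p k \is a unit.
Proof. by have := ylU k i (- n%:Z); rewrite rmorphN. Qed.

Lemma ylU0 b (k : 'I_(a b)) i : link_pt i - p k \is a unit.
Proof. by have := ylU k i 0; rewrite addr0. Qed.

Lemma PylU b i n : pprod b (link_pt i - n%:R) \is a unit.
Proof. by apply: rpred_prod => k _; apply: ylUn. Qed.

Lemma PylU0 b i : pprod b (link_pt i) \is a unit.
Proof. by have := PylU b i 0; rewrite subr0. Qed.

Lemma sgtp b (k : 'I_(a b)) : sg true k (p k) = p k - (pstep b)%:R.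
Proof. by rewrite sgpp mul1r. Qed.

(* Both [hratio b y] and its shift are the same shift-invariant element divided by
   [u (u - d)] and [(u + d) u] respectively, where [u = y - p]. *)
Lemma kf_sg_self b (k : 'I_(a b)) i : (0 < b)%N ->
  let u := link_pt i - p k in let kb := hratio b (link_pt i) in
  kb * (u - (pstep b)%:R) = sg true k kb * (u + (pstep b)%:R).
Proof.
move=> b0 u kb; pose d : C := (pstep b)%:R.
have uU : u \is a unit by apply: ylU0.
have udU : u - d \is a unit by rewrite /u addrAC; apply: ylUn.
have udU' : u + d \is a unit by rewrite /u addrAC;
  apply: (@ylU _ _ _ (pstep b)).
pose Q := pprod' k (link_pt i) * pprod' k (link_pt i - d).
have eP : pprod b (link_pt i) * pprod b (link_pt i - d) = u * (u - d) * Q.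
  by rewrite !(PE k) /Q /u; ring.
have QU : Q \is a unit.
  have : u * (u - d) * Q \is a unit by rewrite -eP unitrM PylU0 PylU.
  by rewrite !unitrM => /andP[].
have sQ : sg true k Q = Q by rewrite rmorphM !sgP' rmorphB sg_yl rmorph_nat.
clearbody Q.
have sd : sg true k d = d by rewrite rmorph_nat.
have su : sg true k u = u +
  d by rewrite /u rmorphB sg_yl sgtp opprB addrA addrAC.
rewrite /kb /hratio eP rmorph_div ?unitrM ?uU ?udU //.
have su2 : sg true k (u - d) =
  u by rewrite (rmorphB (sg true k) u d) su sd addrK.
rewrite sg_numer // sg_yl (rmorphM _ (u * (u - d)) Q) (rmorphM _ u) su su2 sQ.
set N := numer _ _; rewrite -/d.
apply: (mulIr (_ : u * Q \is a unit)); first by rewrite unitrM uU.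
transitivity N.
  transitivity (N / (u * (u - d) * Q) * (u * (u - d) * Q)); first by ring.
  by rewrite divrK // !unitrM uU udU.
symmetry; transitivity (N / ((u + d) * u * Q) * ((u + d) * u * Q));
  first by ring.
by rewrite divrK // !unitrM uU udU'.
Qed.

(** The factor [t] is linear in [p k], so [x] changes by a multiple of [pstep b]. This is expressed
    through [x] when [t] itself vanishes on the pole at [link_pt i], and in [sub_sgL] through the
    shift of [x] when the shift of [t] does. *)
Lemma sub_sgR b (k : 'I_(a b)) i (A t : C) : sg true k A = A ->
  t = link_pt i - p k ->
  let x := A * t in x - sg true k x = - x * ((pstep b)%:R / (link_pt i - p k)).
Proof.
move=> sA tE x; rewrite /x rmorphM sA tE rmorphB sg_yl sgtp.
rewrite mulrA mulNr -[in RHS]mulrA [_ * (pstep b)%:R]mulrC mulrA mulNr mulrK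
  ?ylU0 //.
ring.
Qed.

Lemma sub_sgL b (k : 'I_(a b)) i (A t : C) : sg true k A = A ->
  t = link_pt i - p k - (pstep b)%:R ->
  let x := A * t in x - sg true k x = - ((pstep b)%:R / (link_pt i - p k)) *
    sg true k x.
Proof.
move=> sA tE x; rewrite /x rmorphM sA tE !rmorphB sg_yl sgtp rmorph_nat.
have -> : link_pt i - (p k - (pstep b)%:R) - (pstep b)%:R = link_pt i
  - p k by ring.
rewrite mulNr mulrCA divrK ?ylU0 //; ring.
Qed.

Lemma link_le i : (i <= r)%N -> link i = i. Proof. by rewrite /link_color => ->.
  Qed.
Lemma link_gt i : (r < i)%N -> link i = (2 * r - i)%N.
Proof. by move=> h; rewrite /link_color leqNgt h. Qed.

Lemma P_sg b (k : 'I_(a b)) i (n : nat) :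
  [/\ pprod b (link_pt i - n%:R) = pprod' k (link_pt i - n%:R) *
    (link_pt i - n%:R - p k),
      pprod b (link_pt i) = pprod' k (link_pt i) * (link_pt i - p k),
      sg true k (pprod' k (link_pt i - n%:R)) = pprod' k (link_pt i - n%:R) &
      sg true k (pprod' k (link_pt i)) = pprod' k (link_pt i)].
Proof.
by rewrite !(PE k) sgP' rmorphB sgP' !sg_yl rmorph_nat ![_ * pprod' _ _]mulrC.
Qed.

(** Scalar form of the bracket of [h_(j+1) / h_j] with [e_b^(1)]. The ratio depends on [p k] only if
    [b] is [j] or a neighbour of [j]. Off the middle link, a neighbouring colour enters through a
    single linear factor: [sub_sgR] treats the one at link [i.+1], [sub_sgL] the one at [i.-1]. *)
Lemma kl_sg j b (k : 'I_(a b)) i : (0 < j)%N -> (0 < b <= r)%N ->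
  link_ratio j i - sg true k (link_ratio j i) =
  link_ratio j i * (link_pole k i - link_pole k i.+1) +
    (link_pole k i - link_pole k i.-1) * sg true k (link_ratio j i).
Proof.
move=> j0 hb; rewrite {1 2 3 4}/link_ratio; case: eqP => [lj|_]; last first.
  by rewrite mulr0n rmorph0 subrr mul0r mulr0 addr0.
rewrite mulr1n; have i0 : (0 < i < 2 * r)%N by move: lj; rewrite /link_color;
  case: ifP; lia.
have hj : (0 < j <= r)%N by rewrite -lj; apply: linkE.
have mlE n : link_pole k n =
  (pstep b)%:R / (link_pt n - p k) *+ (link n == b) by [].
have ml0 n : link n != b -> link_pole k n = 0 by rewrite mlE => /negPf->.
have ml1 n : link n = b -> link_pole k n =
  (pstep b)%:R / (link_pt n - p k) by rewrite mlE => ->; rewrite eqxx.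
rewrite lj; have [bj|bj] := eqVneq b j.
  move: k {mlE} ml0 ml1; rewrite bj => k ml0 ml1.
  have -> : link_pole k i.+1 = 0 by apply: ml0; move: lj; rewrite /link_color;
    do 2!case: ifP; lia.
  have -> : link_pole k i.-1 = 0 by apply: ml0; move: lj; rewrite /link_color;
    do 2!case: ifP; lia.
  rewrite !subr0 ml1 //; have j0' : (0 < j)%N by case/andP: hj.
  have /= := kf_sg_self k i j0'.
  set x := hratio _ _; set sx := sg _ _ _ => h.
  apply: (mulIr (ylU0 k i)).
  transitivity ((x + sx) *
    ((pstep j)%:R / (link_pt i - p k) * (link_pt i - p k))); last by ring.
  rewrite divrK ?ylU0 //; apply/eqP; rewrite -subr_eq0; apply/eqP.
  by move/eqP: h; rewrite -subr_eq0 => /eqP h; rewrite -h; ring.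
have ml_i : link_pole k i = 0 by apply: ml0; rewrite lj eq_sym.
rewrite ml_i sub0r add0r -/(link_pt i).
set y := link_pt i; set A :=
  Zprod j y / (pprod j y * pprod j (y - (pstep j)%:R)).
have sA : sg true k A = A.
  rewrite rmorph_div ?unitrM ?PylU0 ?PylU //.
  by rewrite sgZp rmorphM !(sgP_ne _ k _ bj) rmorphB rmorph_nat !sg_yl.
have kE : hratio j y = A *
  (pprod j.-1 (y - 1) * (if j == r then pprod j.-1 (y - 2) else pprod j.+1 y)).
  by rewrite /hratio /numer /A; ring.
clearbody A.
have sP j' n : b != j' -> sg true k (pprod j' (y - n%:R)) = pprod j' (y - n%:R).
  by move=> bj'; rewrite sgP_ne // rmorphB rmorph_nat sg_yl.
have sP1 j' : b != j' -> sg true k (pprod j' (y - 1)) =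
  pprod j' (y - 1) by apply: (sP _ 1%N).
have sP0 j' : b != j' -> sg true k (pprod j' y) = pprod j' y.
  by move=> bj'; rewrite sgP_ne // sg_yl.
have [ir|ri|ir] := ltngtP i r.
- have ji : j = i by rewrite -lj link_le //; lia.
  have jr : (j == r) = false by rewrite ji; apply/negbTE/eqP; lia.
  have l1 : link i.+1 = i.+1 by rewrite link_le.
  have l0 : link i.-1 = i.-1 by rewrite link_le //; lia.
  have yE : link_pt i.+1 = y by rewrite /y /link_pt !ifT //; lia.
  have y0E : link_pt i.-1 = y by rewrite /y /link_pt !ifT //; lia.
  rewrite jr in kE; have [b1|b1] := eqVneq b j.+1.
    move: k {mlE} ml0 ml1 ml_i sA sP sP1 sP0;
      rewrite b1 => k ml0 ml1 ml_i sA sP sP1 sP0.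
    rewrite (ml0 i.-1) ?l0 ?ji; last by lia.
    rewrite oppr0 mul0r addr0 ml1; last by rewrite l1 ji.
    rewrite yE.
    have [_ eP _ sP'] := P_sg k i 0.
    have := @sub_sgR _ k i.+1 (A * pprod j.-1 (y - 1) * pprod' k y) _ _ erefl.
    rewrite yE; set x := (X in let x := X in _) => /= h.
    have -> : hratio j y = x by rewrite kE eP -/y /x; ring.
    by rewrite h ?mulrN ?mulNr // 2!rmorphM sA sP' sP1 //; lia.
  have [b0|b0] := eqVneq b j.-1; last first.
    have -> : link_pole k i.-1 = 0 by apply: ml0; rewrite l0 -ji eq_sym.
    have -> : link_pole k i.+1 = 0 by apply: ml0; rewrite l1 -ji eq_sym.
    by rewrite oppr0 mul0r mulr0 addr0 kE 2!rmorphM sA sP1 ?sP0 ?subrr.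
  have d1 : pstep b = 1%N by rewrite /pstep; case: eqP => //; lia.
  have -> : link_pole k i.+1 = 0 by apply: ml0; rewrite l1; lia.
  rewrite oppr0 mulr0 add0r ml1; last by rewrite l0 b0 ji.
  rewrite y0E.
  move: k d1 {mlE} ml0 ml1 ml_i sA sP sP1 sP0;
    rewrite b0 => k d1 ml0 ml1 ml_i sA sP sP1 sP0.
  have [eP _ sP' _] := P_sg k i 1.
  have := @sub_sgL _ k i.-1 (A * pprod j.+1 y * pprod' k (y - 1)) (y - 1 - p k).
  rewrite y0E; set x := (X in let x := X in _) => /= h.
  have -> : hratio j y = x by rewrite kE eP -/y /x; ring.
  rewrite h ?mulrN ?mulNr //; first by rewrite 2!rmorphM sA sP' sP0 //; lia.
  by rewrite d1; ring.
- have ji : j = (2 * r - i)%N by rewrite -lj link_gt.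
  have jr : (j == r) = false by rewrite ji; apply/negbTE/eqP; lia.
  have l1 : link i.+1 = j.-1 by rewrite link_gt; lia.
  have l0 : link i.-1 = j.+1 by rewrite /link_color; case: ifP; lia.
  have yiE : y = z + j%:R - r%:R - 1 by rewrite /y /link_pt lj ifF //;
    apply/negbTE; lia.
  have yE : (0 < j.-1)%N -> link_pt i.+1 = y - 1.
    move=> j1; rewrite yiE /link_pt ifF; last by apply/negbTE; lia.
    by rewrite l1 -[in RHS](prednK j0) -addn1 natrD; ring.
  have y0E : link_pt i.-1 = y + (pstep j.+1)%:R.
    rewrite yiE /link_pt /pstep l0; case: ifP => ir'.
      have -> : j.+1 == r by apply/eqP; lia.
      have -> : r = j.+1 by lia.
      by rewrite -addn1 natrD; ring.
    have -> : (j.+1 == r) = false by apply/eqP; lia.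
    by rewrite -addn1 natrD; ring.
  rewrite jr in kE; have [b0|b0] := eqVneq b j.-1.
    have -> : link_pole k i.-1 = 0 by apply: ml0; rewrite l0; lia.
    rewrite oppr0 mul0r addr0 ml1; last by rewrite l1 b0.
    move: k {mlE} ml0 ml1 ml_i sA sP sP1 sP0;
      rewrite b0 => k ml0 ml1 ml_i sA sP sP1 sP0.
    have [eP _ sP' _] := P_sg k i 1.
    have yE' := yE ltac:(lia).
    have := @sub_sgR _ k i.+1 (A * pprod j.+1 y * pprod' k (y - 1)) _ _ erefl.
    rewrite yE'; set x := (X in let x := X in _) => /= h.
    have -> : hratio j y = x by rewrite kE eP -/y /x; ring.
    by rewrite h ?mulrN ?mulNr // 2!rmorphM sA sP' sP0 //; lia.
  have -> : link_pole k i.+1 = 0 by apply: ml0; rewrite l1 eq_sym.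
  have [b1|b1] := eqVneq b j.+1; last first.
    have -> : link_pole k i.-1 = 0 by apply: ml0; rewrite l0 eq_sym.
    by rewrite oppr0 mul0r mulr0 addr0 kE 2!rmorphM sA sP1 ?sP0 ?subrr.
  rewrite oppr0 mulr0 add0r ml1; last by rewrite l0 b1.
  move: k {mlE} ml0 ml1 ml_i sA sP sP1 sP0;
    rewrite b1 => k ml0 ml1 ml_i sA sP sP1 sP0.
  have [_ eP _ sP'] := P_sg k i 0.
  have := @sub_sgL _ k i.-1 (A * pprod j.-1 (y - 1) * pprod' k y) (y - p k).
  rewrite y0E; set x := (X in let x := X in _) => /= h.
  have -> : hratio j y = x by rewrite kE eP -/y /x; ring.
  rewrite h ?mulrN ?mulNr //; first by rewrite 2!rmorphM sA sP' sP1 //; lia.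
  by ring.
- have ji : j = i by rewrite -lj link_le //; lia.
  have jr : j == r by rewrite ji; apply/eqP; lia.
  have l1 : link i.+1 = j.-1 by rewrite link_gt; lia.
  have l0 : link i.-1 = j.-1 by rewrite link_le; lia.
  have y0E : link_pt i.-1 = y by rewrite /y /link_pt !ifT //; lia.
  have yE : (0 < j.-1)%N -> link_pt i.+1 = y - 2.
    move=> j1; rewrite /y /link_pt ifF; last by apply/negbTE; lia.
    rewrite l1 ifT; last by lia.
    have -> : r = (j.-1).+1 by lia.
    by rewrite -addn1 natrD; ring.
  rewrite jr in kE; have [b0|b0] := eqVneq b j.-1; last first.
    have -> : link_pole k i.-1 = 0 by apply: ml0; rewrite l0 eq_sym.
    have -> : link_pole k i.+1 = 0 by apply: ml0; rewrite l1 eq_sym.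
    by rewrite oppr0 mul0r mulr0 addr0 kE 2!rmorphM sA sP1 ?(sP _ 2%N) ?subrr.
  have d1 : pstep b = 1%N by rewrite /pstep; case: eqP => //; lia.
  move: k d1 {mlE} ml0 ml1 ml_i sA sP sP1 sP0;
    rewrite b0 => k d1 ml0 ml1 ml_i sA sP sP1 sP0.
  rewrite !ml1 // y0E yE; last by lia.
  have [eP1 _ sP1' _] := P_sg k i 1; have [eP2 _ sP2' _] := P_sg k i 2.
  have uU : y - p k \is a unit by apply: ylU0.
  have uU2 : y - 2 - p k \is a unit by apply: ylUn.
  rewrite kE [pprod _ (y - 1)]eP1 eP2 -/y !rmorphM sA sP1' sP2' !rmorphB sg_yl
    sgtp d1 rmorph_nat rmorph1 -/y.
  set A1 := pprod' k (y - 1%:R); set A2 := pprod' k (y - 2).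
  (* At the middle link both neighbours have colour [r - 1]. The shift turns
     [(y - 1 - p)(y - 2 - p)] into [(y - p)(y - 1 - p)], and the difference [- 2 (y - 1 - p)] is
     shared equally by the poles [y - 2 = p] and [y = p]. *)
  transitivity (- 2 * (A * A1 * A2 * (y - 1 - p k))); first by ring.
  transitivity (- (A * A1 * A2 * (y - 1 - p k)) *
    ((y - 2 - p k) / (y - 2 - p k))
    - (A * A1 * A2 * (y - 1 - p k)) * ((y - p k) / (y - p k))); last by ring.
  by rewrite !divrr //; ring.
Qed.


Lemma sgP'_ne s b (k : 'I_(a b)) j (l : 'I_(a j)) y : b != j ->
  sg s k (pprod' l y) = pprod' l (sg s k y).
Proof.
move=> bj; rewrite rmorph_prod; apply: eq_bigr => m _.
by rewrite rmorphB sgp (negPf bj) subr0.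
Qed.

Lemma sgp_other s b (k : 'I_(a b)) j (l : 'I_(a j)) : b != j -> sg s k (p l) =
  p l.
Proof. by move=> bj; rewrite sgp (negPf bj) subr0. Qed.

Lemma P'U0 b (k : 'I_(a b)) : pprod' k (p k) \is a unit.
Proof. by have := P'U k 0; rewrite addr0. Qed.

Lemma P'Un b (k : 'I_(a b)) (n : nat) : pprod' k (p k - n%:R) \is a unit.
Proof. by have := P'U k (- n%:Z); rewrite rmorphN. Qed.

Lemma sgG_ne b (k : 'I_(a b)) j (l : 'I_(a j)) : b != j ->
  sg true k (e_coef l) = sg true k (e_numer j (p l)) / pprod' l (p l).
Proof. by move=> bj; rewrite rmorph_div ?P'U0 // sgP'_ne // sgp_other. Qed.

Lemma sgU_ne b (k : 'I_(a b)) j (l : 'I_(a j)) : b != j ->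
  sg true k (f_coef l) =
    - sg true k (f_numer j (p l)) / pprod' l (p l - (pstep j)%:R).
Proof.
move=> bj; rewrite rmorph_div ?P'Un // rmorphN sgP'_ne // rmorphB sgp_other //.
by rewrite rmorph_nat.
Qed.

Lemma sgGn_ne b (k : 'I_(a b)) j (l : 'I_(a j)) : b != j -> b != j.-1 ->
  sg true k (e_numer j (p l)) = e_numer j (p l).
Proof.
move=> bj bj'; rewrite rmorphM sgP_ne // rmorphB sgp_other // rmorph1;
  congr (_ * _).
by case: ifP => _; rewrite ?rmorph1 // sgP_ne // rmorphB sgp_other //
  rmorph_nat.
Qed.

Lemma sgUn_ne b (k : 'I_(a b)) j (l : 'I_(a j)) : b != j ->
  (j != r -> b != j.+1) ->
  sg true k (f_numer j (p l)) = f_numer j (p l).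
Proof.
move=> bj bj'; rewrite rmorphM sgZp sgp_other //; congr (_ * _).
by case: eqP => [_|/eqP jr]; rewrite ?rmorph1 // sgP_ne ?bj' // sgp_other.
Qed.

Lemma sgG_far b (k : 'I_(a b)) j (l : 'I_(a j)) : (b.+1 < j)%N || (j.+1 < b)%N
  ->
  sg true k (e_coef l) = e_coef l.
Proof. by move=> h; rewrite sgG_ne ?sgGn_ne //; lia. Qed.

Lemma sgU_far b (k : 'I_(a b)) j (l : 'I_(a j)) : (b.+1 < j)%N || (j.+1 < b)%N
  ->
  sg true k (f_coef l) = f_coef l.
Proof. by move=> h; rewrite sgU_ne ?sgUn_ne //; lia. Qed.

Lemma sgGU_exchange b (l : 'I_(a b)) j (m : 'I_(a j)) :
  (0 < b <= r)%N -> (0 < j <= r)%N -> ~~ ((b == j) && (l == m :> nat)) ->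
  sg true m (e_coef l) * sg true l (f_coef m) = f_coef m * e_coef l.
Proof.
move=> hb hj; have [bj|bj] := eqVneq b j => /= lm.
  move: l lm; rewrite bj => l lm;
    have {}lm : l != m by rewrite -(inj_eq val_inj).
  have fixP i y (k n : 'I_(a j)) : i != j -> sg true k y = y ->
    sg true k (pprod i y) = pprod i y.
    by move=> ij hy; rewrite sgP_ne 1?eq_sym // hy.
  pose Q (k n : 'I_(a j)) y := \prod_(i < a j | (i != k) && (i != n)) (y - p i).
  have P'E (k n : 'I_(a j)) y : n != k -> pprod' k y = (y - p n) * Q k n y.
    by move=> nk; rewrite /pprod' (bigD1 n).
  have sQ (k n i : 'I_(a j)) y : (i == k) || (i == n) -> sg true i (Q k n y) =
    Q k n (sg true i y).
    move=> ikn; rewrite rmorph_prod; apply: eq_bigr => u /andP[uk un].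
    by rewrite rmorphB sgp_ne //; case/orP: ikn => /eqP->; rewrite eq_sym.
  have link_pole : m != l by rewrite eq_sym.
  have jj : j != j.-1 by lia.
  have jj' : j != j.+1 by lia.
  have sGn : sg true m (e_numer j (p l)) = e_numer j (p l).
    rewrite rmorphM sgP_ne // rmorphB sgp_ne // rmorph1; congr (_ * _).
    by case: ifP => _; rewrite ?rmorph1 // sgP_ne // rmorphB sgp_ne //
      rmorph_nat.
  have sUn : sg true l (f_numer j (p m)) = f_numer j (p m).
    rewrite rmorphM sgZp sgp_ne //; congr (_ * _).
    by case: ifP => _; rewrite ?rmorph1 // sgP_ne // sgp_ne.
  rewrite rmorph_div ?P'U0 // [sg true l _]rmorph_div ?P'Un // rmorphN sGn sUn.
  set N1 := e_numer _ _; set N2 := f_numer _ _;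
    rewrite [RHS]mulrC mulrACA [RHS]mulrACA -!invrM ?rmorph_unit ?P'U0 ?P'Un //.
  congr (_ / _); rewrite mulrC [RHS]mulrC (P'E l m) // (P'E m l) //.
  rewrite !rmorphM !sQ ?eqxx ?orbT // !rmorphB !(sgp_ne _ link_pole)
    !(sgp_ne _ lm) !sgtp rmorph_nat; ring.
have jb : j != b by rewrite eq_sym.
rewrite sgG_ne // sgU_ne //.
have [bj1|bj1] := eqVneq b j.+1; last first.
  rewrite sgUn_ne // sgGn_ne //; first by rewrite mulrC.
  by apply: contraNneq bj1 => ->; rewrite prednK //; case/andP: hb.
move: l lm hb bj jb; rewrite bj1 => l lm hb bj jb {bj1}.
rewrite [RHS]mulrC mulrACA [RHS]mulrACA; congr (_ * _); rewrite !mulrN;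
  congr (- _).
have jr : (j == r) = false by apply/negbTE; lia.
have d1 : pstep j = 1%N by rewrite /pstep jr.
have sgpB n : sg true m (p l - n%:R) = p l
  - n%:R by rewrite rmorphB sgp_other // rmorph_nat.
have sm : sg true l (p m) = p m by rewrite sgp_other.
have sP n : sg true m (pprod j (p l - n%:R)) = (p l - n%:R - p m + 1) *
  pprod' m (p l - n%:R).
  by rewrite (PE m) rmorphM sgP' rmorphB sgpB sgtp d1; congr (_ * _); ring.
have sP1 := sP 1%N; have sP2 := sP 2%N.
rewrite /e_numer /f_numer jr /= [sg true l _]rmorphM sgZp sm
  [sg true m _]rmorphM sP1.
rewrite (PE l) (PE m (p l - 1)) !rmorphM sgP' rmorphB sm sgtp /pstep.
case: ifP => _; rewrite ?rmorph1 ?sP2 ?(PE m (p l - 2)); ring.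
Qed.


(** [h_i / Z_0] for [0 < i <= 2r], and 0 for the other indices. *)
Fixpoint hdiag (i : nat) : C :=
  match i with
  | 0 => 0
  | m.+1 => if m == 0%N then pprod 1 z else if link m == 0%N then 0 else hdiag m
    * hratio (link m) (link_pt m)
  end.

Lemma sg_ml b (k : 'I_(a b)) j (l : 'I_(a j)) i : ~~
  ((b == j) && (k == l :> nat)) ->
  sg true k (link_pole l i) = link_pole l i.
Proof.
move=> bj; rewrite /link_pole; case: eqP => _; last by rewrite rmorph0.
rewrite rmorph_div ?ylU0 // rmorph_nat rmorphB sg_yl sgp.
by rewrite (negPf bj) mulr0n subr0.
Qed.

(** With [m_i] for [link_pole k i], [kl_sg] says that [(1 + m_i - m_(i-1)) sg(ratio) = ratio (1 +
    m_(i+1) - m_i)]. So the multiplier [1 + m_i - m_(i-1)], by which the shift changes [h_i], is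
    carried from each entry to the next. *)
Lemma hC_sg b (k : 'I_(a b)) i : (0 < b <= r)%N ->
  hdiag i - sg true k (hdiag i) = - hdiag i *
    (link_pole k i - link_pole k i.-1).
Proof.
move=> hb; elim: i => [|[_|i IH]].
- by rewrite /= rmorph0 oppr0 mul0r addr0.
- have -> : link_pole k 0 = 0 by rewrite /link_pole /link_color leq0n eq_sym;
    case: eqP => // b0; rewrite b0 in hb.
  have l1 : link 1 = 1%N by rewrite link_le.
  have y1 : link_pt 1 = z by rewrite /link_pt r0.
  rewrite /= subr0; have [b1|b1] := eqVneq b 1%N; last first.
    by rewrite sgP_ne // sg_z subrr /link_pole l1 eq_sym (negPf b1) mulr0.
  move: k; rewrite b1 => k.
  have := @sub_sgR _ k 1 (pprod' k z) (z - p k).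
  rewrite sgP' sg_z y1 mulrC -(PE k) /= => -> //.
  by rewrite /link_pole l1 y1.
- rewrite /= in IH *; set h := (if _ == _ then _ else _) in IH *.
  case: eqP => [_|/eqP l0]; first by rewrite rmorph0 oppr0 mul0r addr0.
  have l0' : (0 < link i.+1)%N by rewrite lt0n.
  have := kl_sg k i.+1 l0' hb; rewrite /link_ratio eqxx mulr1n /=.
  set kk := hratio _ _; set m := link_pole k _; set m1 := link_pole k _;
    set m0 := link_pole k _ => e.
  rewrite rmorphM; rewrite -/m -/m0 in IH.
  have -> : sg true k h = h * (1 + m - m0).
    by rewrite -[LHS](subKr h) IH; ring.
  have e2 : (1 + m - m0) * sg true k kk = kk * (1 - m + m1).
    by apply/eqP; rewrite -subr_eq0; apply/eqP;
      transitivity (- (kk - sg true k kk) +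
      (kk * (m - m1) + (m - m0) * sg true k kk)); [ring|rewrite e; ring].
  by rewrite -mulrA e2; ring.
Qed.

Definition link_coef (i : nat) : K :=
  if link i == 0%N then 0 else if (i < r)%N then 1
  else if i == r then 2 else - 1.
(** The scalar with [- col_coef i * link_coef i = 1] at the links inside the matrix, so that each
    new column has diagonal entry 1. *)
Definition col_coef (i : nat) : K :=
  if (i < r)%N then - 1 else if i == r then - 2^-1 else 1.

Lemma link_coef2 i : link i != 0%N -> link_coef i * link_coef i =
  (pstep (link i))%:R ^+ 2.
Proof.
rewrite /link_coef /pstep => /negPf ->.
case: ltngtP => ir; first by rewrite link_le ?ltn_eqF // ?mulr1 ?expr1n // ltnW.
  have -> : (link i == r) = false by rewrite link_gt //; apply/eqP; lia.
  by rewrite mulrNN mulr1 expr1n.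
by rewrite ir link_le // eqxx expr2.
Qed.

Lemma wt_coefE j b i : (0 < j <= r)%N -> (0 < b <= r)%N -> link i = b ->
  ((wt_scale j *+ (link i.+1 == j) - wt_scale j *+ (link i == j))
   - (wt_scale j *+ (link i == j) - wt_scale j *+ (link i.-1 == j))) =
     - wt_coef j b.
Proof.
move=> hj hb lb; rewrite /wt_coef lb -(addrA (_ *+ 2)) -opprD.
have -> : ((link b.+1 == j)%:R + (link b.-1 == j)%:R : K) =
   ((link i.+1 == j)%:R + (link i.-1 == j)%:R : K).
  rewrite -!natrD; congr (_%:R); move: lb; rewrite /link_color; do !case: ifP;
    do !case: eqP; lia.
by rewrite -!(mulr_natr (wt_scale j)) -(mulr_natr (_%:R)); ring.
Qed.

(* For the columns of [E], [(q, X)] and [(q', Y)] describe the [e]'s and the [f]'s;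
   for the rows of [F] they are exchanged and [L] is the opposite ring. *)
Section Lax.
Variables (L : nzRingType) (iota : {rmorphism C -> L}).
Variables (q q' : forall b, 'I_(a b) -> L) (X Y : forall b, 'I_(a b) -> C).
Hypothesis qC : forall b (k : 'I_(a b)) x, q k * iota x = iota (sg true k x) *
  q k.
Hypothesis q'C : forall b (k : 'I_(a b)) x, iota x * q' k = q' k *
  iota (sg true k x).
Hypothesis q'C' : forall b (k : 'I_(a b)) x, q' k * iota x =
  iota (sg false k x) * q' k.
Hypothesis qq' : forall b (k : 'I_(a b)), q k * q' k = 1.
Hypothesis q'q : forall b (k : 'I_(a b)), q' k * q k = 1.
Hypothesis qqC : forall b (k : 'I_(a b)) j (l : 'I_(a j)), q k * q l = q l *
  q k.
Hypothesis etaC : forall x v, iota (eta x) * v = v * iota (eta x).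
Hypothesis XY : forall b (k : 'I_(a b)), X k * Y k = e_coef k * f_coef k.
Hypothesis XY_exchange : forall b (l : 'I_(a b)) j (m : 'I_(a j)),
  (0 < b <= r)%N -> (0 < j <= r)%N -> ~~ ((b == j) && (l == m :> nat)) ->
  sg true m (X l) * sg true l (Y m) = Y m * X l.
Hypothesis X_far : forall b (k : 'I_(a b)) j (l : 'I_(a j)),
  (b.+1 < j)%N || (j.+1 < b)%N -> sg true k (X l) = X l.

Definition osum b (phi : 'I_(a b) -> C) : L :=
  \sum_(k < a b) iota (phi k * X k) * q k.

Definition Le b : L := osum (fun _ : 'I_(a b) => 1).
Definition Lf b : L := \sum_(k < a b) q' k * iota (Y k).
Definition Lmu i : L :=
  osum (fun k : 'I_(a (link i)) => (pstep (link i))%:R / (link_pt i - p k)).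

Lemma lterm_Lmu b i : lterm r Lmu b i =
  osum (fun k : 'I_(a b) => link_pole k i).
Proof.
rewrite /lterm /link_pole; case: eqP => [<-|_]; first by [].
by rewrite /osum big1 // => k _; rewrite mulr0n mul0r rmorph0 mul0r.
Qed.

Lemma mul_osum x b (phi : 'I_(a b) -> C) :
  iota x * osum phi = osum (fun k => x * phi k).
Proof.
by rewrite mulr_sumr; apply: eq_bigr => k _; rewrite mulrA -rmorphM mulrA.
Qed.

Lemma osum_mul x b (phi : 'I_(a b) -> C) :
  osum phi * iota x = osum (fun k => sg true k x * phi k).
Proof.
rewrite mulr_suml; apply: eq_bigr => k _.
by rewrite -mulrA qC mulrA -rmorphM mulrC mulrA.
Qed.

Lemma osumB b (phi psi : 'I_(a b) -> C) :
  osum phi - osum psi = osum (fun k => phi k - psi k).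
Proof. by rewrite -sumrB; apply: eq_bigr => k _; rewrite mulrBl rmorphB mulrBl.
  Qed.

Lemma osumD b (phi psi : 'I_(a b) -> C) :
  osum phi + osum psi = osum (fun k => phi k + psi k).
Proof. by rewrite -big_split; apply: eq_bigr => k _;
  rewrite mulrDl rmorphD mulrDl. Qed.

Lemma eq_osum b (phi psi : 'I_(a b) -> C) : phi =1 psi -> osum phi = osum psi.
Proof. by move=> e; apply: eq_bigr => k _; rewrite e. Qed.

Lemma qq'C b (k : 'I_(a b)) j (l : 'I_(a j)) : q k * q' l = q' l * q k.
Proof.
rewrite -[LHS]mul1r -(q'q l) -!mulrA; congr (_ * _).
by rewrite !mulrA qqC -mulrA qq' mulr1.
Qed.

(** Pairs of different oscillators cancel by [XY_exchange]. For equal ones [q q' = 1] leaves a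
    function in one order and its inverse shift in the other. *)
Lemma osum_Lf b (phi : 'I_(a b) -> C) j : (0 < b <= r)%N -> (0 < j <= r)%N ->
  (forall (k : 'I_(a j)) (l : 'I_(a b)), ~~ ((j == b) && (k == l :> nat)) ->
    sg true k (phi l) = phi l) ->
  osum phi * Lf j - Lf j * osum phi =
  iota (\sum_(k < a b) (phi k * (e_coef k * f_coef k)
    - sg false k (phi k * (e_coef k * f_coef k)))) *+ (b == j).
Proof.
move=> hb hj hphi; rewrite /osum /Lf big_distrlr /=.
rewrite [X in _ - X]big_distrlr /= [X in _ - X]exchange_big /= -sumrB.
have off (l : 'I_(a b)) (m : 'I_(a j)) : ~~ ((b == j) && (l == m :> nat)) ->
  iota (phi l * X l) * q l * (q' m * iota (Y m)) = q' m * iota (Y m) *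
    (iota (phi l * X l) * q l).
  move=> lm; rewrite -(mulrA _ (q l)) (mulrA (q l)) qq'C -(mulrA (q' m)) qC
    !mulrA q'C.
  rewrite -!(mulrA (q' m)) -!rmorphM; congr (_ * (iota _ * _)).
  rewrite rmorphM hphi; last by rewrite eq_sym [X in _ && X]eq_sym.
  by rewrite -mulrA XY_exchange // mulrCA mulrA [Y m * _]mulrC -mulrA.
have [bj|bj] := eqVneq b j; last first.
  rewrite mulr0n big1 // => l _; rewrite -sumrB big1 // => m _.
  by rewrite off ?subrr // (negPf bj).
case: j / bj hj hphi off => hj hphi off.
rewrite mulr1n rmorph_sum; apply: eq_bigr => l _;
  rewrite -sumrB (bigD1 l) //= big1 ?addr0.
  rewrite rmorphB -(mulrA _ (q l)) (mulrA (q l)) qq' mul1r -rmorphM -mulrA XY;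
    congr (_ - _).
  rewrite -!(mulrA (q' l)) (mulrA (iota _)) -rmorphM mulrA q'C' -mulrA q'q
    mulr1.
  by rewrite mulrCA [Y l * _]mulrC XY.
move=> m link_pole; rewrite off ?subrr //.
by rewrite eqxx /= (inj_eq val_inj) eq_sym.
Qed.

Definition Lc (x : K) : L := iota (eta x).
Definition Lkx i : L := iota (eta (link_coef i) * hratio (link i) (link_pt i)).

Lemma lterm_Lkx j i : lterm r Lkx j i =
  iota (eta (link_coef i) * link_ratio j i).
Proof. by rewrite /lterm /link_ratio; case: eqP;
  rewrite ?mulr1n // mulr0n mulr0 rmorph0. Qed.

Lemma Lfe j b : (0 < j <= r)%N -> (0 < b <= r)%N ->
  Lf j * Le b - Le b * Lf j = - iota (kappa j) *+ (j == b).
Proof.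
move=> hj hb; rewrite -opprB osum_Lf //; last by move=> *; rewrite rmorph1.
rewrite mulNrn eq_sym; case: eqP => [->|//]; rewrite !mulr1n -kappa_sum //;
  congr (- iota _).
by apply: eq_bigr => k _; rewrite !mul1r.
Qed.

Lemma Lkxe j b i : (0 < j <= r)%N -> (0 < b <= r)%N ->
  lterm r Lkx j i * Le b - Le b * lterm r Lkx j i =
  lterm r Lkx j i * (lterm r Lmu b i - lterm r Lmu b i.+1)
  + (lterm r Lmu b i - lterm r Lmu b i.-1) * lterm r Lkx j i.
Proof.
move=> hj hb; rewrite lterm_Lkx !lterm_Lmu !osumB !mul_osum !osum_mul osumB
  osumD.
apply: eq_osum => k; rewrite rmorphM sg_eta !mulr1 -mulrBr kl_sg //;
  last by case/andP: hj.
by ring.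
Qed.

(** For [b = j] and a link of this colour this is [kf_partial_fractions] at its point: the square of
    [link_coef i] is [c_j ^ 2], and the value at infinity gives the constant [wt_scale j]. *)
Lemma Lmuf j b i : (0 < j <= r)%N -> (0 < b <= r)%N ->
  lterm r Lmu b i * Lf j - Lf j * lterm r Lmu b i =
  lterm r Lkx j i * lterm r (fun i => Lc (link_coef i)) b i
    - (Lc (wt_scale j) *+ (link i == j)) *+ (j == b).
Proof.
move=> hj hb; rewrite lterm_Lmu osum_Lf //; last by move=> k l; apply: sg_ml.
rewrite lterm_Lkx eq_sym; have [jb|jb] := eqVneq j b; last first.
  rewrite !mulr0n subr0 /link_ratio /lterm; case: eqP => [->|_];
    last by rewrite mulr0 rmorph0 mul0r.
  by rewrite (negPf jb) mulr0.
rewrite -{b hb}jb !mulr1n.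
have [lj|lj] := eqVneq (link i) j; last first.
  rewrite /link_ratio (negPf lj) !mulr0n mulr0 rmorph0 mul0r subr0 big1 ?rmorph0
    // => k _.
  by rewrite /link_pole (negPf lj) mulr0n mul0r rmorph0 subrr.
have yU (k : 'I_(a j)) : link_pt i - (p k + (pstep j)%:R) \is a unit.
  by rewrite opprD addrA addrAC ylUn.
have -> : \sum_(k < a j)
  (link_pole k i * (e_coef k * f_coef k)
  - sg false k (link_pole k i * (e_coef k * f_coef k)))
    = (pstep j)%:R * ((pstep j)%:R *
      (hratio j (link_pt i) - eta (hratio_lead j))).
  rewrite -kf_partial_fractions //; last by move=> k; apply: ylU0.
  rewrite mulr_sumr; apply: eq_bigr => k _.
  rewrite rmorphM /link_pole lj eqxx mulr1n rmorph_div ?ylU0 // rmorph_nat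
    rmorphB sg_yl sgpp.
  by rewrite mulN1r opprK; ring.
have x2 : link_coef i * link_coef i =
  (pstep j)%:R ^+ 2 by rewrite -lj link_coef2 // lj; case/andP: hj; lia.
rewrite /link_ratio /lterm /Lc lj eqxx !mulr1n -!rmorphM -rmorphB;
  congr (iota _).
rewrite mulrAC -rmorphM x2 /wt_scale !rmorphM ?rmorphXn !rmorph_nat; ring.
Qed.

Lemma Lkape j b : (0 < j <= r)%N -> (0 < b <= r)%N ->
  iota (kappa j) * Le b - Le b * iota (kappa j) = Lc (wt_coef j b) * Le b.
Proof.
move=> hj hb; rewrite /Le osum_mul !mul_osum osumB.
by apply: eq_osum => k; rewrite -mulrBl kappa_sg.
Qed.

Lemma Lkapmu j b i : (0 < j <= r)%N -> (0 < b <= r)%N ->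
  iota (kappa j) * lterm r Lmu b i - lterm r Lmu b i * iota (kappa j) =
  Lc (wt_coef j b) * lterm r Lmu b i.
Proof.
move=> hj hb; rewrite !lterm_Lmu osum_mul !mul_osum osumB.
by apply: eq_osum => k; rewrite -mulrBl kappa_sg.
Qed.

Lemma Ltx j b i : (0 < j <= r)%N -> (0 < b <= r)%N ->
  lterm r (fun i => Lc (link_coef i)) b i *
    ((Lc (wt_scale j) *+ (link i.+1 == j) - Lc (wt_scale j) *+ (link i == j))
     - (Lc (wt_scale j) *+ (link i == j) - Lc (wt_scale j) *+ (link i.-1 == j))) =
  - Lc (wt_coef j b) * lterm r (fun i => Lc (link_coef i)) b i.
Proof.
move=> hj hb; rewrite /lterm; case: eqP => [lb|_];
  last by rewrite !mulr0n mul0r mulr0.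
rewrite !mulr1n /Lc -!rmorphMn -!rmorphB -rmorphM -(rmorphM eta).
by rewrite (@wt_coefE j b) // mulrN !rmorphN mulNr -!rmorphM mulrC.
Qed.

Lemma osum_far b b' (phi : 'I_(a b) -> C) : (b.+1 < b')%N ->
  (forall (k : 'I_(a b')) l, sg true k (phi l) = phi l) ->
  osum phi * Le b' = Le b' * osum phi.
Proof.
move=> bb' hphi; rewrite /Le /osum !big_distrlr /= exchange_big /=.
apply: eq_bigr => l _; apply: eq_bigr => k _; rewrite mul1r.
rewrite -!mulrA [q _ * (_ * _)]mulrA qC [q l * (iota _ * _)]mulrA qC !mulrA
  -!rmorphM -!mulrA qqC.
by rewrite [sg true l _]rmorphM hphi !X_far ?bb' ?orbT //; congr (iota _ * _);
  rewrite mulrA mulrC.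
Qed.

Lemma Lfar b b' : (0 < b)%N -> (b.+1 < b' <= r)%N -> Le b * Le b' = Le b' *
  Le b.
Proof. by move=> _ /andP[bb' _]; apply: osum_far => // k l; rewrite rmorph1.
  Qed.

Lemma Lfarmu b b' i : (0 < b)%N -> (b.+1 < b' <= r)%N ->
  lterm r Lmu b i * Le b' = Le b' * lterm r Lmu b i.
Proof.
move=> _ /andP[bb' _]; rewrite lterm_Lmu; apply: osum_far => // k l.
by apply: sg_ml; rewrite gtn_eqF //; lia.
Qed.

Variable v : nat -> nat -> L.
Hypothesis v1 : forall i, v 1 i = (i == 1%N)%:R.
Hypothesis vS : forall m i, (0 < m < 2 * r)%N ->
  v m.+1 i = Lc (col_coef m) *
    raise r Le Lmu (fun i => Lc (link_coef i)) (link m) (v m) i.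

Definition Lscal (u : L) : Prop := exists x, u = Lc x.

Definition lax_side : side L r.
Proof.
refine (@Side L r Le Lf (fun j => iota (kappa j)) Lmu Lkx
  (fun i => Lc (link_coef i))
  (fun j => Lc (wt_scale j)) (fun i => Lc (col_coef i))
    (fun j b => Lc (wt_coef j b)) Lscal v
  _ _ _ _ _ _ _ _ _ Lfe Lkxe Lmuf Lkape Lkapmu Ltx Lfar Lfarmu v1 vS).
- by move=> u w [x ->]; apply: etaC.
- by exists 0; rewrite /Lc !rmorph0.
- by move=> u [x ->]; exists (- x); rewrite /Lc !rmorphN.
- by move=> u w [x ->] [y ->]; exists (x + y); rewrite /Lc !rmorphD.
- by move=> u w [x ->] [y ->]; exists (x * y); rewrite /Lc !rmorphM.
- by move=> i; exists (link_coef i).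
- by move=> i; exists (wt_scale i).
- by move=> i; exists (col_coef i).
- by move=> i j; exists (wt_coef i j).
Defined.

Lemma hC_Le j i : (0 < j <= r)%N ->
  iota (hdiag i) * Le j - Le j * iota (hdiag i) =
  - iota (hdiag i) * (lterm r Lmu j i - lterm r Lmu j i.-1).
Proof.
move=> hj; rewrite !lterm_Lmu osumB osum_mul -rmorphN !mul_osum osumB.
by apply: eq_osum => k; rewrite -mulrBl hC_sg // mulr1.
Qed.

End Lax.

Lemma hC_next i : hdiag i * (eta (link_coef i) * hratio (link i) (link_pt i)) =
  eta (link_coef i) * hdiag i.+1.
Proof.
case: i => [|i]; first by rewrite /link_coef link_le // eqxx rmorph0 !mul0r.
rewrite [hdiag i.+2]/=; case: eqP => [l0|_]; last by rewrite mulrCA.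
by rewrite /link_coef l0 eqxx rmorph0 mul0r !mulr0.
Qed.

End Oscillator.

(** * Columns of the unitriangular factors *)

Section Columns.
Variables (L : nzRingType) (r : nat) (e mu x s B : nat -> L) (h : L).
Variable col : nat -> nat -> L.
Local Notation link := (link_color r).
Hypothesis r0 : (0 < r)%N.
Hypothesis muE : forall i, mu i = (pstep r (link i))%:R * B i.
Hypothesis xE : forall i, (0 < i < 2 * r)%N ->
  x i = if (i < r)%N then 1 else if i == r then 2 else - 1.
Hypothesis sE : forall i, s i =
  if (i < r)%N then - 1 else if i == r then h else 1.
Hypothesis hE : h * 2 = - 1.

(** A column of a unitriangular matrix with rows counted from 1, padded by zeros. *)
Definition colv (m i : nat) : L :=
  if i == 0%N then 0 else if i == m then 1 else if (i < m)%N then col m i else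
    0.

Let comm (u w : L) : L := u * w - w * u.

Hypothesis colS : forall m i, (0 < m < 2 * r)%N -> (0 < i <= m)%N ->
  col m.+1 i =
  if (m < r)%N then (if i == m then B m else - comm (col m i) (e m))
  else if m == r then (if i == r then B r else h * comm (col m i) (e r))
  else let j := link m in
    if (i <= r)%N then
      if i == j then comm (col m i) (e j) - B j * col m i
      else if i == j.+1 then comm (col m i) (e j) + B j * col m i - col m j
      else comm (col m i) (e j)
    else if i == m then - B m else comm (col m i) (e j).

Lemma colv1 i : colv 1 i = (i == 1%N)%:R.
Proof. by rewrite /colv; case: i => [|[|i]]. Qed.

Lemma colvSS m i : colv m.+1 i.+1 =
  if i == m then 1 else if (i < m)%N then col m.+1 i.+1 else 0.
Proof. by rewrite /colv eqSS ltnS. Qed.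

(** In row [m.+1] only the [x] term survives and gives the diagonal 1; in row [m] only [mu] survives
    and gives the basic entry. For [m > r] the corrections in rows [link m] and [(link m).+1] come
    from the other link of the same colour. *)
Lemma colv_raise m i : (0 < m < 2 * r)%N ->
  colv m.+1 i = s m * raise r e mu x (link m) (colv m) i.
Proof.
move=> hm; have hl := linkE hm.
have ltE (f : nat -> L) n b : link n != b -> lterm r f b n = 0.
  by rewrite /lterm => /negPf->.
have ltE1 (f : nat -> L) n b : link n = b -> lterm r f b n = f n.
  by rewrite /lterm => ->; rewrite eqxx.
have cv0 n k : (n < k)%N -> colv n k = 0.
  by move=> nk; rewrite /colv; case: eqP => // _; case: eqP;
    [lia|move=> _; case: ltnP => //; lia].
have cvm n : (0 < n)%N -> colv n n = 1.
  by move=> n0; rewrite /colv eqxx; case: eqP => // ?; lia.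
have cvc n k : (0 < k < n)%N -> colv n k = col n k.
  move=> kn; rewrite /colv; case: eqP; first lia.
  by move=> _; case: eqP; [lia|move=> _; rewrite ifT //; case/andP: kn].
have [mi|] := ltnP m.+1 i.
  rewrite /raise !cv0 ?mulr0 ?mul0r ?subr0 ?mulr0 //; lia.
rewrite leq_eqVlt => /predU1P[->|im].
  rewrite /raise /= cvm // cv0 // mul0r mulr0 subrr mulr0 subr0 sub0r cvm;
    last by lia.
  rewrite mulr1 ltE1 // sE xE //; case: ifP => _; first by rewrite mulrNN mulr1.
  by case: ifP => _; rewrite ?mul1r ?opprK // mulrN hE opprK.
have [->|i0] := posnP i.
  have l0 : link 0 != link m by rewrite {1}/link_color leq0n eq_sym -lt0n;
    case/andP: hl.
  by rewrite /raise !(ltE _ 0%N) // !{1}/colv /= !mul0r !mulr0 !subrr mulr0.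
have im' : (i <= m)%N by lia.
rewrite cvc ?colS /raise; [|lia..]; rewrite sE; case: ltngtP => mr.
- have lm : link m = m by rewrite link_le //; lia.
  rewrite lm (ltE _ i.-1); last by rewrite link_le; lia.
  rewrite (ltE _ i.-1); last by rewrite link_le; lia.
  rewrite mul0r subr0 subr0; have [->|ne] := eqVneq i m.
    rewrite cvm; last by lia.
    rewrite mulr1 mul1r subrr sub0r mulN1r opprK ltE1 // muE lm /pstep ltn_eqF
      // mul1r.
    by rewrite mulr1.
  rewrite ltE; last by rewrite link_le; lia.
  by rewrite mul0r subr0 cvc ?mulN1r //; lia.
- have lm : link m = (2 * r - m)%N by rewrite link_gt.
  have mub i1 : link i1 = link m -> mu i1 = B i1.
    move=> l1; rewrite muE l1 lm /pstep ifF ?mul1r //; apply/negbTE/eqP; lia.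
  rewrite mul1r; case: leqP => ir.
    rewrite (@cvc m i); last by lia.
    have [ib|ib] := eqVneq i (link m).
      rewrite (ltE _ i.-1); last by rewrite link_le; lia.
      rewrite (ltE _ i.-1); last by rewrite link_le; lia.
      by rewrite ltE1 ?mub ?subr0 ?mul0r ?subr0 -?ib // link_le.
    rewrite (ltE _ i); last by rewrite link_le.
    have [ib1|ib1] := eqVneq i (link m).+1.
      have e1 : i.-1 = link m by rewrite ib1.
      have ll : link (link m) = link m by rewrite [LHS]link_le //; lia.
      rewrite e1 !ltE1 // mub // sub0r mulNr opprK xE ?ifT ?mul1r ?cvc //; lia.
    rewrite !(ltE _ i.-1) ?subr0 ?mul0r ?subr0 //; rewrite link_le; lia.
  have l1 : link i.-1 != link m by rewrite lm /link_color; case: ifP; lia.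
  rewrite !(ltE _ i.-1) // mul0r !subr0.
  have [->|ne] := eqVneq i m.
    rewrite cvm; last by lia.
    by rewrite mulr1 mul1r subrr sub0r ltE1 // mub // mulr1.
  rewrite ltE ?mul0r ?subr0 ?cvc //; first by lia.
  rewrite lm link_gt //; lia.
- have lm : link r = r by rewrite link_le.
  rewrite mr lm !(ltE _ i.-1); try by rewrite link_le; lia.
  rewrite mul0r !subr0; have [->|ne] := eqVneq i r.
    rewrite cvm // mulr1 mul1r subrr sub0r ltE1 // muE lm /pstep eqxx mulr1.
    by rewrite mulrN mulrA hE mulN1r opprK.
  rewrite ltE ?mul0r ?subr0 ?cvc //; last by rewrite link_le; lia.
  by rewrite -mr; lia.
Qed.
End Columns.

(** * Laurent series and the oscillator algebra *)

Section LaurentTheory.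
Variable A : nzRingType.
Implicit Types (f : laurent A) (x : A).

Lemma lzC f : lz * f = f * lz.
Proof.
apply: laurentP => n;
  rewrite -[lz * f]/(lmul (lmon 1 1) f) -[f * lz]/(lmul f (lmon 1 1)).
by rewrite lmonM mullmon mul1r mulr1.
Qed.

Lemma coef_lcstM x f n : (lcst x * f) n = x * f n.
Proof. by rewrite -[lcst x * f]/(lmul (lmon x 0) f) lmonM subr0. Qed.

Lemma coef_Mlcst x f n : (f * lcst x) n = f n * x.
Proof. by rewrite -[f * lcst x]/(lmul f (lmon x 0)) mullmon subr0. Qed.

Fact lgeo_subproof x : lbounded
  (fun n : int => if n is Negz m then x ^+ m else 0).
Proof. by exists 0 => -[]. Qed.
(** The expansion of [(z - x)^-1]; [Negz m] is the exponent [- m - 1]. *)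
Definition lgeo x : laurent A := Laurent (lgeo_subproof x).

Lemma lgeoK x : lgeo x * (lz - lcst x) = 1 /\ (lz - lcst x) * lgeo x = 1.
Proof.
have e1 : (lz - lcst x) * lgeo x = 1.
  apply: laurentP => n;
    rewrite mulrBl -[LHS]/((lz * lgeo x) n - (lcst x * lgeo x) n).
  rewrite coef_lcstM -[lz * _]/(lmul (lmon 1 1) _) lmonM mul1r.
  rewrite -[RHS]/(1 *+ (n == 0)) /=; case: n => [[|n]|n].
  - by rewrite mulr0 subr0.
  - by rewrite -predn_int //= mulr0 subrr.
  - by rewrite NegzE -opprD -[n.+1%:Z + 1]/(n.+1 + 1)%:Z addn1 -!NegzE /= -exprS
      subrr.
split=> //; rewrite mulrBr -lzC -[RHS]e1 mulrBl; congr (_ - _).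
apply: laurentP => n; rewrite coef_Mlcst coef_lcstM /=.
by case: n => n; rewrite ?mul0r ?mulr0 // -exprSr -exprS.
Qed.

Lemma lz_sub_unit x : lz - lcst x \is a GRing.unit.
Proof. by apply/unitrP; exists (lgeo x); apply: lgeoK. Qed.

Lemma lz_sub_inv x : (lz - lcst x)^-1 = lgeo x.
Proof.
have [h _] := lgeoK x; apply: (mulIr (lz_sub_unit x)).
by rewrite h mulVr ?lz_sub_unit.
Qed.

Definition regular (f : laurent A) : Prop := exists q, f = lpoly q.

Lemma regular0 : regular 0.
Proof. by exists 0; rewrite /lpoly rmorph0 horner0. Qed.

Lemma regular_lcst x : regular (lcst x).
Proof. by exists x%:P; rewrite /lpoly map_polyC hornerC. Qed.

Lemma regular_lz : regular lz.
Proof. by exists 'X; rewrite /lpoly map_polyX hornerX. Qed.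

Lemma regularB f g : regular f -> regular g -> regular (f - g).
Proof.
by move=> [p ->] [q ->]; exists (p - q); rewrite /lpoly rmorphB hornerD hornerN.
Qed.

Lemma regularM f g : regular f -> regular g -> regular (f * g).
Proof.
move=> [p ->] [q ->]; exists (p * q); rewrite /lpoly rmorphM hornerM_comm //.
by rewrite /comm_poly lzC.
Qed.

Lemma regularD f g : regular f -> regular g -> regular (f + g).
Proof.
move=> pf pg; rewrite -[g]opprK -[- g]sub0r; apply: regularB => //.
exact: regularB regular0 _.
Qed.

Lemma regular_sum (I : Type) (s : seq I) (P : pred I) (F : I -> laurent A) :
  (forall i, regular (F i)) -> regular (\sum_(i <- s | P i) F i).
Proof. by move=> h; apply: big_ind => //; [apply: regular0|apply: regularD].
  Qed.

End LaurentTheory.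

(** * Relations in the oscillator algebra *)

Section OscTheory.
Variables (K : numClosedFieldType) (r : nat) (a : nat -> nat).
Local Notation osc := (osc K r a).
Local Notation opi := (@opi K r a).
Implicit Types t u : oterm K a.

Lemma opiD t u : opi (Oadd t u) = opi t + opi u. Proof. by rewrite -oscaddE.
  Qed.
Lemma opiM t u : opi (Omul t u) = opi t * opi u. Proof. by rewrite -oscmulE.
  Qed.
Lemma opiB t u : opi (osub t u) = opi t - opi u.
Proof. by rewrite opiD; congr (_ + _); rewrite -oscoppE. Qed.
Lemma opiC c : opi (Ocst a c) = c%:A.
Proof.
rewrite -[c%:A]/(oscscale c (opi (Ocst a 1))) oscscaleE; apply: opiP.
by apply: Osym; rewrite -{2}[c]mulr1; apply: OcstM.
Qed.
Lemma opiZ (n : int) : opi (Ocst a n%:~R) = n%:~R.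
Proof. by rewrite opiC -[_%:A]/(in_alg _ _) rmorph_int. Qed.

Variables (i j : nat) (k : 'I_(a i)) (l : 'I_(a j)).
Lemma op_op : op K r k * op K r l = op K r l * op K r k.
Proof.
apply/eqP; rewrite -subr_eq0 -!opiM -opiB; apply/eqP.
by rewrite (opiP (Opp K r k l)) opiC scale0r.
Qed.

Lemma oq_oq s s' : oq K r s k * oq K r s' l = oq K r s' l * oq K r s k.
Proof.
apply/eqP; rewrite -subr_eq0 -!opiM -opiB; apply/eqP.
by rewrite (opiP (Oqq K r s k s' l)) opiC scale0r.
Qed.

Lemma oqK s : oq K r s k * oq K r (~~ s) k = 1.
Proof. by rewrite -opiM (opiP (OqK K r s k)) opiC scale1r. Qed.

Lemma oq_op s : oq K r s k * op K r l =
  (op K r l - (if s then 1 else - 1) *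
    (pstep r i)%:R *+ ((i == j) && (k == l :> nat))) * oq K r s k.
Proof.
apply/eqP; rewrite mulrBl -subr_eq0 opprB addrCA addrC -!opiM -opiB; apply/eqP.
rewrite (opiP (Oqp K r s k l)) opiM opiZ -mulrDl.
rewrite (_ : _ + _ = 0) ?mul0r //; case: (_ && _);
  last by rewrite !mulr0n addr0.
rewrite !mulr1n mulNr rmorphN /= rmorphM /= /ocoef /pstep.
by case: s; case: ifP => _;
  rewrite /= ?rmorphN1 ?mul1r ?mulN1r ?opprK ?addNr ?addrN.
Qed.

End OscTheory.

Lemma op_sub_inv (K : numClosedFieldType) r (a : nat -> nat) i (k l : 'I_(a i))
  (n : int) :
  k != l -> exists w, w * (op K r k - op K r l + n%:~R) = 1 /\
                      (op K r k - op K r l + n%:~R) * w = 1.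
Proof.
move=> kl; exists (opi r (Oinv K kl n)).
rewrite -opiZ -opiB -opiD -!opiM.
by rewrite (opiP (OinvL K r kl n)) (opiP (OinvR K r kl n)) opiC scale1r.
Qed.

(** * The commutative ring of functions of the momenta and its shifts *)

Section Diagonal.
Variables (K : numClosedFieldType) (r : nat) (a : nat -> nat).
Local Notation L := (laurent (osc K r a)).
Local Notation lp k := (lp K r k).
Local Notation lq s k := (lq K r s k).

(* The double centralizer of the [p]'s: a commutative subring of [L] that is
   stable under inverses and under conjugation by the [e^q]'s. *)
Definition diagonal : {pred L} :=
  fun x => `[< forall y, (forall i (k : 'I_(a i)), GRing.comm y (lp k)) ->
    GRing.comm x y >].

Lemma diagonalP x : reflect
  (forall y, (forall i (k : 'I_(a i)), GRing.comm y (lp k)) -> GRing.comm x y)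
  (x \in diagonal).
Proof. exact: asboolP. Qed.

Fact diagonal_divring : divring_closed diagonal.
Proof.
split=> [|x x' /diagonalP hx /diagonalP hx'|x x' /diagonalP hx /diagonalP hx'].
- by apply/diagonalP => y _; apply/commr_sym/commr1.
- apply/diagonalP => y hy; apply/commr_sym/commrB; apply/commr_sym;
    [exact: hx|exact: hx'].
- apply/diagonalP => y hy; apply/commr_sym/commrM; [exact/commr_sym/hx|].
  exact/commrV/commr_sym/hx'.
Qed.
HB.instance Definition _ :=
  GRing.isDivringClosed.Build L diagonal diagonal_divring.

Lemma lp_lp i (k : 'I_(a i)) j (l : 'I_(a j)) : GRing.comm (lp k) (lp l).
Proof. by rewrite /GRing.comm /Defs.lp -!rmorphM op_op. Qed.

Lemma diagonal_lp i (k : 'I_(a i)) : lp k \in diagonal.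
Proof. by apply/diagonalP => y /(_ i k) /commr_sym. Qed.

Lemma diagonal_central x : (forall y, x * y = y * x) -> x \in diagonal.
Proof. by move=> h; apply/diagonalP => y _; apply: h. Qed.

Record dsub := DSub { dval : L; dvalP : dval \in diagonal }.
HB.instance Definition _ := [isSub for dval].
HB.instance Definition _ := [Choice of dsub by <:].
HB.instance Definition _ := [SubChoice_isSubUnitRing of dsub by <:].

(** The momenta commute, so an element of the double centralizer commutes with them and is itself
    one of the elements against which the others are tested. *)
Fact dsub_mulC : commutative (@GRing.mul dsub).
Proof.
move=> x y; apply: val_inj; rewrite !rmorphM /=.
apply: (diagonalP _ (dvalP x)) => i k.
by apply: (diagonalP _ (dvalP y)) => j l; apply: lp_lp.
Qed.
HB.instance Definition _ := GRing.PzRing_hasCommutativeMul.Build dsub dsub_mulC.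


Fact dval_zmod : zmod_morphism dval.
Proof. exact: (rmorphB \val). Qed.
Fact dval_monoid : monoid_morphism dval.
Proof. by split; [exact: (rmorph1 \val)|exact: (rmorphM \val)]. Qed.
HB.instance Definition _ := GRing.isZmodMorphism.Build dsub L dval dval_zmod.
HB.instance Definition _ :=
  GRing.isMonoidMorphism.Build dsub L dval dval_monoid.

Definition dvalc (x : dsub) : L^c := dval x.
Fact dvalc_zmod : zmod_morphism dvalc.
Proof. exact: (rmorphB dval). Qed.
Fact dvalc_monoid : monoid_morphism dvalc.
Proof.
split=> [|x y]; first exact: (rmorph1 dval).
by rewrite mulrC; apply: (rmorphM dval).
Qed.
HB.instance Definition _ :=
  GRing.isZmodMorphism.Build dsub L^c dvalc dvalc_zmod.
HB.instance Definition _ :=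
  GRing.isMonoidMorphism.Build dsub L^c dvalc dvalc_monoid.

Lemma dval_unit x : dval x \is a GRing.unit -> x \is a GRing.unit.
Proof.
move=> xU; have yd : (dval x)^-1 \in diagonal by rewrite rpredV dvalP.
apply/unitrP; exists (DSub yd); split; apply: val_inj;
  rewrite rmorphM rmorph1 /=.
  by rewrite mulVr.
by rewrite divrr.
Qed.

Lemma lqK s i (k : 'I_(a i)) : lq s k * lq (~~ s) k = 1.
Proof. by rewrite -rmorphM oqK rmorph1. Qed.

Lemma lq_lq s i (k : 'I_(a i)) s' j (l : 'I_(a j)) : lq s k * lq s' l =
  lq s' l * lq s k.
Proof. by rewrite -!rmorphM oq_oq. Qed.

Lemma lqK' s i (k : 'I_(a i)) : lq (~~ s) k * lq s k = 1.
Proof. by rewrite lq_lq lqK. Qed.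

Lemma lq_lp s i (k : 'I_(a i)) j (l : 'I_(a j)) : lq s k * lp l =
  (lp l - (if s then 1 else - 1) *
    (pstep r i)%:R *+ ((i == j) && (k == l :> nat))) * lq s k.
Proof.
rewrite -!rmorphM oq_op rmorphM rmorphB rmorphMn rmorphM rmorph_nat.
by case: s; rewrite ?rmorphN rmorph1.
Qed.

(** Conjugation by [e^q] moves each momentum by a constant, so it preserves the centralizer of the
    momenta and hence its centralizer. *)
Fact sigma_subproof s i (k : 'I_(a i)) (x : dsub) :
  lq s k * dval x * lq (~~ s) k \in diagonal.
Proof.
apply/diagonalP => y hy.
have hy' : GRing.comm (dval x) (lq (~~ s) k * y * lq s k).
  apply: (diagonalP _ (dvalP x)) => j l; rewrite /GRing.comm.
  have key u : lq (~~ s) k * (lq s k * u * lq (~~ s) k) * lq s k = u.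
    by rewrite !mulrA lqK' mul1r -mulrA lqK' mulr1.
  have inj u w : lq s k * u * lq (~~ s) k = lq s k * w * lq (~~ s) k -> u = w.
    by move=> h; rewrite -(key u) h key.
  apply: inj.
  have qpq : lq s k * lp l * lq (~~ s) k =
     lp l - (if s then 1 else - 1) *
       (pstep r i)%:R *+ ((i == j) && (k == l :> nat)).
    by rewrite lq_lp -mulrA lqK mulr1.
  transitivity (y * (lq s k * lp l * lq (~~ s) k));
    first by rewrite !mulrA lqK mul1r.
  transitivity (lq s k * lp l * lq (~~ s) k * y);
    last by rewrite -!mulrA lqK mulr1.
  rewrite qpq; apply: commrB (hy j l) _; apply/commrMn/commrM/commr_nat.
  by case: s {hy key qpq}; [exact: commr1|exact/commrN/commr1].
rewrite /GRing.comm; transitivity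
  (lq s k * (dval x * (lq (~~ s) k * y * lq s k)) * lq (~~ s) k).
  by rewrite -!mulrA lqK mulr1.
by rewrite hy' !mulrA lqK mul1r.
Qed.
Definition sigma s i (k : 'I_(a i)) (x : dsub) : dsub :=
  DSub (sigma_subproof s k x).

Fact sigma_zmod s i (k : 'I_(a i)) : zmod_morphism (sigma s k).
Proof.
move=> x y; apply: val_inj;
  rewrite -[LHS]/(lq s k * dval (x - y) * lq (~~ s) k).
by rewrite [RHS](rmorphB dval) (rmorphB dval) mulrBr mulrBl.
Qed.
Fact sigma_monoid s i (k : 'I_(a i)) : monoid_morphism (sigma s k).
Proof.
split=> [|x y]; apply: val_inj.
  by rewrite -[LHS]/(lq s k * dval 1 * lq (~~ s) k) (rmorph1 dval) mulr1 lqK.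
rewrite -[LHS]/(lq s k * dval (x * y) * lq (~~ s) k) [RHS](rmorphM dval)
  (rmorphM dval x).
by rewrite -!mulrA /= -!mulrA (mulrA (lq (~~ s) k)) lqK' mul1r.
Qed.
HB.instance Definition _ s i (k : 'I_(a i)) :=
  GRing.isZmodMorphism.Build dsub dsub (sigma s k) (sigma_zmod s k).
HB.instance Definition _ s i (k : 'I_(a i)) :=
  GRing.isMonoidMorphism.Build dsub dsub (sigma s k) (sigma_monoid s k).

Definition dsg s i (k : 'I_(a i)) : {rmorphism dsub -> dsub} := sigma s k.

Lemma dsgE s i (k : 'I_(a i)) x : dval (dsg s k x) = lq s k * dval x *
  lq (~~ s) k.
Proof. by []. Qed.

Lemma lq_dval s i (k : 'I_(a i)) x : lq s k * dval x = dval (dsg s k x) *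
  lq s k.
Proof. by rewrite dsgE -!mulrA lqK' mulr1. Qed.

Lemma dval_lq s i (k : 'I_(a i)) x : dval x * lq s k = lq s k *
  dval (dsg (~~ s) k x).
Proof. by rewrite dsgE negbK !mulrA lqK mul1r. Qed.

Lemma scalar_central (c : K) (y : L) : lcst c%:A * y = y * lcst c%:A.
Proof.
by apply: laurentP => n;
  rewrite coef_lcstM coef_Mlcst -scalerAl mul1r -scalerAr mulr1.
Qed.

Definition deta (c : K) : dsub := DSub (diagonal_central (scalar_central c)).
Fact deta_zmod : zmod_morphism deta.
Proof.
move=> x y; apply: val_inj;
  rewrite -[LHS]/(lcst (x - y)%:A) [RHS](rmorphB dval).
by rewrite scalerBl rmorphB.
Qed.
Fact deta_monoid : monoid_morphism deta.
Proof.
split=> [|x y]; apply: val_inj; first by rewrite /= scale1r rmorph1.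
rewrite -[LHS]/(lcst (x * y)%:A) [RHS](rmorphM dval)
  -[RHS]/(lcst x%:A * lcst y%:A).
by rewrite -rmorphM -scalerAl mul1r scalerA.
Qed.
HB.instance Definition _ := GRing.isZmodMorphism.Build K dsub deta deta_zmod.
HB.instance Definition _ :=
  GRing.isMonoidMorphism.Build K dsub deta deta_monoid.

Definition dz : dsub := DSub (diagonal_central (@lzC _)).
Definition dp i (k : 'I_(a i)) : dsub := DSub (diagonal_lp k).

Lemma dsg_dp s b (k : 'I_(a b)) j (l : 'I_(a j)) : dsg s k (dp l) =
  dp l - (if s then 1 else - 1) *
    (pstep r b)%:R *+ ((b == j) && (k == l :> nat)).
Proof.
apply: val_inj; rewrite [LHS]/= lq_lp -mulrA lqK mulr1.
rewrite -[RHS]/(dval _) rmorphB rmorphMn rmorphM rmorph_nat /=.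
by case: s; rewrite ?rmorphN rmorph1.
Qed.

Lemma dsg_central s b (k : 'I_(a b)) x : (forall y, dval x * y = y * dval x) ->
  dsg s k x = x.
Proof. by move=> h; apply: val_inj; rewrite /= -h -mulrA lqK mulr1. Qed.

Lemma dsg_deta s b (k : 'I_(a b)) x : dsg s k (deta x) = deta x.
Proof. by apply: dsg_central => y; apply: scalar_central. Qed.

Lemma dsg_dz s b (k : 'I_(a b)) : dsg s k dz = dz.
Proof. by apply: dsg_central => y; apply: lzC. Qed.

Lemma dp_sub_unit i (k l : 'I_(a i)) (n : int) : k != l ->
  dp k - dp l + n%:~R \is a GRing.unit /\
  exists c, dval (dp k - dp l + n%:~R)^-1 = lcst c.
Proof.
move=> kl; have [w [h1 h2]] := @op_sub_inv K r a i k l n kl.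
have e : dval (dp k - dp l + n%:~R) = lcst (op K r k - op K r l + n%:~R).
  by rewrite rmorphD rmorphB rmorph_int rmorphD rmorphB rmorph_int.
have xU : dp k - dp l + n%:~R \is a GRing.unit.
  by apply: dval_unit; rewrite e; apply/unitrP; exists (lcst w);
    rewrite -!rmorphM h1 h2 rmorph1.
split=> //; exists w; transitivity (dval (dp k - dp l + n%:~R))^-1;
  first exact: rmorphV.
rewrite e.
have xU' : lcst (op K r k - op K r l + n%:~R) \is a GRing.unit by rewrite -e
  rmorph_unit.
by apply: (mulIr xU'); rewrite mulVr // -rmorphM h1 rmorph1.
Qed.

Lemma dz_sub_unit x : (exists c, dval x = lcst c) -> dz - x \is a GRing.unit.
Proof.
by move=> [c hc]; apply: dval_unit; rewrite rmorphB /= hc lz_sub_unit.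
Qed.

End Diagonal.

(** * Degrees *)

Section Degrees.
Variables (K : numClosedFieldType) (r : nat) (D : divisor r K) (a : nat -> nat).
Hypothesis hA : assumptionA D a.

Definition dpoints (b : nat) : seq K :=
  [seq dpt s | s <- enum 'I_(dsize D) & dind s == b :> nat].

Let sum_delta n : \sum_(1 <= i < r.+1) (a i)%:Z *+ (i == n) = a n.
Proof.
transitivity (\sum_(1 <= i < r.+1 | i == n) (a i)%:Z).
  by rewrite [RHS]big_mkcond; apply: eq_bigr => i _; case: eqP.
rewrite big_nat1_eq; case: ifP => // h; have [hA0 _] := hA.
by rewrite hA0 // h.
Qed.

(** Pair Assumption (A) with [epsilon_b^vee - epsilon_(b+1)^vee]. The finite part of the divisor
    counts its points of colour [b], the part at infinity is non-negative by dominance, and the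
    roots give a row of the Cartan matrix. *)
Lemma degree_le b : (0 < b <= r)%N ->
  (size (dpoints b) + (a b.-1 + (if b == r then a b.-1 else a b.+1)) <= a b +
    a b)%N.
Proof.
move=> hb; have [hA0 hAl] := hA.
pose phi (m : wlattice r) := wepsv b m - wepsv b.+1 m.
have phiD m n : phi (m + n) = phi m + phi n by rewrite /phi /wepsv !mxE; ring.
have phi0 : phi 0 = 0 by rewrite /phi /wepsv !mxE subrr.
have phiN m : phi (- m) = - phi m by rewrite /phi /wepsv !mxE opprB addrC opprK.
have phi_sum (I : Type) (s : seq I) P F : phi (\sum_(i <- s | P i) F i) =
  \sum_(i <- s | P i) phi (F i).
  by apply: (big_morph phi phiD phi0).
have phiMn m n : phi (m *+ n) = phi m *+ n.
  by elim: n => [|n IH]; rewrite ?mulr0n // !mulrS phiD IH.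
have phiMz m (n : int) : phi (m *~ n) = phi m *~ n.
  by case: n => n; rewrite ?NegzE ?mulrNz ?phiN -!pmulrn phiMn.
have phi_eps j : phi (weps r j) = (b == j)%:R - (b.+1 == j)%:R.
  by rewrite /phi /wepsv /weps !mxE !inordK ?prednK //; lia.
have phi_varpi i : phi (wvarpi r i) = (i == b)%:R.
  rewrite /wvarpi phiN phi_sum; under eq_bigr do rewrite phi_eps.
  rewrite sumrB.
  have e n : (n < r.+2)%N -> \sum_(i.+1 <= j < r.+2) ((n == j)%:R : int) =
    (i < n)%:R.
    move=> nr; transitivity (\sum_(i.+1 <= j < r.+2 | j == n) (1 : int)).
      by rewrite [RHS]big_mkcond; apply: eq_bigr => j _; rewrite eq_sym;
        case: eqP.
    by rewrite big_nat1_eq nr andbT; case: ltnP.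
  by rewrite !e; lia.
have phi_alpha i : (0 < i <= r)%N -> phi (walpha r i) =
   2 *+ (i == b) - (1 *+ (i == b.-1) +
     (if b == r then 1 *+ (i == b.-1) else 1 *+ (i == b.+1))).
  move=> hi; have e1 : (b.+1 == i) = (i == b.+1) by rewrite eq_sym.
  have e2 : (b == i.+1) = (i == b.-1) by apply/eqP/eqP; lia.
  rewrite /walpha; case: eqP => ir;
    rewrite ?phiD ?phiN !phi_eps eqSS (eq_sym b i) e1 e2.
    have e3 : (b == i.+2) = false by apply/eqP; lia.
    have e4 : (i == b.-1) = (b == r) by apply/eqP/eqP; lia.
    have e5 : (b == r) && (i == b.+1) =
      false by apply/negP => /andP[/eqP ? /eqP ?]; lia.
    by rewrite eqSS e2 e3 e4; move: e5; case: (b == r); case: (i == b.+1);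
      case: (i == b).
  have e4 : (b == r) && (i == b.-1) =
    false by apply/negP => /andP[/eqP ? /eqP ?]; lia.
  have e5 : (b == r) && (i == b.+1) =
    false by apply/negP => /andP[/eqP ? /eqP ?]; lia.
  by move: e4 e5; case: (b == r); case: (i == b.-1); case: (i == b.+1);
    case: (i == b).
have := congr1 phi hAl; rewrite phiD !phi_sum.
have -> : \sum_(s < dsize D) phi (wvarpi r (dind s) *~ dsgn s) =
  (size (dpoints b))%:Z.
  rewrite size_map size_filter -sum1_count (big_morph Posz PoszD erefl).
  rewrite [RHS]big_mkcond [RHS]big_enum /=; apply: eq_bigr => s _;
    rewrite phiMz phi_varpi.
  (* A negative sign occurs only in colour 0, which [phi] does not see because [b > 0]. *)
  by case: (dsgnP s) => [->|[d0 ->]]; rewrite ?mulr1z; case: eqP => // e; lia.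
rewrite [X in _ + _ = X](_ : _ = 2 * (a b)%:Z - ((a b.-1)%:Z +
    (if b == r then (a b.-1)%:Z else (a b.+1)%:Z))); last first.
  transitivity (\sum_(1 <= i < r.+1)
    (2 * ((a i)%:Z *+ (i == b)) - ((a i)%:Z *+ (i == b.-1) +
    (if b == r then (a i)%:Z *+ (i == b.-1) else (a i)%:Z *+ (i == b.+1))))).
    apply: eq_big_nat => i hi; rewrite phiMn phi_alpha; last by lia.
    by case: ifP => _; case: (i == b); case: (i == b.-1); case: (i == b.+1);
      rewrite ?mulr1n ?mulr0n -mulr_natr natz; ring.
  rewrite sumrB -mulr_sumr big_split /= !sum_delta.
  by case: ifP => _; rewrite sum_delta.
have := dinfP D hb; rewrite -/(phi (dinf D)); case: ifP => _; lia.
Qed.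
End Degrees.

(** * Regularity of the Lax matrix *)

Section Assembly.
Variables (K : numClosedFieldType) (r : nat) (D : divisor r K) (a : nat -> nat).
Hypothesis r0 : (0 < r)%N.
Hypothesis hA : assumptionA D a.

Local Notation L := (laurent (osc K r a)).
Local Notation lp k := (lp K r k).
Local Notation lq s k := (lq K r s k).

Variables (C : comUnitRingType) (iota : {rmorphism C -> L})
  (iotac : {rmorphism C -> L^c}).
Variables (eta : {rmorphism K -> C}) (p : forall i, 'I_(a i) -> C).
Variable sg : bool -> forall i, 'I_(a i) -> {rmorphism C -> C}.
Variable z : C.

(** Freedom from [z]: it makes [z - x] invertible, and the residues [e_coef], [f_coef] have it. *)
Definition const (x : C) : Prop := exists c, iota x = lcst c.

Hypothesis iotacE : forall x, iotac x = iota x :> L.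
Hypothesis iota_eta : forall x, iota (eta x) = lcst x%:A.
Hypothesis iota_p : forall i (k : 'I_(a i)), iota (p k) = lp k.
Hypothesis iota_z : iota z = lz.
Hypothesis lq_iota : forall s i (k : 'I_(a i)) x, lq s k * iota x =
  iota (sg s k x) * lq s k.
Hypothesis iota_lq : forall s i (k : 'I_(a i)) x, iota x * lq s k = lq s k *
  iota (sg (~~ s) k x).
Hypothesis sgp : forall s b (k : 'I_(a b)) j (l : 'I_(a j)),
  sg s k (p l) = p l - (if s then 1 else - 1) *
    (pstep r b)%:R *+ ((b == j) && (k == l :> nat)).
Hypothesis sg_eta : forall s b (k : 'I_(a b)) x, sg s k (eta x) = eta x.
Hypothesis sg_z : forall s b (k : 'I_(a b)), sg s k z = z.
Hypothesis pU : forall b (k l : 'I_(a b)) (n : int), k != l -> p k - p l +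
  n%:~R \is a GRing.unit.
Hypothesis pVconst : forall b (k l : 'I_(a b)) (n : int), k != l ->
  const (p k - p l + n%:~R)^-1.
Hypothesis z_unit : forall x, const x -> z - x \is a GRing.unit.

Local Notation zs := (dpoints D).
Local Notation link := (link_color r).
Local Notation P := (pprod p).
Local Notation P' := (@pprod' C a p _).
Local Notation G := (@e_coef C r a p).
Local Notation U := (@f_coef K C eta r a p zs).
Local Notation Zp := (Zprod eta zs).
Local Notation kf := (hratio eta r p zs).
Local Notation yl := (link_pt r z).

Lemma eq_mulL (x x' y y' : L) : x = x' -> y = y' -> x * y = x' * y'.
Proof. by move=> -> ->. Qed.

Lemma constB x y : const x -> const y -> const (x - y).
Proof. by move=> [c hc] [d hd]; exists (c - d); rewrite !rmorphB /= hc hd. Qed.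
Lemma constM x y : const x -> const y -> const (x * y).
Proof. by move=> [c hc] [d hd]; exists (c * d); rewrite !rmorphM /= hc hd. Qed.
Lemma const1 : const 1. Proof. by exists 1; rewrite !rmorph1. Qed.
Lemma const_int n : const n%:~R. Proof. by exists n%:~R; rewrite !rmorph_int.
  Qed.
Lemma const_nat n : const n%:R. Proof. by exists n%:R; rewrite !rmorph_nat. Qed.
Lemma constN x : const x -> const (- x).
Proof. by move=> [c hc]; exists (- c); rewrite !rmorphN /= hc. Qed.
Lemma const_p i (k : 'I_(a i)) : const (p k). Proof. by exists (op K r k);
  apply: iota_p. Qed.
Lemma const_eta x : const (eta x). Proof. by exists x%:A; apply: iota_eta. Qed.
Lemma const_prod (I : Type) (s : seq I) (Q : pred I) F :
  (forall i, Q i -> const (F i)) -> const (\prod_(i <- s | Q i) F i).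
Proof. by move=> h; apply: big_ind => //; [exact: const1|exact: constM]. Qed.

Lemma zU b (k : 'I_(a b)) (n : int) : z + n%:~R - p k \is a GRing.unit.
Proof.
rewrite -addrA -[n%:~R - _]opprB; apply: z_unit.
by apply: constB (const_int _); apply: const_p.
Qed.

Lemma a0 : a 0 = 0%N. Proof. by have [h _] := hA; apply: h. Qed.

Lemma szr b : (0 < b <= r)%N -> (size (nroots eta r p zs b) <= a b + a b)%N.
Proof.
move=> hb; apply: leq_trans (degree_le hA hb).
rewrite /nroots !size_cat !size_map -?enumT size_enum_ord.
by case: ifP => _; rewrite size_map -?enumT size_enum_ord.
Qed.

Lemma iota_P j y : iota (P j y) = Pfun j (iota y).
Proof. by rewrite rmorph_prod; apply: eq_bigr => k _; rewrite rmorphB iota_p.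
  Qed.

Lemma iota_P' j (k : 'I_(a j)) y : iota (P' k y) = Pfun' k (iota y).
Proof. by rewrite rmorph_prod; apply: eq_bigr => l _; rewrite rmorphB iota_p.
  Qed.

Lemma iota_Zp j y : (0 < j)%N -> iota (Zp j y) = Zfun D j (iota y).
Proof.
move=> j0; rewrite rmorph_prod /= big_map big_filter ?big_enum_cond ?enumT.
apply: eq_bigr => s /eqP sj; rewrite rmorphB iota_eta.
by case: (dsgnP s) => [->|[d0 _]]; [rewrite expr1z|move: j0; rewrite -sj d0].
Qed.

Lemma iota_div (x y : C) : y \is a GRing.unit -> iota (x / y) = iota x / iota y.
Proof. exact: rmorph_div. Qed.

Lemma iota_inv (x : C) : x \is a GRing.unit -> iota x^-1 = (iota x)^-1.
Proof. exact: rmorphV. Qed.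

Lemma ebasicE b y : (0 < b <= r)%N ->
  (forall k : 'I_(a b), y - p k \is a GRing.unit) ->
  ebasic b (iota y) = \sum_(k < a b) iota ((y - p k)^-1 * G k) * lq true k.
Proof.
move=> hb yU; have PU (k : 'I_(a b)) : P' k (p k) \is a GRing.unit
  by apply: (P'U0 pU).
have e k : (iota y - lp k) * Pfun' k (lp k) = iota ((y - p k) * P' k (p k)).
  by rewrite rmorphM rmorphB iota_P' iota_p.
have eG (k : 'I_(a b)) : (y - p k)^-1 * G k =
  e_numer r p b (p k) / ((y - p k) * P' k (p k)).
  by rewrite invrM ?yU // /e_coef mulrCA mulrA [_^-1 * _]mulrC mulrA.
have eT (k : 'I_(a b)) u : u = iota (e_numer r p b (p k)) ->
    u / ((iota y - lp k) * Pfun' k (lp k)) = iota ((y - p k)^-1 * G k).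
  by move=> ->; rewrite eG e iota_div // unitrM yU PU.
rewrite /ebasic; case: eqP => [br|/eqP br].
  subst b; apply: eq_bigr => k _; rewrite eT //.
  by rewrite /e_numer eqxx rmorphM !iota_P !rmorphB rmorph1 rmorph_nat iota_p.
apply: eq_bigr => k _; rewrite eT //.
by rewrite /e_numer (negPf br) mulr1 iota_P rmorphB rmorph1 iota_p.
Qed.

Lemma U_sg b (k : 'I_(a b)) : (0 < b)%N -> sg false k (U k) =
  - f_numer eta r p zs b (p k + (pstep r b)%:R) / P' k (p k).
Proof.
move=> b0; have bb : b != b.+1 by lia.
have e : sg false k (p k) = p k +
  (pstep r b)%:R by rewrite sgp !eqxx mulN1r opprK.
rewrite rmorph_div; last by apply: (P'Un pU).
rewrite rmorphN (sgP' sgp) rmorphB e rmorph_nat addrK; congr (- _ / _).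
rewrite rmorphM (sgZp zs sg_eta) e; congr (_ * _).
by case: ifP => _; rewrite ?rmorph1 // (sgP_ne sgp) // e.
Qed.

Lemma fbasicE b y : (0 < b <= r)%N ->
  (forall k : 'I_(a b), y - p k \is a GRing.unit) ->
  (forall k : 'I_(a b), y - p k - (pstep r b)%:R \is a GRing.unit) ->
  (forall s (k : 'I_(a b)), sg s k y = y) ->
  fbasic D b (iota y) = \sum_(k < a b) lq false k * iota ((y - p k)^-1 * U k).
Proof.
move=> hb yU yU' sy; have b0 : (0 < b)%N by case/andP: hb.
have PU (k : 'I_(a b)) : P' k (p k) \is a GRing.unit by apply: (P'U0 pU).
have e (k : 'I_(a b)) : sg false k (p k) = p k +
  (pstep r b)%:R by rewrite sgp !eqxx mulN1r opprK.
have eU (k : 'I_(a b)) : sg false k ((y - p k)^-1 * U k) =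
   - f_numer eta r p zs b (p k + (pstep r b)%:R) /
       ((y - p k - (pstep r b)%:R) * P' k (p k)).
  rewrite rmorphM rmorphV // rmorphB sy e U_sg // opprD addrA.
  by rewrite invrM // mulrCA mulrA [_^-1 * _]mulrC mulrA.
have eT (k : 'I_(a b)) u w : u =
  iota (f_numer eta r p zs b (p k + (pstep r b)%:R)) ->
    w = iota (y - p k - (pstep r b)%:R) ->
    - (u / (w * Pfun' k (lp k)) * lq false k) = lq false k *
        iota ((y - p k)^-1 * U k).
  move=> -> ->; rewrite lq_iota eU -iota_p -(iota_P' k (p k)) -rmorphM -mulNr;
    apply: eq_mulL => //.
  by rewrite mulNr rmorphN iota_div // unitrM yU' PU.
rewrite /fbasic; case: eqP => [br|/eqP br].
  subst b; rewrite -sumrN; apply: eq_bigr => k _; apply: eT.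
    by rewrite /f_numer eqxx mulr1 iota_Zp // rmorphD rmorph_nat iota_p /pstep
      eqxx.
  by rewrite !rmorphB rmorph_nat iota_p /pstep eqxx.
rewrite -sumrN; apply: eq_bigr => k _; apply: eT; rewrite /pstep (negPf br).
  by rewrite /f_numer (negPf br) rmorphM iota_Zp // iota_P rmorphD rmorph1
    iota_p.
by rewrite !rmorphB rmorph1 iota_p.
Qed.


Lemma lres_sum (I : Type) (s : seq I) (Q : pred I) (F : I -> L) :
  lres (\sum_(i <- s | Q i) F i) = \sum_(i <- s | Q i) lres (F i).
Proof.
apply: (big_morph (@lres K r a)) => [f g|]; first by rewrite /lres -rmorphD.
by rewrite /lres -(rmorph0 (@lcst _)).
Qed.

Lemma lres_inv b (k : 'I_(a b)) (c d : osc K r a) :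
  lres (lcst c * (lz - lp k)^-1 * lcst d) = lcst c * lcst d.
Proof.
by rewrite /lres /Defs.lp lz_sub_inv coef_Mlcst coef_lcstM /= mulr1 rmorphM.
Qed.

Lemma const_P'V b (k : 'I_(a b)) (n : nat) : const (P' k (p k - n%:R))^-1.
Proof.
have h l : l != k -> p k - n%:R
  - p l \is a GRing.unit /\ const (p k - n%:R - p l)^-1.
  move=> lk; have kl : k != l by rewrite eq_sym.
  have := pU (- n%:Z) kl; have := pVconst (- n%:Z) kl.
  by rewrite rmorphN addrAC.
rewrite /pprod' -prodrV => [|l lk]; last by case: (h l lk).
by apply: const_prod => l lk; case: (h l lk).
Qed.

Lemma const_P j y : const y -> const (P j y).
Proof. by move=> hy; apply: const_prod => k _; apply: constB => //;
  apply: const_p. Qed.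

Lemma const_G b (k : 'I_(a b)) : const (G k).
Proof.
have h n : const (p k - n%:R) by apply: constB;
  [apply: const_p|apply: const_nat].
rewrite /e_coef -[X in P' k X]subr0 -[0]/(0%:R) ; apply: constM (const_P'V k 0).
apply: constM; first by apply/const_P/(h 1%N).
by case: ifP => _; [apply/const_P/(h 2%N)|apply: const1].
Qed.

Lemma const_U b (k : 'I_(a b)) : const (U k).
Proof.
apply: constM (const_P'V _ _); apply/constN/constM.
  by apply: const_prod => x _; apply: constB; [apply: const_p|apply: const_eta].
by case: ifP => _; [apply: const1|apply/const_P/const_p].
Qed.

Lemma z_subp b (k : 'I_(a b)) : z - p k \is a GRing.unit.
Proof. by apply: z_unit; apply: const_p. Qed.

Lemma z_subpn b (k : 'I_(a b)) n : z - p k - n%:R \is a GRing.unit.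
Proof.
rewrite -addrA -opprD; apply: z_unit.
by rewrite -[n%:R]opprK; apply/constB/constN/const_nat/const_p.
Qed.

Lemma lres_ebasic b : (0 < b <= r)%N ->
  lres (ebasic b (iota z)) =
    Le iota (fun b (k : 'I_(a b)) => lq true k) (@e_coef C r a p) b.
Proof.
move=> hb; rewrite (@ebasicE b z hb) ?lres_sum; last by move=> k; apply: z_subp.
apply: eq_bigr => k _; have [c hc] := const_G k.
by rewrite mul1r mulrC rmorphM iota_inv ?z_subp // rmorphB iota_z iota_p hc
  lres_inv.
Qed.

Lemma lres_fbasic b : (0 < b <= r)%N ->
  lres (fbasic D b (iota z)) =
    Lf iota (fun b (k : 'I_(a b)) => lq false k) (@f_coef K C eta r a p zs) b.
Proof.
move=> hb; rewrite (@fbasicE b z hb) ?lres_sum; first last.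
- by move=> s k; apply: sg_z.
- by move=> k; apply: z_subpn.
- by move=> k; apply: z_subp.
apply: eq_bigr => k _; have [c hc] := const_U k.
rewrite mulrC rmorphM mulrA iota_inv ?z_subp // rmorphB iota_z iota_p hc.
by rewrite -[X in X * _^-1]rmorphM -[X in lres X]mulr1
  -[1 in LHS](rmorph1 (@lcst _)) lres_inv rmorph1 mulr1 rmorphM.
Qed.



Definition lqs s b (k : 'I_(a b)) : L := lq s k.
Definition lqsc s b (k : 'I_(a b)) : L^c := lq s k.

Lemma eta_central x (v : L) : iota (eta x) * v = v * iota (eta x).
Proof. by rewrite iota_eta scalar_central. Qed.

Lemma yl_small m : (m <= r)%N -> yl m = z. Proof. by rewrite /link_pt => ->.
  Qed.

Lemma yl_subp m b (k : 'I_(a b)) : yl m - p k \is a GRing.unit.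
Proof. exact: (ylU0 r zU). Qed.

Lemma yl_subpn m b (k : 'I_(a b)) n : yl m - p k - n%:R \is a GRing.unit.
Proof. by rewrite addrAC; apply: (ylUn r zU). Qed.

Lemma iota_yl m : iota (yl m) = if (m <= r)%N then lz else lz + (link m)%:R
  - r%:R - 1.
Proof.
rewrite /link_pt; case: ifP => _ //.
by rewrite !rmorphB rmorphD !rmorph_nat rmorph1 iota_z.
Qed.

Lemma Lc_half : Lc eta iota (- 2^-1) = - (2^-1 : L).
Proof.
have u2 : (2 : C) \is a GRing.unit by rewrite -(rmorph_nat eta) rmorph_unit //
  unitfE pnatr_eq0.
rewrite /Lc !rmorphN; congr (- _).
by rewrite rmorphV ?unitfE ?pnatr_eq0 // rmorph_nat rmorphV // rmorph_nat.
Qed.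

Definition vE := colv (@ecol K r a).

Definition Ee b : L := Le iota (lqs true) (@e_coef C r a p) b.
Definition Eb i : L :=
  osum iota (lqs true) (@e_coef C r a p)
  (fun k : 'I_(a (link i)) => (yl i - p k)^-1).
Definition Emu i : L := Lmu r p z iota (lqs true) (@e_coef C r a p) i.

Lemma EbE i : (0 < i < 2 * r)%N -> Eb i = ebasic (link i) (iota (yl i)).
Proof. by move=> hi; rewrite ebasicE ?linkE // => k; apply: yl_subp. Qed.

Lemma EmuE i : Emu i = (pstep r (link i))%:R * Eb i.
Proof.
rewrite /Emu /Lmu /Eb /osum mulr_sumr; apply: eq_bigr => k _.
rewrite [RHS]mulrA; apply: eq_mulL => //.
by rewrite -[X in _ = X * _](rmorph_nat iota) -[RHS]rmorphM mulrA.
Qed.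

Lemma xE i : (0 < i < 2 * r)%N ->
  Lc eta iota (link_coef K r i) =
    if (i < r)%N then 1 else if i == r then 2 else - 1.
Proof.
move=> hi; have hl := linkE hi; rewrite /link_coef ifF; last by apply/negbTE;
  lia.
by rewrite /Lc; case: ifP => _; [|case: ifP => _];
  rewrite ?rmorphN ?rmorph1 // !rmorph_nat.
Qed.

Lemma sE i : Lc eta iota (col_coef K r i) =
  if (i < r)%N then - 1 else if i == r then Lc eta iota (- 2^-1) else 1.
Proof. by rewrite /col_coef /Lc; case: ifP => _; [|case: ifP => _];
  rewrite ?rmorphN ?rmorph1. Qed.

Lemma hE : Lc eta iota (- 2^-1) * 2 = - 1.
Proof.
rewrite /Lc -(rmorph_nat iota) -(rmorph_nat eta) -!rmorphM mulNr mulVf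
  ?pnatr_eq0 //.
by rewrite !rmorphN !rmorph1.
Qed.

Lemma vE_raise m i : (0 < m < 2 * r)%N ->
  vE m.+1 i = Lc eta iota (col_coef K r m) *
    raise r Ee Emu (fun i => Lc eta iota (link_coef K r i)) (link m) (vE m) i.
Proof.
move=> hm; apply: (colv_raise r0 EmuE xE sE hE) => // {hm i}m i hm hi.
have hl := linkE hm.
have lE b : (0 < b <= r)%N -> lres (ebasic b lz) = Ee b by move=> hb;
  rewrite -iota_z lres_ebasic.
have bE b : (0 < b <= r)%N -> ebasic b lz = Eb b.
  by move=> hb; rewrite EbE ?iota_yl ?link_le //;
    [case/andP: hb => _ ->|case/andP: hb..|lia].
rewrite [ecol _ _ _ _]/= eqSS /lcomm; case: ltngtP => mr.
- have hmr : (0 < m <= r)%N by lia.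
  by rewrite lE // bE.
- have -> : iprime r m.+1 = link m by rewrite link_gt // /iprime subSS.
  have e2 : ebasic (link m) (lz + (link m)%:R - r%:R - 1) = Eb m.
    by rewrite EbE // iota_yl leqNgt mr.
  by rewrite /= e2 lE // bE.
- have hr : (0 < r <= r)%N by rewrite r0 leqnn.
  by rewrite lE // bE // Lc_half.
Qed.

Definition vF := colv (fun n i => frow D a n i : L^c).

Definition Fe b : L^c := Le iotac (lqsc false) (@f_coef K C eta r a p zs) b.
Definition Fb i : L^c :=
  osum iotac (lqsc false) (@f_coef K C eta r a p zs)
  (fun k : 'I_(a (link i)) => (yl i - p k)^-1).
Definition Fmu i : L^c :=
  Lmu r p z iotac (lqsc false) (@f_coef K C eta r a p zs) i.

Lemma FbE i : (0 < i < 2 * r)%N -> Fb i = fbasic D (link i) (iota (yl i)) :> L.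
Proof.
move=> hi; rewrite fbasicE ?linkE //; first last.
- by move=> s k; apply: sg_yl.
- by move=> k; apply: yl_subpn.
- by move=> k; apply: yl_subp.
by apply: eq_bigr => k _; rewrite -iotacE.
Qed.

Lemma FmuE i : Fmu i = (pstep r (link i))%:R * Fb i.
Proof.
rewrite /Fmu /Lmu /Fb /osum mulr_sumr; apply: eq_bigr => k _.
rewrite [RHS]mulrA; apply: (congr1 (fun u => u * _)).
by rewrite -[X in _ = X * _](rmorph_nat iotac) -[RHS]rmorphM mulrA.
Qed.

Lemma xF i : (0 < i < 2 * r)%N ->
  Lc eta iotac (link_coef K r i) =
    if (i < r)%N then 1 else if i == r then 2 else - 1.
Proof.
move=> hi; have hl := linkE hi; rewrite /link_coef ifF; last by apply/negbTE;
  lia.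
by rewrite /Lc; case: ifP => _; [|case: ifP => _];
  rewrite ?rmorphN ?rmorph1 // !rmorph_nat.
Qed.

Lemma sF i : Lc eta iotac (col_coef K r i) =
  if (i < r)%N then - 1 else if i == r then Lc eta iotac (- 2^-1) else 1.
Proof. by rewrite /col_coef /Lc; case: ifP => _; [|case: ifP => _];
  rewrite ?rmorphN ?rmorph1. Qed.

Lemma hF : Lc eta iotac (- 2^-1) * 2 = - 1.
Proof.
rewrite /Lc -(rmorph_nat iotac) -(rmorph_nat eta) -!rmorphM mulNr mulVf
  ?pnatr_eq0 //.
by rewrite !rmorphN !rmorph1.
Qed.

Lemma vF_raise m i : (0 < m < 2 * r)%N ->
  vF m.+1 i = Lc eta iotac (col_coef K r m) *
    raise r Fe Fmu (fun i => Lc eta iotac (link_coef K r i)) (link m) (vF m) i.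
Proof.
move=> hm; apply: (colv_raise r0 FmuE xF sF hF) => // {hm i}m i hm hi.
have hl := linkE hm.
have lE b : (0 < b <= r)%N -> lres (fbasic D b lz) = Fe b :> L.
  move=> hb; rewrite -iota_z lres_fbasic //; apply: eq_bigr => k _.
  by rewrite mul1r -iotacE.
have bE b : (0 < b <= r)%N -> fbasic D b lz = Fb b :> L.
  by move=> hb; rewrite FbE ?iota_yl ?link_le //;
    [case/andP: hb => _ ->|case/andP: hb..|lia].
rewrite [frow _ _ _ _]/= eqSS /lcomm; case: ltngtP => mr.
- have hmr : (0 < m <= r)%N by lia.
  by rewrite lE // bE.
- have -> : iprime r m.+1 = link m by rewrite link_gt // /iprime subSS.
  have e2 : fbasic D (link m) (lz + (link m)%:R - r%:R - 1) = Fb m :> L.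
    by rewrite FbE // iota_yl leqNgt mr.
  by rewrite /= e2 lE // bE.
- rewrite mr lE ?bE ?r0 ?leqnn //; case: eqP => // _.
  rewrite -Lc_half [Lc eta iotac _]iotacE; exact: eta_central.
Qed.

Lemma lqs_iota b (k : 'I_(a b)) x : lqs true k * iota x = iota (sg true k x) *
  lqs true k.
Proof. exact: lq_iota. Qed.

Definition sideE : side L r.
Proof.
apply: (@lax_side K C eta r a p sg zs z r0 a0 sgp sg_eta sg_z pU zU szr L iota
  (lqs true) (lqs false) (@e_coef C r a p) (@f_coef K C eta r a p zs) _ _ _ _ _
    _ _ _ _ _ vE
  (colv1 _) vE_raise).
- exact: lqs_iota.
- by move=> b k x; apply: (iota_lq false k x).
- by move=> b k x; apply: (lq_iota false k x).
- by move=> b k; apply: (lqK K r true k).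
- by move=> b k; apply: (lqK K r false k).
- by move=> b k j l; apply: lq_lq.
- exact: eta_central.
- by [].
- move=> b l j m hb hj; apply: sgGU_exchange => //; exact: a0.
- move=> b k j l; apply: sgG_far => //; exact: a0.
Defined.

Definition sideF : side L^c r.
Proof.
apply: (@lax_side K C eta r a p sg zs z r0 a0 sgp sg_eta sg_z pU zU szr L^c
  iotac
  (lqsc false) (lqsc true) (@f_coef K C eta r a p zs) (@e_coef C r a p) _ _ _ _
    _ _ _ _ _ _ vF
  (colv1 _) vF_raise).
- by move=> b k x; rewrite !iotacE; apply: (iota_lq false k x).
- by move=> b k x; rewrite !iotacE; apply: (lq_iota true k x).
- by move=> b k x; rewrite !iotacE; apply: (iota_lq true k x).
- by move=> b k; apply: (lqK K r true k).
- by move=> b k; apply: (lqK K r false k).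
- by move=> b k j l; apply: lq_lq.
- by move=> x v; rewrite iotacE; symmetry; apply: eta_central.
- by move=> b k; rewrite mulrC.
- move=> b l j m hb hj lm; rewrite mulrC [RHS]mulrC; apply: sgGU_exchange => //;
    first exact: a0.
  by rewrite eq_sym [X in _ && X]eq_sym.
- move=> b k j l; apply: sgU_far => //; exact: a0.
Defined.


Local Notation hC := (hdiag eta r p zs z).

Lemma lp_regular i (k : 'I_(a i)) : regular (lp k).
Proof. exact: regular_lcst. Qed.

Lemma const_regular x : const x -> regular (iota x).
Proof. by move=> [c ->]; apply: regular_lcst. Qed.

Lemma Ee_regular j : regular (se sideE j).
Proof.
apply: regular_sum => k; apply: regularM; last exact: regular_lcst.
by rewrite mul1r; apply/const_regular/const_G.
Qed.

Lemma Ef_regular j : regular (sf sideE j).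
Proof.
apply: regular_sum => k; apply: regularM; first exact: regular_lcst.
by apply/const_regular/const_U.
Qed.

Lemma se_sideF j : se sideF j = sf sideE j.
Proof. by apply: eq_bigr => k _; rewrite mul1r iotacE. Qed.

Lemma sf_sideF j : sf sideF j = se sideE j.
Proof. by apply: eq_bigr => k _; rewrite mul1r iotacE. Qed.

Lemma hC1 : regular (iota (hC 1)).
Proof.
rewrite /= iota_P iota_z; apply: (big_ind (@regular _)).
- by rewrite -(rmorph1 (@lcst _)); apply: regular_lcst.
- exact: regularM.
- by move=> k _; apply: regularB; [apply: regular_lz|apply: lp_regular].
Qed.

Lemma lax_regular m n : (0 < m <= 2 * r)%N -> (0 < n <= 2 * r)%N ->
  regular (\sum_(i < (2 * r).+1) (vF m i : L) * (iota (hC i) * vE n i)).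
Proof.
apply: (@lax_mem L r sideE sideF (fun i => iota (hC i)) (@regular _)).
- exact: se_sideF.
- exact: sf_sideF.
- by move=> i; apply: iotacE.
- by move=> i; apply: iotacE.
- by move=> i; rewrite -rmorphM hC_next rmorphM.
- by move=> i; rewrite -!rmorphM mulrC.
- move=> j i hj; rewrite -se_sideF.
  have := @hC_Le K C eta r a p sg zs z r0 a0 sgp sg_eta sg_z zU L^c iotac
    (lqsc false)
    (@f_coef K C eta r a p zs) _ j i hj.
  have qC b (k : 'I_(a b)) x : lqsc false k * iotac x = iotac (sg true k x) *
    lqsc false k.
    by rewrite !iotacE; apply: (iota_lq false k x).
  move/(_ qC); rewrite iotacE mulNr -mulrN => h; exact: h.
- move=> j i hj.
  apply: (@hC_Le K C eta r a p sg zs z r0 a0 sgp sg_eta sg_z zU L iota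
    (lqs true)
    (@e_coef C r a p) _ j i hj); exact: lqs_iota.
- exact: regular0.
- exact: regularB.
- exact: regularM.
- by move=> u [x ->]; apply/const_regular/const_eta.
- by move=> u [x ->]; rewrite /Lc iotacE; apply/const_regular/const_eta.
- exact: Ee_regular.
- exact: Ef_regular.
- exact: hC1.
Qed.


(** Keeps the signs of the divisor, unlike [Zprod]; they can differ from 1 only in colour 0. *)
Definition ZfunC (b : nat) (y : C) : C :=
  \prod_(s < dsize D | dind s == b :> nat) (y - eta (dpt s)) ^ dsgn s.

Lemma zn_unit x (n : int) : const x -> z + n%:~R - x \is a GRing.unit.
Proof.
move=> hx; rewrite -addrA -[n%:~R - _]opprB; apply: z_unit.
exact: constB hx (const_int _).
Qed.

Lemma P_unit j (n : int) : P j (z + n%:~R) \is a GRing.unit.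
Proof. by apply: rpred_prod => k _; apply: zU. Qed.

Lemma Zc_unit b (n : int) : ZfunC b (z + n%:~R) \is a GRing.unit.
Proof. by apply: rpred_prod => s _; rewrite unitrXz // zn_unit //;
  apply: const_eta. Qed.

Lemma iota_Zc b (n : int) : iota (ZfunC b (z + n%:~R)) =
  Zfun D b (iota (z + n%:~R)).
Proof.
rewrite rmorph_prod; apply: eq_bigr => s _.
have u : z + n%:~R - eta (dpt s) \is a GRing.unit by apply/zn_unit/const_eta.
rewrite -iota_eta -rmorphB; case: (dsgnP s) => [->|[_ ->]];
  first by rewrite !expr1z.
by rewrite !exprN1 iota_inv.
Qed.

Lemma ZcE b y : (0 < b)%N -> ZfunC b y = Zp b y.
Proof.
move=> b0; rewrite /Zprod big_map big_filter ?big_enum_cond ?enumT.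
apply: eq_bigr => s /eqP sb.
by case: (dsgnP s) => [->|[d0 _]]; [rewrite expr1z|move: b0; rewrite -sb d0].
Qed.

Definition hbasicC (n : nat) (y : C) : C :=
  (if (n <= r)%N then P n y / P n.-1 (y - 1) else P r.-1 (y - 2) / P r (y - 2))
  * \prod_(0 <= k < n) ZfunC k y.

Lemma hb_unit m (n : int) : hbasicC m (z + n%:~R) \is a GRing.unit.
Proof.
have e1 : z + n%:~R - 1 = z + (n - 1)%:~R by rewrite rmorphB addrA.
have e2 : z + n%:~R - 2 = z + (n - 2)%:~R by rewrite rmorphB addrA.
rewrite unitrM; apply/andP; split.
  by case: ifP => _; rewrite ?e1 ?e2 unitrM unitrV !P_unit.
by apply: rpred_prod => k _; apply: Zc_unit.
Qed.

Lemma iota_hb m (n : int) : iota (hbasicC m (z + n%:~R)) =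
  hbasic D m (iota (z + n%:~R)).
Proof.
have e1 : z + n%:~R - 1 = z + (n - 1)%:~R by rewrite rmorphB addrA.
have e2 : z + n%:~R - 2 = z + (n - 2)%:~R by rewrite rmorphB addrA.
rewrite rmorphM rmorph_prod; apply: eq_mulL.
  case: ifP => _; rewrite iota_div ?e1 ?e2 ?P_unit // !iota_P.
    by rewrite -e1 rmorphB rmorph1.
  by rewrite -e2 rmorphB rmorph_nat.
by apply: eq_bigr => k _; apply: iota_Zc.
Qed.

Lemma hb_next m (n : int) : (0 < m <= r)%N ->
  hbasicC m.+1 (z + n%:~R) = hbasicC m (z + n%:~R) * kf m (z + n%:~R).
Proof.
move=> hm; set y := z + n%:~R.
have e1 : y - 1 = z + (n - 1)%:~R by rewrite rmorphB addrA.
have e2 : y - 2 = z + (n - 2)%:~R by rewrite rmorphB addrA.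
have u0 j : P j y \is a GRing.unit by apply: P_unit.
have u1 j : P j (y - 1) \is a GRing.unit by rewrite e1 P_unit.
have u2 j : P j (y - 2) \is a GRing.unit by rewrite e2 P_unit.
have m0 : (0 < m)%N by case/andP: hm.
rewrite /hbasicC big_nat_recr //= ZcE // /hratio /numer /pstep.
have -> : (m <= r)%N by case/andP: hm.
case: eqP => [mr|mr].
  rewrite ifF; last by apply/negbTE; lia.
  subst m; set Q := \prod_(_ <= _ < _) _.
  rewrite !invrM //; apply/eqP; rewrite -subr_eq0; apply/eqP.
  transitivity (P r.-1 (y - 2) / P r (y - 2) * (Q * Zp r y) *
     (1 - (P r y / P r y) * (P r.-1 (y - 1) / P r.-1 (y - 1)))); first by ring.
  by rewrite !divrr // mulr1 subrr mulr0.
rewrite ifT; last by lia.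
rewrite /= !invrM //; set Q := \prod_(_ <= _ < _) _; apply/eqP;
  rewrite -subr_eq0; apply/eqP.
transitivity (P m.+1 y / P m (y - 1) * (Q * Zp m y) *
     (1 - (P m y / P m y) * (P m.-1 (y - 1) / P m.-1 (y - 1)))); first by ring.
by rewrite !divrr // mulr1 subrr mulr0.
Qed.


Definition hentryC (n : nat) : C :=
  if (n <= r.+1)%N then hbasicC n z else
  let i := iprime r n in
  (hbasicC i (z + i%:R - r%:R - 1))^-1
  * \prod_(i.+1 <= j < r)
    (hbasicC j (z + j%:R - r%:R - 2) / hbasicC j (z + j%:R - r%:R - 1))
  * hbasicC r (z - 2) * hbasicC r.+1 z.

Let zE : z = z + 0%:~R. Proof. by rewrite addr0. Qed.
Let z2E : z - 2 = z + (- 2)%:~R. Proof. by []. Qed.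
Let zjE j m : z + j%:R - r%:R - m%:R = z + (j%:Z - r%:Z - m%:Z)%:~R.
Proof. by rewrite !rmorphB /= !addrA. Qed.

Lemma iota_zj j m : iota (z + j%:R - r%:R - m%:R) = lz + j%:R - r%:R - m%:R.
Proof. by rewrite !rmorphB rmorphD !rmorph_nat iota_z. Qed.

Lemma iota_hent n : iota (hentryC n) = hentry D a n.
Proof.
have h1 m : iota (hbasicC m z) =
  hbasic D m lz by rewrite {1}zE iota_hb -zE iota_z.
rewrite /hentryC /hentry; case: ifP => _ //.
rewrite rmorphM h1 rmorphM z2E iota_hb -z2E rmorphB rmorph_nat iota_z.
apply: eq_mulL => //; apply: eq_mulL => //.
rewrite rmorphM rmorph_prod; apply: eq_mulL.
  rewrite -[1 in LHS]/(1%:R) zjE iota_inv ?hb_unit // iota_hb -zjE iota_zj //.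
apply: eq_bigr => j _.
rewrite -[1 in LHS]/(1%:R) !zjE iota_div ?hb_unit // !iota_hb -!zjE !iota_zj.
by [].
Qed.

(** For [n > r] put [j = link n] and [y = z + j - r - 1]. Passing from [h_((j+1)')] to [h_(j')], the
    new factor of the product cancels the old inverse and leaves [h_(j+1)(y) / h_j(y)]. For
    [n = r + 1] the product is empty and [h_r(z - 2)] supplies the numerator. *)
Lemma hent_next n : (0 < n < 2 * r)%N -> hentryC n.+1 = hentryC n *
  kf (link n) (yl n).
Proof.
move=> hn; have hl := linkE hn; have [nr|nr] := leqP n r.
  rewrite /hentryC !ifT ?link_le ?yl_small //; [|lia..].
  have hn' : (0 < n <= r)%N by lia.
  by have := hb_next 0 hn'; rewrite -zE.
have lE : link n = (2 * r - n)%N by rewrite link_gt.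
have iE : iprime r n.+1 = link n by rewrite lE /iprime subSS.
have yE : yl n = z + (link n)%:R - r%:R - 1%:R by rewrite /link_pt leqNgt nr.
have lr : (link n < r)%N by lia.
have hbn (j m : nat) : hbasicC j (z + j%:R - r%:R - m%:R) \is a GRing.unit
  by rewrite zjE hb_unit.
rewrite [hentryC n.+1]/hentryC ifF; last by apply/negbTE; lia.
have yE' : yl n = z + ((link n)%:Z - r%:Z - 1%:Z)%:~R by rewrite yE zjE.
have hy : hbasicC (link n).+1 (yl n) = hbasicC (link n) (yl n) *
  kf (link n) (yl n).
  by rewrite yE' hb_next.
have uy : hbasicC (link n) (yl n) \is a GRing.unit by rewrite yE' hb_unit.
rewrite iE /= -[1]/(1%:R) -yE; have [n1|n1] := leqP n r.+1.
  have lE' : (link n).+1 = r by lia.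
  have e2 : z - 2 = yl n by rewrite yE -{2}lE' -addn1 natrD; ring.
  have -> : hentryC n = hbasicC r.+1 z.
    by rewrite /hentryC n1; congr hbasicC; lia.
  have hy' : hbasicC r (yl n) = hbasicC (link n) (yl n) *
    kf (link n) (yl n) by rewrite -hy lE'.
  by rewrite big_geq ?lE' // mulr1 e2 hy' mulKr // mulrC.
have iE' : iprime r n = (link n).+1 by rewrite lE /iprime; lia.
rewrite /hentryC ifF; last by apply/negbTE; lia.
rewrite iE' /= big_ltn; last by lia.
have e2 : z + ((link n).+1)%:R - r%:R - 2 = yl n by rewrite yE -addn1 natrD;
  ring.
rewrite e2 hy; set Q := \prod_(_ <= _ < _) _.
set X := hbasicC (link n).+1 _; set h := hbasicC (link n) _; set k := kf _ _.
transitivity ((h / h) * (X^-1 * Q * hbasicC r (z - 2) * hbasicC r.+1 z * k));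
  last by rewrite divrr ?mul1r.
by ring.
Qed.

Lemma P_0 y : P 0 y = 1.
Proof. by apply: big1 => -[k kl]; exfalso; move: (kl); rewrite a0. Qed.

Lemma hent_hC n : (0 < n <= 2 * r)%N -> hentryC n = ZfunC 0 z * hC n.
Proof.
elim: n => // -[_ _|n IH hn].
  have -> : hentryC 1 = hbasicC 1 z by [].
  by rewrite /hbasicC r0 big_nat1 P_0 divr1 mulrC.
rewrite hent_next ?IH; [|lia..].
rewrite [hC n.+2]/= ifF ?mulrA //; apply/negbTE.
by have := @linkE r n.+1 ltac:(lia); lia.
Qed.

Theorem Tmx_regular : exists T : 'M[{poly osc K r a}]_(2 * r),
  Tmx_normalized D a = map_mx (@lpoly (osc K r a)) T.
Proof.
pose Z0 : L := Zfun D 0 lz.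
have Z0E : iota (ZfunC 0 z) = Z0 by have := iota_Zc 0 0; rewrite -zE iota_z.
have Z0U : Z0 \is a GRing.unit.
  by rewrite -Z0E rmorph_unit // zE Zc_unit.
(* [Z_0] involves only [z] and scalars, so its inverse can be moved past [F] onto [H]. *)
have Z0C y : Z0 * y = y * Z0.
  apply: (big_ind (fun f : L => f * y = y * f)) => [|f g hf hg|s _].
  - by rewrite mul1r mulr1.
  - by rewrite -mulrA hg !mulrA hf.
  - have h : (lz - lcst (dpt s)%:A) * y = y * (lz - lcst (dpt s)%:A).
      by rewrite mulrBl mulrBr lzC scalar_central.
    by apply/commr_sym/commrXz/commr_sym.
have Z0h n : (0 < n <= 2 * r)%N -> Z0^-1 * hentry D a n = iota (hC n).
  by move=> hn; rewrite -iota_hent hent_hC // rmorphM Z0E mulKr.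
have reg (i j : 'I_(2 * r)) : regular (Tmx_normalized D a i j).
  have -> : Tmx_normalized D a i j =
     \sum_(k < (2 * r).+1) (vF i.+1 k : L) * (iota (hC k) * vE j.+1 k).
    (* The sum of [lax_regular] has an extra row 0, where the padded columns vanish. *)
    rewrite big_ord_recl [X in _ = X + _](_ : _ = 0) ?add0r; last exact: mul0r.
    rewrite mxE /Tmx mul_mx_diag mxE mulr_sumr; apply: eq_bigr => k _.
    rewrite lift0 -Z0h ?ltn_ord //.
    have -> : (\matrix_(i0, j0)
      (Fmx D a i0 j0 * (\row_i1 hentry D a i1.+1) 0 j0)) i k
      = Fmx D a i k * hentry D a k.+1 by rewrite !mxE.
    have -> : Fmx D a i k = vF i.+1 k.+1.
      by rewrite mxE /vF colvSS eq_sym -(inj_eq val_inj).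
    have -> : Emx K r a k j = vE j.+1 k.+1.
      by rewrite mxE /vE colvSS -(inj_eq val_inj).
    have Z0VC y : Z0^-1 * y = y * Z0^-1 by apply/commr_sym/commrV/commr_sym/Z0C.
    by rewrite -/Z0 !mulrA Z0VC.
  apply: lax_regular; exact: ltn_ord.
exists (\matrix_(i, j) projT1 (cid (reg i j))).
by apply/matrixP => i j; rewrite [RHS]mxE [in RHS]mxE; case: cid.
Qed.

End Assembly.

(** The abstract ring [C] is realised by the double centralizer [dsub], embedded in [L] and in its
    opposite by the same map, with conjugation by [e^q] as shifts. *)
Theorem Tmx_normalized_regular (K : numClosedFieldType) (r : nat)
  (D : divisor r K) (a : nat -> nat) :
  (0 < r)%N -> assumptionA D a ->
  exists T : 'M[{poly osc K r a}]_(2 * r),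
    Tmx_normalized D a = map_mx (@lpoly (osc K r a)) T.
Proof.
move=> r0 hA.
apply: (@Tmx_regular K r D a r0 hA (dsub K r a : comUnitRingType)
  (@dval K r a : {rmorphism _ -> _}) (@dvalc K r a : {rmorphism _ -> _})
  (@deta K r a : {rmorphism _ -> _}) (@dp K r a) (@dsg K r a) (dz K r a)) => //.
- by move=> s i k x; apply: lq_dval.
- by move=> s i k x; apply: dval_lq.
- by move=> s b k j l; apply: dsg_dp.
- by move=> s b k x; apply: dsg_deta.
- by move=> s b k; apply: dsg_dz.
- by move=> b k l n kl; case: (@dp_sub_unit K r a b k l n kl).
- by move=> b k l n kl; case: (@dp_sub_unit K r a b k l n kl).
- by move=> x; apply: dz_sub_unit.
Qed.

Unset Implicit Arguments.
Local Open Scope complex_scope.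

Theorem theorem3p31 (R : realType) (r : nat) (D : divisor r R[i])
    (a : nat -> nat) :
  (0 < r)%N -> assumptionA D a ->
  exists T : 'M[{poly osc R[i] r a}]_(2 * r),
    Tmx_normalized D a = map_mx (@lpoly (osc R[i] r a)) T.
Proof. exact: Tmx_normalized_regular. Qed.
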